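(* Let $c>0$ be real. For every $s\in\mathbb{C}$ with $\Re(s)>1$ and every $x\in\mathbb{R}$ with $|x|\le c$, $$\sum_{n=1}^{\infty}\frac{(-1)^{n-1}}{n^s}\cos\frac{n\pi x}{c}=\sum_{k=0}^{\infty}\frac{(-1)^k}{(2k)!}\left(\frac{\pi x}{c}\right)^{2k}\eta(s-2k).$$
   Context: $\eta(s)$ is the alternating zeta function, the entire function that equals $\sum_{n\ge1}(-1)^{n-1}n^{-s}$ for $\Re(s)>0$. *)

(* Defs.v *)
From Stdlib Require Import Reals.
From Coquelicot Require Import Coquelicot.

Local Open Scope R_scope.

Definition Cexp (z : C) : C :=
  (exp (Re z) * cos (Im z), exp (Re z) * sin (Im z)).

(* Only meaningful for n >= 1, since Stdlib sets [ln 0 = 0]. *)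
Definition nat_Cpower (n : nat) (s : C) : C :=
  Cexp (s * RtoC (ln (INR n)))%C.

Definition entire (f : C -> C) : Prop :=
  forall z : C, @ex_derive C_AbsRing C_NormedModule f z.

(* These two properties determine [eta] uniquely, by the identity theorem.
   [is_series] starts at index 0, so its index m stands for n = m + 1; it is
   the limit of partial sums, as is needed for 0 < Re s <= 1, where the
   convergence is only conditional. *)
Definition is_alternating_zeta (eta : C -> C) : Prop :=
  entire eta /\
  forall s : C, 0 < Re s ->
    @is_series C_AbsRing C_NormedModule
      (fun m : nat => RtoC ((-1) ^ m) / nat_Cpower (S m) s)%C (eta s).

(* Main.v *)
Require Import Defs.
From Stdlib Require Import Reals Factorial Lra Lia ClassicalEpsilon FunctionalExtensionality.
From Coquelicot Require Import Coquelicot.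

Local Open Scope R_scope.

(** Lindelöf's integral [1/2 * int w^-s cos (th w) / cosh (PI t) dt] over the line
    [w = 1/2 + i t], where [cosh (PI t) = sin (PI w)], is the sum of the terms
    [(-1)^(n-1) n^-s cos (n th)] when [Re s > 1] and [|th| <= PI]: moving the line from
    [Re w = n - 1/2] to [Re w = n + 1/2] picks up the [n]-th term as a residue, and the
    integral over the [n]-th line tends to 0.  For [th = 0] the integral converges for
    all [s] and is entire, hence equals [eta s] everywhere by unique continuation.
    Expanding [cos (th w)] into its Taylor series and using [w^-s w^(2k) = w^-(s-2k)]
    gives the right-hand side; the exchange of sum and integral is dominated by
    [exp (PI |w|) |w|^-Re s / cosh (PI t)], which is integrable even for [|th| = PI]
    because [Re s > 1].

    Complex differentiability at every point is all that is known of [eta], so unique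
    continuation rests on Goursat's bisection argument.  It is used in the form that
    allows one exceptional point near which the function is merely bounded: this yields both
    Cauchy's formula (for unique continuation) and the residue step above. *)

(** * Complex derivatives *)

(** The half-integer abscissas are chosen because on those lines the sine is, up to sign,
    [cosh (PI t)], and the reciprocal of this positive function has integral 1 over the line. This
    turns the residue step into Poisson's formula for a strip: once the value at the centre is
    subtracted, the integrand is bounded near its only singularity, the rectangle theorem with one
    exceptional point applies, and the total mass 1 restores the subtracted value. The sine has
    opposite signs on neighbouring lines, so two consecutive integrals add up to twice a term of the
    series and the alternating sum telescopes.

    The delicate case is |th| = PI, where the cosine grows exactly like [cosh (PI t)] and all decay
    must come from w^(-s). Both passages to the limit, along the lines and along the Taylor
    polynomials, therefore use a constant times (1 + |t|)^(- Re s) as majorant, uniformly in the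
    index.

    For large k the point s - 2k lies outside the half-plane in which the series of [eta] is given.
    Estimates on the line Re w = 1/2 must therefore also cover negative Re s, where only the decay
    of 1 / cosh can give convergence. *)

Definition Cderiv (f : C -> C) (z l : C) : Prop :=
  forall eps, 0 < eps -> exists d, 0 < d /\
    forall h, Cmod h < d -> Cmod (f (z + h) - f z - l * h)%C <= eps * Cmod h.

Definition Cdiff (f : C -> C) (z : C) : Prop := exists l, Cderiv f z l.

Definition Ccont (f : C -> C) (z : C) : Prop :=
  forall eps, 0 < eps -> exists d, 0 < d /\
    forall h, Cmod h < d -> Cmod (f (z + h) - f z)%C <= eps.

Lemma Cplus_minus (a b : C) : (a + (b - a))%C = b.
Proof. ring. Qed.

Lemma Cderiv_is_derive (f : C -> C) (z l : C) :
  Cderiv f z l <-> @is_derive C_AbsRing (AbsRing_NormedModule C_AbsRing) f z l.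
Proof.
  split.
  - intros H. split; [apply is_linear_scal_l |].
    intros x Hx eps.
    assert (E : z = x)
      by (apply (@is_filter_lim_locally_unique C_AbsRing (AbsRing_NormedModule C_AbsRing)); exact Hx).
    subst x.
    destruct (H eps (cond_pos eps)) as [d [Hd H1]].
    exists (mkposreal d Hd); intros y Hy.
    change (Cmod (y - z)%C < d) in Hy.
    specialize (H1 _ Hy).
    rewrite Cplus_minus in H1.
    change (Cmod (f y - f z - (y - z) * l)%C <= eps * Cmod (y - z)%C).
    rewrite (Cmult_comm (y - z)). exact H1.
  - intros [_ H] eps Heps.
    destruct (H z (fun P HP => HP) (mkposreal eps Heps)) as [d H1].
    exists d; split; [apply cond_pos |]; intros h Hh.
    specialize (H1 (z + h)%C).
    assert (E : (z + h - z)%C = h) by ring.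
    assert (H2 : @ball (AbsRing_UniformSpace C_AbsRing) z d (z + h)%C).
    { change (Cmod (z + h - z)%C < d). now rewrite E. }
    specialize (H1 H2).
    change (Cmod (f (z + h) - f z - (z + h - z) * l)%C <= eps * Cmod (z + h - z)%C) in H1.
    rewrite E in H1. now rewrite (Cmult_comm l).
Qed.

(** Product and chain rules come from the ring as a module over itself, whereas [entire] uses
    [C_NormedModule]. The two norms coincide, so only linearity of the differential has to be proved
    again. *)
Lemma Cderiv_is_derive_NormedModule (f : C -> C) (z l : C) :
  Cderiv f z l <-> @is_derive C_AbsRing C_NormedModule f z l.
Proof.
  rewrite Cderiv_is_derive. split; intros [H1 H2]; (split; [apply is_linear_scal_l | exact H2]).
Qed.

Lemma Cdiff_ex_derive (f : C -> C) (z : C) :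
  Cdiff f z <-> @ex_derive C_AbsRing C_NormedModule f z.
Proof. split; intros [l H]; exists l; now apply Cderiv_is_derive_NormedModule. Qed.

Lemma Cderiv_const c z : Cderiv (fun _ => c) z 0.
Proof. apply Cderiv_is_derive, @is_derive_const. Qed.

Lemma Cderiv_id z : Cderiv (fun w => w) z 1.
Proof. apply Cderiv_is_derive, @is_derive_id. Qed.

Lemma Cderiv_plus f g z l m :
  Cderiv f z l -> Cderiv g z m -> Cderiv (fun w => f w + g w)%C z (l + m)%C.
Proof. rewrite !Cderiv_is_derive. apply @is_derive_plus. Qed.

Lemma Cderiv_minus f g z l m :
  Cderiv f z l -> Cderiv g z m -> Cderiv (fun w => f w - g w)%C z (l - m)%C.
Proof. rewrite !Cderiv_is_derive. apply @is_derive_minus. Qed.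

Lemma Cderiv_mult f g z l m :
  Cderiv f z l -> Cderiv g z m ->
  Cderiv (fun w => f w * g w)%C z (l * g z + f z * m)%C.
Proof.
  rewrite !Cderiv_is_derive. intros H1 H2.
  apply (@is_derive_mult C_AbsRing f g z l m); auto.
  intros; apply Cmult_comm.
Qed.

Lemma Cderiv_comp f g z l m :
  Cderiv f (g z) l -> Cderiv g z m -> Cderiv (fun w => f (g w)) z (l * m)%C.
Proof.
  rewrite !Cderiv_is_derive. intros H1 H2. rewrite Cmult_comm.
  apply (@is_derive_comp C_AbsRing (AbsRing_NormedModule C_AbsRing) f g z l m); auto.
Qed.

Lemma Cdiff_const c z : Cdiff (fun _ => c) z.
Proof. eexists; apply Cderiv_const. Qed.
Lemma Cdiff_id z : Cdiff (fun w => w) z.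
Proof. eexists; apply Cderiv_id. Qed.
Lemma Cdiff_plus f g z : Cdiff f z -> Cdiff g z -> Cdiff (fun w => f w + g w)%C z.
Proof. intros [l H] [m H']; eexists; eapply Cderiv_plus; eauto. Qed.
Lemma Cdiff_minus f g z : Cdiff f z -> Cdiff g z -> Cdiff (fun w => f w - g w)%C z.
Proof. intros [l H] [m H']; eexists; eapply Cderiv_minus; eauto. Qed.
Lemma Cdiff_mult f g z : Cdiff f z -> Cdiff g z -> Cdiff (fun w => f w * g w)%C z.
Proof. intros [l H] [m H']; eexists; eapply Cderiv_mult; eauto. Qed.
Lemma Cdiff_comp f g z : Cdiff f (g z) -> Cdiff g z -> Cdiff (fun w => f (g w)) z.
Proof. intros [l H] [m H']; eexists; eapply Cderiv_comp; eauto. Qed.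

Lemma Cmod_lower a b : Cmod a - Cmod b <= Cmod (a + b)%C.
Proof.
  assert (H := Cmod_triangle (a + b) (- b)).
  replace (a + b + - b)%C with a in H by ring. rewrite Cmod_opp in H. lra.
Qed.

Lemma Cmod_minus_sym a b : Cmod (a - b)%C = Cmod (b - a)%C.
Proof. rewrite <- Cmod_opp. now rewrite Copp_minus_distr. Qed.

Lemma Cderiv_inv (z : C) : z <> 0 -> Cderiv Cinv z (- (/ (z * z)))%C.
Proof.
  intros Hz eps Heps.
  assert (P : 0 < Cmod z) by now apply Cmod_gt_0.
  assert (P3 : 0 < Cmod z ^ 3) by now apply pow_lt.
  (* The first bound keeps |z + h| above |z| / 2, so the error is at most 2 |h|^2 / |z|^3; the
     second bound makes this at most eps |h|. *)
  exists (Rmin (Cmod z / 2) (eps * Cmod z ^ 3 / 2)); split.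
  { apply Rmin_glb_lt; [lra|]. apply Rdiv_lt_0_compat; [|lra]. now apply Rmult_lt_0_compat. }
  intros h Hh.
  assert (Hh1 := Rlt_le_trans _ _ _ Hh (Rmin_l _ _)).
  assert (Hh2 := Rlt_le_trans _ _ _ Hh (Rmin_r _ _)).
  assert (Q : Cmod z / 2 <= Cmod (z + h)%C).
  { assert (H := Cmod_lower z h). lra. }
  assert (Hzh : (z + h)%C <> 0).
  { apply Cmod_gt_0. lra. }
  replace (/ (z + h) - / z - - / (z * z) * h)%C with (h * h / (z * z * (z + h)))%C
    by (field; auto).
  rewrite Cmod_div by (repeat apply Cmult_neq_0; auto).
  rewrite !Cmod_mult.
  apply Rle_trans with (Cmod h * Cmod h / (Cmod z * Cmod z * (Cmod z / 2))).
  - apply Rmult_le_compat_l; [apply Rmult_le_pos; apply Cmod_ge_0|].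
    apply Rinv_le_contravar; [repeat apply Rmult_lt_0_compat; lra|].
    apply Rmult_le_compat_l; [|exact Q]. apply Rmult_le_pos; lra.
  - replace (Cmod h * Cmod h / (Cmod z * Cmod z * (Cmod z / 2)))
      with (Cmod h * (Cmod h * (2 / Cmod z ^ 3))) by (field; lra).
    rewrite (Rmult_comm eps). apply Rmult_le_compat_l; [apply Cmod_ge_0|].
    apply Rle_trans with (eps * Cmod z ^ 3 / 2 * (2 / Cmod z ^ 3)).
    + apply Rmult_le_compat_r; [|lra]. apply Rlt_le, Rdiv_lt_0_compat; lra.
    + right; field; lra.
Qed.

Lemma Cdiff_inv (f : C -> C) z : f z <> 0 -> Cdiff f z -> Cdiff (fun w => / f w)%C z.
Proof.
  intros H H'. apply (Cdiff_comp Cinv f); auto. eexists; now apply Cderiv_inv.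
Qed.
Lemma Cdiff_div (f g : C -> C) z : g z <> 0 -> Cdiff f z -> Cdiff g z -> Cdiff (fun w => f w / g w)%C z.
Proof. intros. apply Cdiff_mult; auto. now apply Cdiff_inv. Qed.

Lemma Cdiff_pow f z n : Cdiff f z -> Cdiff (fun w => f w ^ n)%C z.
Proof.
  intros H; induction n; simpl; [apply Cdiff_const | now apply Cdiff_mult].
Qed.

Lemma Cdiff_ext_loc f g z :
  (exists d, 0 < d /\ forall h, Cmod h < d -> f (z + h)%C = g (z + h)%C) ->
  Cdiff f z -> Cdiff g z.
Proof.
  intros [d [Hd E]] [l H]. exists l. intros eps Heps.
  destruct (H eps Heps) as [d' [Hd' H']].
  exists (Rmin d d'); split; [now apply Rmin_glb_lt|]. intros h Hh.
  assert (E0 : f z = g z).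
  { replace z with (z + 0)%C by ring. apply E. now rewrite Cmod_0. }
  rewrite <- E0, <- E.
  - apply H'. eapply Rlt_le_trans; [exact Hh | apply Rmin_r].
  - eapply Rlt_le_trans; [exact Hh | apply Rmin_l].
Qed.

Lemma Cderiv_lip f z l : Cderiv f z l ->
  exists d, 0 < d /\ forall h, Cmod h < d -> Cmod (f (z + h) - f z)%C <= (Cmod l + 1) * Cmod h.
Proof.
  intros H. destruct (H 1 Rlt_0_1) as [d [Hd H1]].
  exists d; split; auto; intros h Hh. specialize (H1 h Hh).
  replace (f (z + h) - f z)%C with ((f (z + h) - f z - l * h) + l * h)%C by ring.
  eapply Rle_trans; [apply Cmod_triangle|]. rewrite Cmod_mult. lra.
Qed.

Lemma Cdiff_cont f z : Cdiff f z -> Ccont f z.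
Proof.
  intros [l H] eps Heps. destruct (Cderiv_lip _ _ _ H) as [d [Hd H1]].
  assert (P : 0 < Cmod l + 1) by (generalize (Cmod_ge_0 l); lra).
  exists (Rmin d (eps / (Cmod l + 1))); split.
  { apply Rmin_glb_lt; auto. now apply Rdiv_lt_0_compat. }
  intros h Hh.
  eapply Rle_trans; [apply H1; eapply Rlt_le_trans; [exact Hh | apply Rmin_l]|].
  apply Rle_trans with ((Cmod l + 1) * (eps / (Cmod l + 1))).
  - apply Rmult_le_compat_l; [lra|]. eapply Rle_trans; [apply Rlt_le, Hh|apply Rmin_r].
  - right; field; lra.
Qed.

(** * Integrals of complex functions of a real variable *)

Definition RCcont (f : R -> C) (t : R) : Prop :=
  @continuous R_UniformSpace C_R_CompleteNormedModule f t.

Definition Cex (f : R -> C) a b : Prop := @ex_RInt C_R_NormedModule f a b.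
Definition CInt (f : R -> C) a b : C := @RInt C_R_CompleteNormedModule f a b.

Lemma norm_C_R (z : C) : @norm R_AbsRing C_R_NormedModule z = Cmod z.
Proof.
  unfold norm; simpl. unfold prod_norm, Cmod. 
  change (sqrt (Rabs (fst z) ^ 2 + Rabs (snd z) ^ 2) = sqrt (fst z ^ 2 + snd z ^ 2)).
  now rewrite !pow2_abs.
Qed.

Lemma Cmod_lt_ball (x y : C) (e : posreal) :
  Cmod (y - x)%C < e -> @ball C_UniformSpace x e y.
Proof. apply (C_NormedModule_mixin_compat1 x y e). Qed.

(** Balls of the product structure are squares, which costs a factor sqrt 2, rounded up to 2. *)
Lemma ball_Cmod_lt (x y : C) (e : posreal) :
  @ball C_UniformSpace x e y -> Cmod (y - x)%C < 2 * e.
Proof.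
  intros H. eapply Rlt_le_trans; [apply (C_NormedModule_mixin_compat2 x y e H)|].
  apply Rmult_le_compat_r; [apply Rlt_le, cond_pos|].
  rewrite <- (sqrt_square 2) at 2 by lra. apply sqrt_le_1; lra.
Qed.

Lemma RCcont_eps (f : R -> C) t :
  RCcont f t <-> forall eps, 0 < eps -> exists d, 0 < d /\
    forall u, Rabs (u - t) < d -> Cmod (f u - f t)%C <= eps.
Proof.
  split.
  - intros H eps Heps.
    assert (H2 : 0 < eps / 2) by lra.
    specialize (proj1 (filterlim_locally _ _) H (mkposreal _ H2)). intros [d Hd].
    exists d; split; [apply cond_pos|]. intros u Hu.
    specialize (Hd u Hu). apply ball_Cmod_lt in Hd. simpl in Hd. lra.
  - intros H. apply filterlim_locally. intros eps.
    assert (H2 : 0 < eps / 2) by (generalize (cond_pos eps); lra).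
    destruct (H _ H2) as [d [Hd H1]].
    exists (mkposreal d Hd). intros u Hu. apply Cmod_lt_ball.
    eapply Rle_lt_trans; [apply H1; exact Hu|]. generalize (cond_pos eps); lra.
Qed.

Lemma RCcont_comp (F : C -> C) (g : R -> C) t :
  Ccont F (g t) -> RCcont g t -> RCcont (fun u => F (g u)) t.
Proof.
  intros H Hg. apply RCcont_eps. intros eps Heps.
  destruct (H eps Heps) as [d [Hd H1]].
  assert (Hd2 : 0 < d / 2) by lra.
  destruct (proj1 (RCcont_eps _ _) Hg _ Hd2) as [d' [Hd' H2]].
  exists d'; split; auto. intros u Hu. specialize (H2 u Hu).
  rewrite <- (Cplus_minus (g t) (g u)). apply H1. lra.
Qed.

Lemma Cmod_R_le (x y : R) : Cmod (x, y) <= Rabs x + Rabs y.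
Proof.
  replace (x, y) with (RtoC x + Ci * RtoC y)%C.
  - eapply Rle_trans; [apply Cmod_triangle|]. rewrite Cmod_mult, Cmod_Ci, !Cmod_R. lra.
  - apply injective_projections; simpl; ring.
Qed.

Lemma RCcont_hor y t : RCcont (fun x => (x, y)) t.
Proof.
  apply RCcont_eps. intros eps Heps. exists eps; split; auto. intros u Hu.
  replace ((u, y) - (t, y))%C with (RtoC (u - t)).
  - rewrite Cmod_R. lra.
  - apply injective_projections; simpl; ring.
Qed.

Lemma RCcont_ver x t : RCcont (fun y => (x, y)) t.
Proof.
  apply RCcont_eps. intros eps Heps. exists eps; split; auto. intros u Hu.
  replace ((x, u) - (x, t))%C with (Ci * RtoC (u - t))%C.
  - rewrite Cmod_mult, Cmod_Ci, Cmod_R. lra.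
  - apply injective_projections; simpl; ring.
Qed.

Lemma RCcont_plus f g t : RCcont f t -> RCcont g t -> RCcont (fun u => f u + g u)%C t.
Proof. apply (@continuous_plus R_UniformSpace R_AbsRing C_R_NormedModule). Qed.
Lemma RCcont_minus f g t : RCcont f t -> RCcont g t -> RCcont (fun u => f u - g u)%C t.
Proof. apply (@continuous_minus R_UniformSpace R_AbsRing C_R_NormedModule). Qed.
Lemma RCcont_const c t : RCcont (fun _ => c) t.
Proof. apply (@continuous_const R_UniformSpace C_UniformSpace). Qed.

Lemma RCcont_RtoC (g : R -> R) t : continuous g t -> RCcont (fun u => RtoC (g u)) t.
Proof.
  intros H. apply RCcont_eps. intros eps Heps.
  destruct (proj1 (filterlim_locally _ _) H (mkposreal _ Heps)) as [d Hd].
  exists d; split; [apply cond_pos|]. intros u Hu. specialize (Hd u Hu).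
  rewrite <- RtoC_minus, Cmod_R. apply Rlt_le, Hd.
Qed.

Lemma RCcont_pair (g h : R -> R) t :
  continuous g t -> continuous h t -> RCcont (fun u => (g u, h u)) t.
Proof.
  intros H H'. apply RCcont_eps. intros eps Heps.
  assert (He : 0 < eps / 2) by lra.
  destruct (proj1 (filterlim_locally _ _) H (mkposreal _ He)) as [d Hd].
  destruct (proj1 (filterlim_locally _ _) H' (mkposreal _ He)) as [d' Hd'].
  exists (Rmin d d'); split; [apply Rmin_glb_lt; apply cond_pos|]. intros u Hu.
  specialize (Hd u (Rlt_le_trans _ _ _ Hu (Rmin_l _ _))).
  specialize (Hd' u (Rlt_le_trans _ _ _ Hu (Rmin_r _ _))).
  change (Rabs (g u - g t) < eps / 2) in Hd. change (Rabs (h u - h t) < eps / 2) in Hd'.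
  replace ((g u, h u) - (g t, h t))%C with (g u - g t, h u - h t).
  - eapply Rle_trans; [apply Cmod_R_le|]. lra.
  - apply injective_projections; simpl; ring.
Qed.

Lemma RCcont_fst f t : RCcont f t -> continuous (fun u => fst (f u)) t.
Proof.
  intros H. apply (filterlim_comp _ _ _ f fst _ _ _ H). apply (@continuous_fst R_UniformSpace R_UniformSpace).
Qed.
Lemma RCcont_snd f t : RCcont f t -> continuous (fun u => snd (f u)) t.
Proof.
  intros H. apply (filterlim_comp _ _ _ f snd _ _ _ H). apply (@continuous_snd R_UniformSpace R_UniformSpace).
Qed.

Lemma RCcont_mult f g t : RCcont f t -> RCcont g t -> RCcont (fun u => f u * g u)%C t.
Proof.
  intros Hf Hg. apply RCcont_pair.
  - apply (@continuous_minus R_UniformSpace R_AbsRing R_NormedModule);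
      apply (@continuous_mult R_UniformSpace R_AbsRing);
      auto using RCcont_fst, RCcont_snd.
  - apply (@continuous_plus R_UniformSpace R_AbsRing R_NormedModule);
      apply (@continuous_mult R_UniformSpace R_AbsRing);
      auto using RCcont_fst, RCcont_snd.
Qed.

Lemma Cex_cont f a b : (forall t, Rmin a b <= t <= Rmax a b -> RCcont f t) -> Cex f a b.
Proof. apply (@ex_RInt_continuous C_R_CompleteNormedModule). Qed.

Lemma Cex_cont_le f a b : a <= b -> (forall t, a <= t <= b -> RCcont f t) -> Cex f a b.
Proof.
  intros Hab H. apply Cex_cont. rewrite Rmin_left, Rmax_right by auto. auto.
Qed.

Lemma CInt_correct f a b : Cex f a b -> @is_RInt C_R_NormedModule f a b (CInt f a b).
Proof. apply (@RInt_correct C_R_CompleteNormedModule). Qed.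

Lemma CInt_unique f a b l : @is_RInt C_R_NormedModule f a b l -> CInt f a b = l.
Proof. apply (@is_RInt_unique C_R_CompleteNormedModule). Qed.

Lemma CInt_ext f g a b : a <= b -> (forall t, a < t < b -> f t = g t) -> CInt f a b = CInt g a b.
Proof.
  intros Hab H. apply (@RInt_ext C_R_CompleteNormedModule).
  rewrite Rmin_left, Rmax_right by auto. auto.
Qed.

Lemma CInt_plus f g a b : Cex f a b -> Cex g a b ->
  CInt (fun t => f t + g t)%C a b = (CInt f a b + CInt g a b)%C.
Proof. apply (@RInt_plus C_R_CompleteNormedModule). Qed.

Lemma CInt_minus f g a b : Cex f a b -> Cex g a b ->
  CInt (fun t => f t - g t)%C a b = (CInt f a b - CInt g a b)%C.
Proof. apply (@RInt_minus C_R_CompleteNormedModule). Qed.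

Lemma CInt_Chasles f a b c : Cex f a b -> Cex f b c ->
  (CInt f a b + CInt f b c)%C = CInt f a c.
Proof. apply (@RInt_Chasles C_R_CompleteNormedModule). Qed.

Lemma CInt_const c a b : CInt (fun _ => c) a b = (RtoC (b - a) * c)%C.
Proof.
  unfold CInt. rewrite (@RInt_const C_R_CompleteNormedModule).
  apply scal_R_Cmult.
Qed.
Lemma Cex_const c a b : Cex (fun _ => c) a b.
Proof. apply (@ex_RInt_const C_R_NormedModule). Qed.

Lemma is_RInt_C f a b l :
  @is_RInt C_R_NormedModule f a b l <->
  is_RInt (fun t => fst (f t)) a b (fst l) /\ is_RInt (fun t => snd (f t)) a b (snd l).
Proof.
  split.
  - intros H; split.
    + now apply (@is_RInt_fct_extend_fst R_NormedModule R_NormedModule).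
    + now apply (@is_RInt_fct_extend_snd R_NormedModule R_NormedModule).
  - intros [H1 H2]. destruct l as [l1 l2]. 
    apply (@is_RInt_fct_extend_pair R_NormedModule R_NormedModule); auto.
Qed.

(** A complex factor is not a scalar of the real module in which the integral lives, so linearity is
    checked on the components. *)
Lemma is_RInt_Cmult k f a b l :
  @is_RInt C_R_NormedModule f a b l ->
  @is_RInt C_R_NormedModule (fun t => k * f t)%C a b (k * l)%C.
Proof.
  rewrite !is_RInt_C. intros [H1 H2]. split; simpl.
  - apply (@is_RInt_minus R_NormedModule); now apply (@is_RInt_scal R_NormedModule).
  - apply (@is_RInt_plus R_NormedModule); now apply (@is_RInt_scal R_NormedModule).
Qed.

Lemma Cex_mult k f a b : Cex f a b -> Cex (fun t => k * f t)%C a b.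
Proof. intros [l H]. eexists. apply is_RInt_Cmult, H. Qed.

Lemma CInt_mult k f a b : Cex f a b -> CInt (fun t => k * f t)%C a b = (k * CInt f a b)%C.
Proof. intros H. apply CInt_unique, is_RInt_Cmult, CInt_correct, H. Qed.

Lemma CInt_le_const f a b M : a <= b -> Cex f a b ->
  (forall t, a <= t <= b -> Cmod (f t) <= M) -> Cmod (CInt f a b) <= (b - a) * M.
Proof.
  intros Hab He H. rewrite <- norm_C_R.
  apply (@norm_RInt_le_const C_R_NormedModule f a b); auto.
  - intros; rewrite norm_C_R; auto.
  - now apply CInt_correct.
Qed.

Lemma CInt_le f g a b : a <= b -> Cex f a b -> ex_RInt g a b ->
  (forall t, a <= t <= b -> Cmod (f t) <= g t) -> Cmod (CInt f a b) <= RInt g a b.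
Proof.
  intros Hab He Hg H. rewrite <- norm_C_R.
  apply (@norm_RInt_le C_R_NormedModule f g a b); auto.
  - intros; rewrite norm_C_R; auto.
  - now apply CInt_correct.
  - now apply (@RInt_correct R_CompleteNormedModule).
Qed.

Lemma CInt_fst f a b : Cex f a b -> fst (CInt f a b) = RInt (fun t => fst (f t)) a b.
Proof.
  intros H. apply CInt_correct, is_RInt_C in H. destruct H as [H _].
  symmetry; now apply is_RInt_unique.
Qed.
Lemma CInt_snd f a b : Cex f a b -> snd (CInt f a b) = RInt (fun t => snd (f t)) a b.
Proof.
  intros H. apply CInt_correct, is_RInt_C in H. destruct H as [_ H].
  symmetry; now apply is_RInt_unique.
Qed.

Global Opaque CInt.

(** * Goursat's theorem on rectangles *)

(** Quartering is separated from the integral estimates: [P] stands for a property of rectangles,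
    given by their sides, that is inherited by at least one quarter. *)
Lemma bisection_point (P : R -> R -> R -> R -> Prop) :
  (forall a b c d, a < b -> c < d -> P a b c d ->
     P a ((a + b) / 2) c ((c + d) / 2) \/ P ((a + b) / 2) b c ((c + d) / 2) \/
     P a ((a + b) / 2) ((c + d) / 2) d \/ P ((a + b) / 2) b ((c + d) / 2) d) ->
  forall a b c d, a < b -> c < d -> P a b c d ->
  exists x y, forall n : nat, exists a' b' c' d',
    a <= a' <= x /\ x <= b' <= b /\ c <= c' <= y /\ y <= d' <= d /\
    b' - a' = (b - a) / 2 ^ n /\ d' - c' = (d - c) / 2 ^ n /\ P a' b' c' d'.
Proof.
  intros step a b c d Hab Hcd H0.
  (* The first quarter satisfying [P]; by [step] the fourth satisfies it when the other three do
     not, so it is not tested. *)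
  set (next := fun r : (R * R) * (R * R) =>
    let '((a, b), (c, d)) := r in
    let m := (a + b) / 2 in let n := (c + d) / 2 in
    if excluded_middle_informative (P a m c n) then ((a, m), (c, n)) else
    if excluded_middle_informative (P m b c n) then ((m, b), (c, n)) else
    if excluded_middle_informative (P a m n d) then ((a, m), (n, d)) else ((m, b), (n, d))).
  set (u := fun n => Nat.iter n next ((a, b), (c, d))).
  set (ua := fun n => fst (fst (u n))). set (ub := fun n => snd (fst (u n))).
  set (uc := fun n => fst (snd (u n))). set (ud := fun n => snd (snd (u n))).
  assert (Hn : forall n, ua n < ub n /\ uc n < ud n /\ P (ua n) (ub n) (uc n) (ud n) /\
     ub n - ua n = (b - a) / 2 ^ n /\ ud n - uc n = (d - c) / 2 ^ n).
  { induction n as [|n IH].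
    - unfold ua, ub, uc, ud; simpl. repeat split; auto; field.
    - destruct IH as (I1 & I2 & I3 & I4 & I5).
      specialize (step _ _ _ _ I1 I2 I3).
      assert (E : forall X, X / 2 ^ S n = (X / 2 ^ n) / 2).
      { intros; simpl; field. apply pow_nonzero; lra. }
      rewrite !E, <- I4, <- I5.
      unfold ua, ub, uc, ud in *; simpl. fold (u n) in *.
      destruct (u n) as [[a1 b1] [c1 d1]]; simpl in *.
      repeat destruct excluded_middle_informative; simpl;
        (repeat split; [lra | lra | tauto | lra | lra]). }
  assert (Hm : forall n, ua n <= ua (S n) /\ ub (S n) <= ub n /\ uc n <= uc (S n) /\ ud (S n) <= ud n).
  { intros n. destruct (Hn n) as (I1 & I2 & _).
    unfold ua, ub, uc, ud in *; simpl. fold (u n) in *.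
    destruct (u n) as [[a1 b1] [c1 d1]]; simpl in *.
    repeat destruct excluded_middle_informative; simpl; lra. }
  assert (Hmm : forall k n, ua n <= ua (n + k)%nat /\ ub (n + k)%nat <= ub n
                 /\ uc n <= uc (n + k)%nat /\ ud (n + k)%nat <= ud n).
  { induction k; intros n; [rewrite Nat.add_0_r; lra|].
    rewrite Nat.add_succ_r. specialize (IHk n). specialize (Hm (n + k)%nat). lra. }
  assert (Hx : forall n m, ua n <= ub m /\ uc n <= ud m).
  { intros n m. destruct (Nat.le_ge_cases n m) as [L|L].
    - assert (H := Hmm (m - n)%nat n). replace (n + (m - n))%nat with m in H by lia.
      destruct (Hn m) as (I1 & I2 & _). lra.
    - assert (H := Hmm (n - m)%nat m). replace (m + (n - m))%nat with n in H by lia.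
      destruct (Hn n) as (I1 & I2 & _). lra. }
  (* Every left end is below every right end, so the supremum of the left ends lies in all the
     nested intervals; likewise for the vertical ones. *)
  destruct (completeness (fun r => exists n, r = ua n)) as [x [X1 X2]].
  { exists (ub 0%nat). intros r [n ->]. apply Hx. }
  { exists (ua 0%nat); now exists 0%nat. }
  destruct (completeness (fun r => exists n, r = uc n)) as [y [Y1 Y2]].
  { exists (ud 0%nat). intros r [n ->]. apply Hx. }
  { exists (uc 0%nat); now exists 0%nat. }
  exists x, y. intros n. exists (ua n), (ub n), (uc n), (ud n).
  destruct (Hn n) as (I1 & I2 & I3 & I4 & I5).
  destruct (Hmm n 0%nat) as (M1 & M2 & M3 & M4). simpl in M1, M2, M3, M4.
  change (ua 0%nat) with a in M1. change (ub 0%nat) with b in M2.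
  change (uc 0%nat) with c in M3. change (ud 0%nat) with d in M4.
  assert (x <= ub n) by (apply X2; intros r [k ->]; apply Hx).
  assert (y <= ud n) by (apply Y2; intros r [k ->]; apply Hx).
  assert (ua n <= x) by (apply X1; now exists n).
  assert (uc n <= y) by (apply Y1; now exists n).
  repeat split; auto; lra.
Qed.

Definition Hor (f : C -> C) a b y : C := CInt (fun x => f (x, y)) a b.
Definition Ver (f : C -> C) x c d : C := CInt (fun y => f (x, y)) c d.
(** The counterclockwise contour integral; the factor [Ci] is dz = i dy on the vertical sides. *)
Definition rect_int (f : C -> C) a b c d : C :=
  (Hor f a b c + Ci * Ver f b c d - Hor f a b d - Ci * Ver f a c d)%C.

Definition Hcont (f : C -> C) a b y := forall x, a <= x <= b -> Ccont f (x, y).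
Definition Vcont (f : C -> C) x c d := forall y, c <= y <= d -> Ccont f (x, y).

Lemma Hcont_sub f a b a' b' y : a <= a' -> b' <= b -> Hcont f a b y -> Hcont f a' b' y.
Proof. intros A B H x Hx. apply H; lra. Qed.
Lemma Vcont_sub f c d c' d' x : c <= c' -> d' <= d -> Vcont f x c d -> Vcont f x c' d'.
Proof. intros A B H y Hy. apply H; lra. Qed.

Lemma Hor_ex f a b y : a <= b -> Hcont f a b y -> Cex (fun x => f (x, y)) a b.
Proof.
  intros Hab H. apply Cex_cont_le; auto. intros t Ht.
  apply (RCcont_comp f (fun x => (x, y))); [now apply H | apply RCcont_hor].
Qed.

Lemma Ver_ex f x c d : c <= d -> Vcont f x c d -> Cex (fun y => f (x, y)) c d.
Proof.
  intros Hab H. apply Cex_cont_le; auto. intros t Ht.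
  apply (RCcont_comp f (fun y => (x, y))); [now apply H | apply RCcont_ver].
Qed.

Lemma rect_int_split_v f a m b c d : a <= m -> m <= b ->
  Hcont f a b c -> Hcont f a b d ->
  rect_int f a b c d = (rect_int f a m c d + rect_int f m b c d)%C.
Proof.
  intros H1 H2 Hc Hd. unfold rect_int, Hor.
  rewrite <- (CInt_Chasles (fun x => f (x, c)) a m b), <- (CInt_Chasles (fun x => f (x, d)) a m b).
  - ring.
  - apply Hor_ex; auto. eapply Hcont_sub; [| |exact Hd]; lra.
  - apply Hor_ex; auto. eapply Hcont_sub; [| |exact Hd]; lra.
  - apply Hor_ex; auto. eapply Hcont_sub; [| |exact Hc]; lra.
  - apply Hor_ex; auto. eapply Hcont_sub; [| |exact Hc]; lra.
Qed.

Lemma rect_int_split_h f a b c m d : c <= m -> m <= d ->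
  Vcont f a c d -> Vcont f b c d ->
  rect_int f a b c d = (rect_int f a b c m + rect_int f a b m d)%C.
Proof.
  intros H1 H2 Hc Hd. unfold rect_int, Ver.
  rewrite <- (CInt_Chasles (fun x => f (a, x)) c m d), <- (CInt_Chasles (fun x => f (b, x)) c m d).
  - ring.
  - apply Ver_ex; auto. eapply Vcont_sub; [| |exact Hd]; lra.
  - apply Ver_ex; auto. eapply Vcont_sub; [| |exact Hd]; lra.
  - apply Ver_ex; auto. eapply Vcont_sub; [| |exact Hc]; lra.
  - apply Ver_ex; auto. eapply Vcont_sub; [| |exact Hc]; lra.
Qed.

Definition on_boundary (a b c d : R) (z : C) : Prop :=
  (a <= fst z <= b /\ (snd z = c \/ snd z = d)) \/ (c <= snd z <= d /\ (fst z = a \/ fst z = b)).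

Lemma rect_int_bound f a b c d M : a <= b -> c <= d ->
  (forall z, on_boundary a b c d z -> Ccont f z) ->
  (forall z, on_boundary a b c d z -> Cmod (f z) <= M) ->
  Cmod (rect_int f a b c d) <= 2 * ((b - a) + (d - c)) * M.
Proof.
  intros Hab Hcd Hc HM. unfold rect_int.
  assert (T : forall p q r s, Cmod (p + Ci * q - r - Ci * s)%C <= Cmod p + Cmod q + Cmod r + Cmod s).
  { intros. unfold Cminus.
    eapply Rle_trans; [apply Cmod_triangle|]. rewrite Cmod_opp, Cmod_mult, Cmod_Ci.
    eapply Rle_trans; [apply Rplus_le_compat_r, Cmod_triangle|]. rewrite Cmod_opp.
    eapply Rle_trans; [apply Rplus_le_compat_r, Rplus_le_compat_r, Cmod_triangle|].
    rewrite Cmod_mult, Cmod_Ci. lra. }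
  eapply Rle_trans; [apply T|].
  assert (H1 : Cmod (Hor f a b c) <= (b - a) * M).
  { apply CInt_le_const; auto.
    - apply Hor_ex; auto. intros x Hx. apply Hc. left; simpl; auto.
    - intros x Hx. apply HM. left; simpl; auto. }
  assert (H2 : Cmod (Hor f a b d) <= (b - a) * M).
  { apply CInt_le_const; auto.
    - apply Hor_ex; auto. intros x Hx. apply Hc. left; simpl; auto.
    - intros x Hx. apply HM. left; simpl; auto. }
  assert (H3 : Cmod (Ver f a c d) <= (d - c) * M).
  { apply CInt_le_const; auto.
    - apply Ver_ex; auto. intros x Hx. apply Hc. right; simpl; auto.
    - intros x Hx. apply HM. right; simpl; auto. }
  assert (H4 : Cmod (Ver f b c d) <= (d - c) * M).
  { apply CInt_le_const; auto.
    - apply Ver_ex; auto. intros x Hx. apply Hc. right; simpl; auto.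
    - intros x Hx. apply HM. right; simpl; auto. }
  lra.
Qed.

Lemma boundary_ex f a b c d : a <= b -> c <= d ->
  (forall z, on_boundary a b c d z -> Ccont f z) ->
  Cex (fun x => f (x, c)) a b /\ Cex (fun x => f (x, d)) a b /\
  Cex (fun y => f (a, y)) c d /\ Cex (fun y => f (b, y)) c d.
Proof.
  intros Hab Hcd Hf. repeat split.
  - apply Hor_ex; auto. intros x Hx. apply Hf. left; simpl; auto.
  - apply Hor_ex; auto. intros x Hx. apply Hf. left; simpl; auto.
  - apply Ver_ex; auto. intros x Hx. apply Hf. right; simpl; auto.
  - apply Ver_ex; auto. intros x Hx. apply Hf. right; simpl; auto.
Qed.

Lemma rect_int_minus f g a b c d : a <= b -> c <= d ->
  (forall z, on_boundary a b c d z -> Ccont f z) ->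
  (forall z, on_boundary a b c d z -> Ccont g z) ->
  rect_int (fun z => f z - g z)%C a b c d = (rect_int f a b c d - rect_int g a b c d)%C.
Proof.
  intros Hab Hcd Hf Hg.
  destruct (boundary_ex f a b c d Hab Hcd Hf) as (F1 & F2 & F3 & F4).
  destruct (boundary_ex g a b c d Hab Hcd Hg) as (G1 & G2 & G3 & G4).
  unfold rect_int, Hor, Ver.
  rewrite (CInt_minus _ _ a b F1 G1), (CInt_minus _ _ a b F2 G2),
    (CInt_minus _ _ c d F3 G3), (CInt_minus _ _ c d F4 G4). ring.
Qed.

Lemma rect_int_mult k f a b c d : a <= b -> c <= d ->
  (forall z, on_boundary a b c d z -> Ccont f z) ->
  rect_int (fun z => k * f z)%C a b c d = (k * rect_int f a b c d)%C.
Proof.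
  intros Hab Hcd Hf.
  destruct (boundary_ex f a b c d Hab Hcd Hf) as (F1 & F2 & F3 & F4).
  unfold rect_int, Hor, Ver.
  rewrite (CInt_mult k _ a b F1), (CInt_mult k _ a b F2),
    (CInt_mult k _ c d F3), (CInt_mult k _ c d F4). ring.
Qed.

Lemma CInt_id a b : CInt (fun x => RtoC x) a b = RtoC ((b * b - a * a) / 2).
Proof.
  apply CInt_unique, is_RInt_C; simpl. split.
  - replace ((b * b - a * a) / 2) with (minus (b * b / 2) (a * a / 2)).
    + apply (is_RInt_derive (fun x => x * x / 2) (fun x => x)).
      * intros. auto_derive; auto; field.
      * intros; apply continuous_id.
    + unfold minus, plus, opp; simpl. field.
  - assert (H := @is_RInt_const R_NormedModule a b 0).
    change (scal (b - a) 0) with ((b - a) * 0) in H. now rewrite Rmult_0_r in H.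
Qed.

(** Integrated explicitly; it is the base case that lets Goursat's argument subtract a tangent map
    without changing the contour integral. *)
Lemma rect_int_affine p q a b c d : rect_int (fun z => p + q * z)%C a b c d = 0.
Proof.
  assert (E : forall l0 l1 a b, CInt (fun x => l0 + l1 * RtoC x)%C a b
     = (RtoC (b - a) * l0 + l1 * RtoC ((b * b - a * a) / 2))%C).
  { intros.
    assert (X : forall t, Rmin a0 b0 <= t <= Rmax a0 b0 -> RCcont (fun x => RtoC x) t)
      by (intros; apply RCcont_RtoC, continuous_id).
    rewrite (CInt_plus (fun _ => l0) (fun x => l1 * RtoC x)%C), CInt_const, CInt_mult, CInt_id; auto.
    - now apply Cex_cont.
    - apply Cex_const.
    - now apply Cex_mult, Cex_cont. }
  assert (EH : forall y a b, CInt (fun x => p + q * (x, y))%C a b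
     = (RtoC (b - a) * (p + q * Ci * y) + q * RtoC ((b * b - a * a) / 2))%C).
  { intros. rewrite <- E. apply (f_equal (fun h => CInt h _ _)); apply functional_extensionality; intros x.
    apply injective_projections; simpl; ring. }
  assert (EV : forall x c d, CInt (fun y => p + q * (x, y))%C c d
     = (RtoC (d - c) * (p + q * x) + q * Ci * RtoC ((d * d - c * c) / 2))%C).
  { intros. rewrite <- E. apply (f_equal (fun h => CInt h _ _)); apply functional_extensionality; intros y.
    apply injective_projections; simpl; ring. }
  unfold rect_int, Hor, Ver. rewrite !EH, !EV.
  apply injective_projections; simpl; field.
Qed.

Lemma goursat_rect f a b c d : a < b -> c < d ->
  (forall x y, a <= x <= b -> c <= y <= d -> Cdiff f (x, y)) ->
  rect_int f a b c d = 0.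
Proof.
  intros Hab Hcd Hf.
  destruct (Ceq_dec (rect_int f a b c d) 0) as [|Hne]; auto. exfalso.
  assert (Hpos : 0 < Cmod (rect_int f a b c d)) by now apply Cmod_gt_0.
  set (area := (b - a) * (d - c)).
  assert (Ha : 0 < area) by (unfold area; apply Rmult_lt_0_compat; lra).
  set (k := Cmod (rect_int f a b c d) / area).
  assert (Hk : 0 < k) by now apply Rdiv_lt_0_compat.
  (* Rectangles whose integral is at least [k] times their area; the initial one is such with
     equality. If all four quarters failed, adding them up would contradict this for the whole. *)
  set (P := fun a' b' c' d' => a <= a' /\ b' <= b /\ c <= c' /\ d' <= d /\
     k * ((b' - a') * (d' - c')) <= Cmod (rect_int f a' b' c' d')).
  destruct (bisection_point P) with a b c d as [x [y Hxy]]; auto.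
  - intros a' b' c' d' H1 H2 (P1 & P2 & P3 & P4 & P5). unfold P.
    set (m := (a' + b') / 2). set (n := (c' + d') / 2).
    assert (Hm : m = (a' + b') / 2) by reflexivity. assert (Hn : n = (c' + d') / 2) by reflexivity.
    clearbody m n.
    assert (C1 : forall x y, a' <= x <= b' -> c' <= y <= d' -> Ccont f (x, y)).
    { intros. apply Cdiff_cont, Hf; lra. }
    assert (S : rect_int f a' b' c' d' =
      ((rect_int f a' m c' n + rect_int f a' m n d') + (rect_int f m b' c' n + rect_int f m b' n d'))%C).
    { rewrite <- !rect_int_split_h; try lra.
      - apply rect_int_split_v; try lra; intros x Hx; apply C1; lra.
      - intros x Hx; apply C1; lra.
      - intros x Hx; apply C1; lra.
      - intros x Hx; apply C1; lra.
      - intros x Hx; apply C1; lra. }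
    destruct (Rle_lt_dec (k * ((m - a') * (n - c'))) (Cmod (rect_int f a' m c' n))) as [?|L1];
      [left; lra | right].
    destruct (Rle_lt_dec (k * ((b' - m) * (n - c'))) (Cmod (rect_int f m b' c' n))) as [?|L2];
      [left; lra | right].
    destruct (Rle_lt_dec (k * ((m - a') * (d' - n))) (Cmod (rect_int f a' m n d'))) as [?|L3];
      [left; lra | right].
    destruct (Rle_lt_dec (k * ((b' - m) * (d' - n))) (Cmod (rect_int f m b' n d'))) as [?|L4];
      [lra|exfalso].
    assert (T : Cmod (rect_int f a' b' c' d') <=
      (Cmod (rect_int f a' m c' n) + Cmod (rect_int f a' m n d')) +
      (Cmod (rect_int f m b' c' n) + Cmod (rect_int f m b' n d'))).
    { rewrite S. eapply Rle_trans; [apply Cmod_triangle|].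
      apply Rplus_le_compat; apply Cmod_triangle. }
    replace (m - a') with ((b' - a') / 2) in * by lra.
    replace (b' - m) with ((b' - a') / 2) in * by lra.
    replace (n - c') with ((d' - c') / 2) in * by lra.
    replace (d' - n) with ((d' - c') / 2) in * by lra.
    replace (k * ((b' - a') / 2 * ((d' - c') / 2))) with (k * ((b' - a') * (d' - c')) / 4) in * by field.
    lra.
  - unfold P. repeat split; try lra. fold area. unfold k. right; field; lra.
  - assert (Hx : a <= x <= b /\ c <= y <= d).
    { destruct (Hxy 0%nat) as (a' & b' & c' & d' & H). lra. }
    destruct (Hf x y) as [l Hl]; try tauto.
    set (s := (b - a) + (d - c)). assert (Hs : 0 < s) by (unfold s; lra).
    (* With half-perimeter s' = s / 2^N, the upper bound 2 s' (eps s') is then exactly half of the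
       lower bound k area / 4^N. *)
    set (eps := k * area / (4 * (s * s))).
    assert (Hss : 0 < s * s) by now apply Rmult_lt_0_compat.
    assert (Heps : 0 < eps).
    { apply Rdiv_lt_0_compat; [|lra]. now apply Rmult_lt_0_compat. }
    destruct (Hl eps Heps) as [del [Hdel Hd]].
    destruct (pow_lt_1_zero (/ 2)) with (y := del / s) as [N HN].
    { rewrite Rabs_pos_eq; lra. } { now apply Rdiv_lt_0_compat. }
    specialize (HN N (Nat.le_refl _)).
    rewrite pow_inv in HN.
    assert (H2N : 0 < 2 ^ N) by (apply pow_lt; lra).
    rewrite Rabs_pos_eq in HN by (apply Rlt_le, Rinv_0_lt_compat; auto).
    destruct (Hxy N) as (a' & b' & c' & d' & H1 & H2 & H3 & H4 & Ew & Eh & (_ & _ & _ & _ & HP)).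
    set (s' := (b' - a') + (d' - c')).
    assert (Es : s' = s / 2 ^ N) by (unfold s', s; rewrite Ew, Eh; field; lra).
    assert (Hs' : s' < del).
    { rewrite Es. unfold Rdiv. apply Rmult_lt_reg_l with (/ s); [now apply Rinv_0_lt_compat|].
      replace (/ s * (s * / 2 ^ N)) with (/ 2 ^ N) by (field; lra). unfold Rdiv in HN. lra. }
    set (z0 := (x, y) : C).
    (* The tangent map at the limit point: its integral vanishes, so only the remainder, at most eps
       s' on the boundary, contributes. *)
    set (aff := fun z : C => ((f z0 - l * z0) + l * z)%C).
    assert (Caff : forall z, Ccont aff z).
    { intros z. apply Cdiff_cont, Cdiff_plus; [apply Cdiff_const|].
      apply Cdiff_mult; [apply Cdiff_const|apply Cdiff_id]. }
    assert (Bd : forall z, on_boundary a' b' c' d' z -> a' <= fst z <= b' /\ c' <= snd z <= d').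
    { intros z Hz. unfold on_boundary in Hz. lra. }
    assert (Cf : forall z, on_boundary a' b' c' d' z -> Ccont f z).
    { intros [x1 y1] Hz. apply Bd in Hz; simpl in Hz. apply Cdiff_cont, Hf; lra. }
    assert (E : rect_int f a' b' c' d' = rect_int (fun z => f z - aff z)%C a' b' c' d').
    { rewrite rect_int_minus; auto; try lra.
      unfold aff at 1. rewrite rect_int_affine. ring. }
    assert (Q : Cmod (rect_int f a' b' c' d') <= 2 * s' * (eps * s')).
    { rewrite E. unfold s'. apply rect_int_bound; try lra.
      - intros z Hz. apply Cdiff_cont, Cdiff_minus.
        + destruct z as [x1 y1]. apply Bd in Hz; simpl in Hz. apply Hf; lra.
        + apply Cdiff_plus; [apply Cdiff_const|].
          apply Cdiff_mult; [apply Cdiff_const|apply Cdiff_id].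
      - intros z Hz. apply Bd in Hz. fold s'.
        assert (Hz' : Cmod (z - z0)%C <= s').
        { destruct z as [x1 y1]; simpl in Hz.
          replace ((x1, y1) - z0)%C with (x1 - x, y1 - y)
            by (unfold z0; apply injective_projections; simpl; ring).
          eapply Rle_trans; [apply Cmod_R_le|]. unfold s'.
          apply Rplus_le_compat; apply Rabs_le; lra. }
        specialize (Hd (z - z0)%C). fold z0 in Hd. rewrite Cplus_minus in Hd.
        replace (f z - aff z)%C with (f z - f z0 - l * (z - z0))%C by (unfold aff; ring).
        eapply Rle_trans; [apply Hd; lra|].
        apply Rmult_le_compat_l; lra. }
    assert (HQ := Rle_trans _ _ _ HP Q).
    rewrite Es, Ew, Eh in HQ.
    replace (k * ((b - a) / 2 ^ N * ((d - c) / 2 ^ N))) with (k * area * (/ 2 ^ N * / 2 ^ N)) in HQ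
      by (unfold area; field; lra).
    replace (2 * (s / 2 ^ N) * (eps * (s / 2 ^ N))) with (k * area / 2 * (/ 2 ^ N * / 2 ^ N)) in HQ
      by (unfold eps; field; lra).
    assert (0 < / 2 ^ N * / 2 ^ N) by (apply Rmult_lt_0_compat; now apply Rinv_0_lt_compat).
    apply Rmult_le_reg_r in HQ; auto.
    assert (0 < k * area) by now apply Rmult_lt_0_compat. lra.
Qed.

(* A square of side [2e] around the exceptional point contributes O(e). *)
Lemma goursat_rect_except f a b c d p q M r : a < p < b -> c < q < d ->
  (forall x y, a <= x <= b -> c <= y <= d -> (x, y) <> (p, q) -> Cdiff f (x, y)) ->
  0 < r -> (forall h, 0 < Cmod h < r -> Cmod (f ((p, q) + h)%C) <= M) ->
  rect_int f a b c d = 0.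
Proof.
  intros Hp Hq Hf Hr HM.
  assert (HM0 : 0 <= M).
  { eapply Rle_trans; [apply Cmod_ge_0|apply (HM (RtoC (r / 2)))].
    rewrite Cmod_R, Rabs_pos_eq; lra. }
  destruct (Ceq_dec (rect_int f a b c d) 0) as [|Hne]; auto. exfalso.
  assert (Hpos : 0 < Cmod (rect_int f a b c d)) by now apply Cmod_gt_0.
  set (J := Cmod (rect_int f a b c d)) in *.
  (* The first four entries keep the square inside the rectangle, [r / 4] keeps its boundary where
     [M] bounds [f], and the last one makes perimeter times [M], that is 8 e M, less than [J].
     Halving makes the inequalities strict. *)
  set (e := Rmin (Rmin (Rmin (p - a) (b - p)) (Rmin (q - c) (d - q))) (Rmin (r / 4) (J / (16 * (M + 1)))) / 2).
  assert (He : 0 < e /\ e < p - a /\ e < b - p /\ e < q - c /\ e < d - q /\ e < r / 4 /\ e < J / (16 * (M + 1))).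
  { assert (0 < J / (16 * (M + 1))) by (apply Rdiv_lt_0_compat; lra).
    revert H. unfold e. generalize (J / (16 * (M + 1))). intros j Hj.
    unfold Rmin; repeat destruct Rle_dec; lra. }
  clearbody e. destruct He as (E0 & E1 & E2 & E3 & E4 & E5 & E6).
  assert (Hc : forall x y, a <= x <= b -> c <= y <= d -> (x <> p \/ y <> q) -> Ccont f (x, y)).
  { intros x y Hx Hy Hn. apply Cdiff_cont, Hf; auto. intros E; inversion E; lra. }
  (* The pieces to the left, to the right, below and above the square avoid the exceptional point,
     so their integrals vanish. *)
  assert (S : rect_int f a b c d = rect_int f (p - e) (p + e) (q - e) (q + e)).
  { rewrite (rect_int_split_v f a (p - e) b); try lra;
      try (intros x Hx; apply Hc; lra).
    rewrite (rect_int_split_v f (p - e) (p + e) b); try lra;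
      try (intros x Hx; apply Hc; lra).
    rewrite (rect_int_split_h f (p - e) (p + e) c (q - e) d); try lra;
      try (intros x Hx; apply Hc; lra).
    rewrite (rect_int_split_h f (p - e) (p + e) (q - e) (q + e) d); try lra;
      try (intros x Hx; apply Hc; lra).
    rewrite (goursat_rect f a (p - e)), (goursat_rect f (p + e) b),
      (goursat_rect f _ _ c (q - e)), (goursat_rect f _ _ (q + e) d);
      try lra; [ring| | | |];
      (intros x y Hx Hy; apply Hf; try lra; intros E; inversion E; lra). }
  assert (B : J <= 2 * ((p + e - (p - e)) + (q + e - (q - e))) * M).
  { unfold J. rewrite S. apply rect_int_bound; try lra.
    - intros [x y] Hz. unfold on_boundary in Hz; simpl in Hz. apply Hc; lra.
    - intros [x y] Hz. unfold on_boundary in Hz; simpl in Hz.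
      rewrite <- (Cplus_minus (p, q) (x, y)). apply HM.
      replace ((x, y) - (p, q))%C with (x - p, y - q)
        by (apply injective_projections; simpl; ring).
      split.
      + apply Cmod_gt_0. intros E; inversion E; lra.
      + eapply Rle_lt_trans; [apply Cmod_R_le|].
        assert (Rabs (x - p) <= e) by (apply Rabs_le; lra).
        assert (Rabs (y - q) <= e) by (apply Rabs_le; lra). lra. }
  assert (8 * e * M <= 8 * e * (M + 1)) by (apply Rmult_le_compat_l; lra).
  assert (e * (16 * (M + 1)) < J).
  { apply Rmult_lt_reg_r with (/ (16 * (M + 1))); [apply Rinv_0_lt_compat; lra|].
    replace (e * (16 * (M + 1)) * / (16 * (M + 1))) with e by (field; lra). exact E6. }
  lra.
Qed.

(** * Unique continuation *)

Lemma RCcont_Cmod f t : RCcont f t -> continuous (fun u => Cmod (f u)) t.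
Proof.
  intros H. apply filterlim_locally. intros eps.
  assert (He : 0 < eps / 2) by (generalize (cond_pos eps); lra).
  destruct (proj1 (RCcont_eps _ _) H _ He) as [d [Hd H1]].
  exists (mkposreal d Hd). intros u Hu. specialize (H1 u Hu).
  change (Rabs (Cmod (f u) - Cmod (f t)) < eps).
  assert (A := Cmod_lower (f u) (- f t)). assert (B := Cmod_lower (f t) (- f u)).
  rewrite Cmod_opp in A, B.
  change (f u + - f t)%C with (f u - f t)%C in A. change (f t + - f u)%C with (f t - f u)%C in B.
  rewrite (Cmod_minus_sym (f t)) in B.
  apply Rabs_lt_between. generalize (cond_pos eps); lra.
Qed.

Lemma RCcont_bounded f a b : a <= b -> (forall t, a <= t <= b -> RCcont f t) ->
  exists M, forall t, a <= t <= b -> Cmod (f t) <= M.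
Proof.
  intros Hab H. destruct (continuity_ab_maj (fun u => Cmod (f u)) a b Hab) as [x [Hx _]].
  - intros t Ht. apply continuity_pt_filterlim. now apply RCcont_Cmod, H.
  - exists (Cmod (f x)). exact Hx.
Qed.

Lemma boundary_bounded f a b c d : a <= b -> c <= d -> (forall z, Ccont f z) ->
  exists M, forall z, on_boundary a b c d z -> Cmod (f z) <= M.
Proof.
  intros Hab Hcd Hf.
  assert (H1 : forall y, exists M, forall x, a <= x <= b -> Cmod (f (x, y)) <= M).
  { intros y. apply (RCcont_bounded (fun x => f (x, y))); auto.
    intros t _. apply (RCcont_comp f (fun x => (x, y))); [apply Hf|apply RCcont_hor]. }
  assert (H2 : forall x, exists M, forall y, c <= y <= d -> Cmod (f (x, y)) <= M).
  { intros x. apply (RCcont_bounded (fun y => f (x, y))); auto.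
    intros t _. apply (RCcont_comp f (fun y => (x, y))); [apply Hf|apply RCcont_ver]. }
  destruct (H1 c) as [M1 B1], (H1 d) as [M2 B2], (H2 a) as [M3 B3], (H2 b) as [M4 B4].
  exists (Rmax (Rmax M1 M2) (Rmax M3 M4)).
  intros [x y] [[Hx [E|E]]|[Hx [E|E]]]; simpl in *; subst.
  - eapply Rle_trans; [now apply B1|]. eapply Rle_trans; [|apply Rmax_l]. apply Rmax_l.
  - eapply Rle_trans; [now apply B2|]. eapply Rle_trans; [|apply Rmax_l]. apply Rmax_r.
  - eapply Rle_trans; [now apply B3|]. eapply Rle_trans; [|apply Rmax_r]. apply Rmax_l.
  - eapply Rle_trans; [now apply B4|]. eapply Rle_trans; [|apply Rmax_r]. apply Rmax_r.
Qed.

Lemma Cdiff_inv_minus (p : C) z : z <> p -> Cdiff (fun w => / (w - p))%C z.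
Proof.
  intros H. apply Cdiff_inv.
  - now apply Cminus_eq_contra.
  - apply Cdiff_minus; [apply Cdiff_id|apply Cdiff_const].
Qed.

Lemma RInt_neg (g : R -> R) a b : a < b -> (forall x, a < x < b -> g x < 0) ->
  (forall x, a <= x <= b -> continuous g x) -> RInt g a b < 0.
Proof.
  intros Hab Hn Hc.
  assert (E : RInt (fun x => - g x) a b = - RInt g a b).
  { apply (@RInt_opp R_CompleteNormedModule g a b).
    apply (@ex_RInt_continuous R_CompleteNormedModule).
    rewrite Rmin_left, Rmax_right by lra. auto. }
  enough (0 < RInt (fun x => - g x) a b) by lra.
  apply RInt_gt_0; auto.
  - intros x Hx. specialize (Hn x Hx). lra.
  - intros x Hx. apply (@continuous_opp R_UniformSpace R_AbsRing R_NormedModule). auto.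
Qed.

(* The winding number: each of the four sides contributes a positive imaginary part. *)
Lemma rect_int_inv_neq_0 a b c d p q : a < p < b -> c < q < d ->
  rect_int (fun w => / (w - (p, q)))%C a b c d <> 0.
Proof.
  intros Hp Hq E. set (k := fun w => (/ (w - (p, q)))%C).
  assert (Hk : forall z, z <> (p, q) -> Ccont k z).
  { intros z Hz. now apply Cdiff_cont, Cdiff_inv_minus. }
  assert (CH : forall y, y <> q -> forall x, RCcont (fun x => k (x, y)) x).
  { intros y Hy x. apply (RCcont_comp k (fun x => (x, y))); [|apply RCcont_hor].
    apply Hk. intros F; inversion F; lra. }
  assert (CV : forall x, x <> p -> forall y, RCcont (fun y => k (x, y)) y).
  { intros x Hx y. apply (RCcont_comp k (fun y => (x, y))); [|apply RCcont_ver].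
    apply Hk. intros F; inversion F; lra. }
  assert (Den : forall x y, (x <> p \/ y <> q) -> 0 < (x - p) ^ 2 + (y - q) ^ 2).
  { intros x y [H|H].
    - assert (0 < (x - p) ^ 2) by (apply pow2_gt_0; lra). generalize (pow2_ge_0 (y - q)); lra.
    - assert (0 < (y - q) ^ 2) by (apply pow2_gt_0; lra). generalize (pow2_ge_0 (x - p)); lra. }
  assert (V1 : 0 < snd (Hor k a b c)).
  { unfold Hor. rewrite CInt_snd by (apply Cex_cont; intros; apply CH; lra).
    apply RInt_gt_0; try lra.
    - intros x Hx. unfold k; simpl. change (x + - p) with (x - p). change (c + - q) with (c - q).
      apply Rdiv_lt_0_compat; [lra | apply (Den x c); lra].
    - intros x Hx. apply RCcont_snd, CH; lra. }
  assert (V2 : snd (Hor k a b d) < 0).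
  { unfold Hor. rewrite CInt_snd by (apply Cex_cont; intros; apply CH; lra).
    apply RInt_neg; try lra.
    - intros x Hx. unfold k; simpl. change (x + - p) with (x - p). change (d + - q) with (d - q).
      unfold Rdiv. rewrite <- Ropp_mult_distr_l. apply Ropp_lt_gt_0_contravar.
      apply Rdiv_lt_0_compat; [lra | apply (Den x d); lra].
    - intros x Hx. apply RCcont_snd, CH; lra. }
  assert (V3 : 0 < fst (Ver k b c d)).
  { unfold Ver. rewrite CInt_fst by (apply Cex_cont; intros; apply CV; lra).
    apply RInt_gt_0; try lra.
    - intros y Hy. unfold k; simpl. change (b + - p) with (b - p). change (y + - q) with (y - q).
      apply Rdiv_lt_0_compat; [lra | apply (Den b y); lra].
    - intros x Hx. apply RCcont_fst, CV; lra. }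
  assert (V4 : fst (Ver k a c d) < 0).
  { unfold Ver. rewrite CInt_fst by (apply Cex_cont; intros; apply CV; lra).
    apply RInt_neg; try lra.
    - intros y Hy. unfold k; simpl. change (a + - p) with (a - p). change (y + - q) with (y - q).
      apply Ropp_lt_cancel. rewrite Ropp_0. unfold Rdiv. rewrite Ropp_mult_distr_l.
      apply Rdiv_lt_0_compat; [lra | apply (Den a y); lra].
    - intros x Hx. apply RCcont_fst, CV; lra. }
  apply (f_equal snd) in E. unfold rect_int in E. fold k in E. simpl in E.
  lra.
Qed.

(* Cauchy's formula on a large square for [g w * ((p - a) / (w - a)) ^ n], which is
   entire because [g] vanishes near [a]: on the square this is O(2^-n). *)
Lemma unique_continuation g a r : 0 < r -> (forall z, Cdiff g z) ->
  (forall h, Cmod h < r -> g (a + h)%C = 0) -> forall p, g p = 0.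
Proof.
  intros Hr Hg H0 p.
  destruct (Ceq_dec (g p) 0) as [|Hne]; auto. exfalso.
  assert (Hpa : p <> a).
  { intros ->. apply Hne. replace a with (a + 0)%C by ring. apply H0. now rewrite Cmod_0. }
  set (s := Cmod (p - a)%C).
  assert (Hs : 0 < s) by (apply Cmod_gt_0; now apply Cminus_eq_contra).
  destruct p as [p1 p2], a as [a1 a2].
  set (p := (p1, p2) : C) in *. set (a := (a1, a2) : C) in *.
  assert (Hp1 : Rabs (p1 - a1) <= s /\ Rabs (p2 - a2) <= s).
  { assert (R := Rmax_Cmod (p - a)%C). fold s in R. split.
    - eapply Rle_trans; [|exact R]. apply Rmax_l.
    - eapply Rle_trans; [|exact R]. apply Rmax_r. }
  destruct Hp1 as [Hp1 Hp2]. apply Rabs_le_between in Hp1, Hp2.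
  set (k := fun n w => (g w * ((p - a) / (w - a)) ^ n)%C).
  (* Near [a] the factor [g] vanishes identically, so [k n] is locally the constant 0 in spite of
     the quotient. *)
  assert (Hk : forall n z, Cdiff (k n) z).
  { intros n z. destruct (Ceq_dec z a) as [->|Hz].
    - apply (Cdiff_ext_loc (fun _ => RtoC 0)); [|apply Cdiff_const].
      exists r; split; auto. intros h Hh. unfold k. rewrite H0; auto. now rewrite Cmult_0_l.
    - apply Cdiff_mult; auto. apply Cdiff_pow.
      apply Cdiff_mult; [apply Cdiff_const|]. now apply Cdiff_inv_minus. }
  assert (Hkp : forall n, k n p = g p).
  { intros n. unfold k. replace ((p - a) / (p - a))%C with (RtoC 1).
    - rewrite Cpow_1_l. ring.
    - field. now apply Cminus_eq_contra. }
  (* On this square |w - a| is at least 2 s, so the quotient (p - a) / (w - a) has modulus at most 1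
     / 2, while |w - p| stays at least s. *)
  set (rho := 2 * s).
  assert (Hrho : 0 < rho) by (unfold rho; lra).
  set (J := fun f => rect_int f (a1 - rho) (a1 + rho) (a2 - rho) (a2 + rho)).
  set (B := on_boundary (a1 - rho) (a1 + rho) (a2 - rho) (a2 + rho)).
  assert (HB : forall z, B z -> rho <= Cmod (z - a)%C).
  { intros [x y] Hz. assert (R := Rmax_Cmod ((x, y) - a)%C). simpl in R.
    change (x + - a1) with (x - a1) in R. change (y + - a2) with (y - a2) in R.
    assert (Rx := Rle_trans _ _ _ (Rmax_l _ _) R). assert (Ry := Rle_trans _ _ _ (Rmax_r _ _) R).
    unfold B, on_boundary in Hz; simpl in Hz.
    destruct Hz as [[_ [E|E]]|[_ [E|E]]]; subst.
    - rewrite <- (Rabs_Ropp), Rabs_pos_eq in Ry; lra.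
    - rewrite Rabs_pos_eq in Ry; lra.
    - rewrite <- (Rabs_Ropp), Rabs_pos_eq in Rx; lra.
    - rewrite Rabs_pos_eq in Rx; lra. }
  assert (HBp : forall z, B z -> s <= Cmod (z - p)%C).
  { intros z Hz. specialize (HB z Hz).
    assert (T := Cmod_lower (z - a) (- (p - a))). rewrite Cmod_opp in T. fold s in T.
    replace (z - a + - (p - a))%C with (z - p)%C in T by ring. unfold rho in HB; lra. }
  assert (HBne : forall z, B z -> z <> p).
  { intros z Hz ->. specialize (HBp p Hz). replace (p - p)%C with (RtoC 0) in HBp by ring.
    rewrite Cmod_0 in HBp. lra. }
  (* The winding integral is carried along as a nonzero constant in Cauchy's formula. *)
  set (W := J (fun w => / (w - p))%C).
  assert (HW : W <> 0).
  { apply (rect_int_inv_neq_0 (a1 - rho) (a1 + rho) (a2 - rho) (a2 + rho) p1 p2); unfold rho; lra. }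
  assert (Cauchy : forall n, J (fun w => k n w * / (w - p))%C = (g p * W)%C).
  { intros n.
    (* Differentiability at [p] bounds this difference quotient nearby, so [p] can serve as the
       exceptional point. *)
    assert (Z : J (fun w => (k n w - g p) * / (w - p))%C = 0).
    { destruct (Hk n p) as [l Hl]. destruct (Cderiv_lip _ _ _ Hl) as [d [Hd HL]].
      apply (goursat_rect_except (fun w => (k n w - g p) * / (w - p))%C _ _ _ _ p1 p2 (Cmod l + 1) d); try (unfold rho; lra).
      - intros x y _ _ Hxy. apply Cdiff_mult; [|now apply Cdiff_inv_minus].
        apply Cdiff_minus; auto. apply Cdiff_const.
      - intros h Hh. fold p. rewrite <- (Hkp n).
        replace (p + h - p)%C with h by ring.
        assert (h <> 0) by (apply Cmod_gt_0; lra).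
        rewrite Cmod_mult, Cmod_inv by auto.
        apply Rmult_le_reg_r with (Cmod h); [lra|].
        rewrite Rmult_assoc, Rinv_l by lra. rewrite Rmult_1_r. apply HL; lra. }
    assert (E : J (fun w => (k n w * / (w - p)) - g p * / (w - p))%C = 0).
    { rewrite <- Z. unfold J. f_equal. apply functional_extensionality. intros w. ring. }
    unfold J in E. rewrite rect_int_minus in E; try lra.
    - replace (rect_int (fun z => g p * / (z - p))%C (a1 - rho) (a1 + rho) (a2 - rho) (a2 + rho))
        with (g p * W)%C in E.
      + fold (J (fun z => k n z * / (z - p))%C) in E. apply Ceq_minus in E. exact E.
      + symmetry. apply (rect_int_mult (g p) (fun w => / (w - p))%C); try lra.
        intros z Hz. now apply Cdiff_cont, Cdiff_inv_minus, HBne.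
    - intros z Hz. apply Cdiff_cont, Cdiff_mult; auto. now apply Cdiff_inv_minus, HBne.
    - intros z Hz. apply Cdiff_cont, Cdiff_mult; [apply Cdiff_const|]. now apply Cdiff_inv_minus, HBne. }
  destruct (boundary_bounded g (a1 - rho) (a1 + rho) (a2 - rho) (a2 + rho)) as [M HM]; try lra.
  { intros z; now apply Cdiff_cont. }
  assert (Bn : forall n, Cmod (g p * W)%C <= 2 * (2 * rho + 2 * rho) * (M * (/ 2) ^ n * / s)).
  { intros n. rewrite <- (Cauchy n).
    replace (2 * rho + 2 * rho) with ((a1 + rho - (a1 - rho)) + (a2 + rho - (a2 - rho))) by ring.
    apply (rect_int_bound (fun w => k n w * / (w - p))%C (a1 - rho) (a1 + rho) (a2 - rho) (a2 + rho)).
    - lra.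
    - lra.
    - intros z Hz. apply Cdiff_cont, Cdiff_mult; auto. now apply Cdiff_inv_minus, HBne.
    - intros z Hz. unfold k. rewrite !Cmod_mult, Cmod_pow.
      specialize (HM z Hz). specialize (HB z Hz). specialize (HBp z Hz).
      assert (z <> p) by now apply HBne.
      rewrite Cmod_inv by now apply Cminus_eq_contra.
      apply Rmult_le_compat.
      + apply Rmult_le_pos; [apply Cmod_ge_0|apply pow_le, Cmod_ge_0].
      + apply Rlt_le, Rinv_0_lt_compat; lra.
      + apply Rmult_le_compat; auto; [apply Cmod_ge_0|apply pow_le, Cmod_ge_0|].
        apply pow_incr; split; [apply Cmod_ge_0|].
        rewrite Cmod_div by (apply Cmod_gt_0; lra). fold s.
        apply Rmult_le_reg_r with (Cmod (z - a)); [lra|].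
        unfold Rdiv. rewrite Rmult_assoc, Rinv_l by lra. unfold rho in HB. lra.
      + apply Rinv_le_contravar; lra. }
  assert (P : 0 < Cmod (g p * W)%C) by (apply Cmod_gt_0, Cmult_neq_0; auto).
  set (K := 2 * (2 * rho + 2 * rho) * (M * / s)).
  assert (Bn' : forall n, Cmod (g p * W)%C <= K * (/ 2) ^ n).
  { intros n. eapply Rle_trans; [apply (Bn n)|]. right. unfold K; ring. }
  assert (HK : 0 < K) by (specialize (Bn' 0%nat); simpl in Bn'; lra).
  destruct (pow_lt_1_zero (/ 2)) with (y := Cmod (g p * W)%C / K) as [N HN].
  { rewrite Rabs_pos_eq; lra. } { now apply Rdiv_lt_0_compat. }
  specialize (HN N (Nat.le_refl _)). rewrite Rabs_pos_eq in HN by (apply pow_le; lra).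
  specialize (Bn' N).
  apply (Rmult_lt_compat_l K) in HN; auto.
  replace (K * (Cmod (g p * W)%C / K)) with (Cmod (g p * W)%C) in HN by (field; lra). lra.
Qed.

(** * The complex exponential, sine, cosine and logarithm *)

Lemma Cexp_plus a b : Cexp (a + b)%C = (Cexp a * Cexp b)%C.
Proof.
  unfold Cexp. rewrite re_plus, im_plus, exp_plus, cos_plus, sin_plus.
  apply injective_projections; simpl; ring.
Qed.

Lemma Cexp_0 : Cexp 0 = 1.
Proof.
  unfold Cexp. simpl. rewrite exp_0, cos_0, sin_0. apply injective_projections; simpl; ring.
Qed.

Lemma Cexp_opp z : (Cexp z * Cexp (- z))%C = 1.
Proof. rewrite <- Cexp_plus, Cplus_opp_r. apply Cexp_0. Qed.

Lemma Cexp_neq_0 z : Cexp z <> 0.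
Proof.
  intros E. assert (H := Cexp_opp z). rewrite E, Cmult_0_l in H. now apply C1_nz.
Qed.

Lemma Cexp_opp_inv z : Cexp (- z)%C = (/ Cexp z)%C.
Proof.
  assert (H := Cexp_neq_0 z). rewrite <- (Cmult_1_l (/ Cexp z)%C), <- (Cexp_opp z). now field.
Qed.

Lemma Cexp_pow z n : (Cexp z ^ n)%C = Cexp (RtoC (INR n) * z).
Proof.
  induction n.
  - simpl. rewrite Cmult_0_l. now rewrite Cexp_0.
  - rewrite Cpow_S, IHn, <- Cexp_plus. f_equal. rewrite S_INR, RtoC_plus. ring.
Qed.

Lemma Cmod_Cexp z : Cmod (Cexp z) = exp (Re z).
Proof.
  unfold Cexp, Cmod; simpl. 
  replace (_ + _) with (exp (Re z) * exp (Re z) * (Rsqr (sin (Im z)) + Rsqr (cos (Im z)))) 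
    by (unfold Rsqr; ring).
  rewrite sin2_cos2, Rmult_1_r. apply sqrt_square, Rlt_le, exp_pos.
Qed.

Lemma exp_le x y : x <= y -> exp x <= exp y.
Proof. intros [H| ->]; [left; now apply exp_increasing|right; auto]. Qed.

Lemma Cmod_Cexp_le z : Cmod (Cexp z) <= exp (Cmod z).
Proof.
  rewrite Cmod_Cexp. apply exp_le. eapply Rle_trans; [apply Rle_abs|apply re_le_Cmod].
Qed.

Lemma im_le_Cmod z : Rabs (Im z) <= Cmod z.
Proof. eapply Rle_trans; [|apply (Rmax_Cmod z)]. apply Rmax_r. Qed.

(** Componentwise, because the mean value theorem is real and is applied to each coordinate. *)
Definition RCderiv (f : R -> C) (t : R) (l : C) : Prop :=
  is_derive (fun u => fst (f u)) t (fst l) /\ is_derive (fun u => snd (f u)) t (snd l).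

Lemma RCderiv_mult f g t l m : RCderiv f t l -> RCderiv g t m ->
  RCderiv (fun u => f u * g u)%C t (l * g t + f t * m)%C.
Proof.
  intros [F1 F2] [G1 G2]. split; simpl.
  - eapply (is_derive_ext (fun u => minus (fst (f u) * fst (g u)) (snd (f u) * snd (g u)))).
    + reflexivity.
    + assert (H := @is_derive_minus _ _ _ _ _ _ _
        (@is_derive_mult R_AbsRing _ _ _ _ _ F1 G1 Rmult_comm)
        (@is_derive_mult R_AbsRing _ _ _ _ _ F2 G2 Rmult_comm)).
      evar_last; [apply H|]. unfold minus, plus, opp, mult; simpl; ring.
  - assert (H := @is_derive_plus _ _ _ _ _ _ _
        (@is_derive_mult R_AbsRing _ _ _ _ _ F1 G2 Rmult_comm)
        (@is_derive_mult R_AbsRing _ _ _ _ _ F2 G1 Rmult_comm)).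
    evar_last; [apply H|]. unfold minus, plus, opp, mult; simpl; ring.
Qed.

Lemma RCderiv_plus f g t l m : RCderiv f t l -> RCderiv g t m ->
  RCderiv (fun u => f u + g u)%C t (l + m)%C.
Proof.
  intros [F1 F2] [G1 G2]. split; simpl.
  - apply (@is_derive_plus _ _ _ _ _ _ _ F1 G1).
  - apply (@is_derive_plus _ _ _ _ _ _ _ F2 G2).
Qed.

Lemma RCderiv_const c t : RCderiv (fun _ => c) t 0.
Proof. split; apply (@is_derive_const R_AbsRing R_NormedModule). Qed.

Lemma RCderiv_RtoC (g : R -> R) (t l : R) : is_derive g t l -> RCderiv (fun u => RtoC (g u)) t (RtoC l).
Proof. intros H; split; auto. apply (@is_derive_const R_AbsRing R_NormedModule 0 t). Qed.

Lemma RCderiv_Cexp z t : RCderiv (fun u => Cexp (RtoC u * z)) t (z * Cexp (RtoC t * z))%C.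
Proof.
  destruct z as [a b]. unfold Cexp; split; simpl; auto_derive; auto; unfold Rminus; ring.
Qed.

(* The factor 2 comes from applying the real mean value theorem to each component. *)
Lemma RC_mean_value f df M : (forall t, 0 <= t <= 1 -> RCderiv f t (df t) /\ Cmod (df t) <= M) ->
  Cmod (f 1 - f 0)%C <= 2 * M.
Proof.
  intros H.
  assert (E : (f 1 - f 0)%C = (fst (f 1) - fst (f 0), snd (f 1) - snd (f 0)))
    by (apply injective_projections; simpl; ring).
  rewrite E. eapply Rle_trans; [apply Cmod_R_le|].
  assert (A : forall h dh, (forall t, 0 <= t <= 1 -> is_derive h t (dh t) /\ Rabs (dh t) <= M) ->
     Rabs (h 1 - h 0) <= M).
  { intros h dh Hh. destruct (MVT_gen h 0 1 dh) as [c [Hc ->]].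
    - intros t Ht. rewrite Rmin_left, Rmax_right in Ht by lra. apply Hh; lra.
    - intros t Ht. rewrite Rmin_left, Rmax_right in Ht by lra. apply continuity_pt_filterlim.
      apply (@ex_derive_continuous R_AbsRing R_NormedModule). eexists; apply Hh; lra.
    - rewrite Rmin_left, Rmax_right in Hc by lra. rewrite Rminus_0_r, Rmult_1_r. apply Hh; lra. }
  assert (A1 := A (fun u => fst (f u)) (fun u => fst (df u))).
  assert (A2 := A (fun u => snd (f u)) (fun u => snd (df u))).
  simpl in A1, A2.
  assert (Rabs (fst (f 1) - fst (f 0)) <= M).
  { apply A1. intros t Ht. destruct (H t Ht) as [[D1 D2] D3]. split; auto.
    eapply Rle_trans; [apply re_le_Cmod|auto]. }
  assert (Rabs (snd (f 1) - snd (f 0)) <= M).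
  { apply A2. intros t Ht. destruct (H t Ht) as [[D1 D2] D3]. split; auto.
    eapply Rle_trans; [apply im_le_Cmod|auto]. }
  lra.
Qed.

(** * Taylor polynomials of the exponential *)

Fixpoint exp_taylor (n : nat) (z : C) : C :=
  match n with
  | O => RtoC 1
  | S m => (exp_taylor m z + RtoC (/ INR (fact (S m))) * z ^ S m)%C
  end.

Lemma Cpow_RtoC_mult (t : R) z n : ((RtoC t * z) ^ n)%C = (RtoC (t ^ n) * z ^ n)%C.
Proof. now rewrite Cpow_mult_l, RtoC_pow. Qed.

(** Differentiation turns each term into the preceding one times z, so only the top term is lost;
    this leaves a single term in the derivative used for the Taylor error. *)
Lemma RCderiv_exp_taylor n z t :
  RCderiv (fun u => exp_taylor n (RtoC u * z)) t
    (z * (exp_taylor n (RtoC t * z) - RtoC (/ INR (fact n)) * (RtoC t * z) ^ n))%C.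
Proof.
  induction n.
  - simpl. replace (z * (1 - (/ 1)%R * 1))%C with (RtoC 0).
    + apply RCderiv_const.
    + rewrite Rinv_1. ring.
  - change (fun u : R => exp_taylor (S n) (RtoC u * z)) with
      (fun u : R => (exp_taylor n (RtoC u * z) + RtoC (/ INR (fact (S n))) * (RtoC u * z) ^ S n)%C).
    change (exp_taylor (S n) (RtoC t * z)) with
      (exp_taylor n (RtoC t * z) + RtoC (/ INR (fact (S n))) * (RtoC t * z) ^ S n)%C.
    assert (H : RCderiv (fun u => RtoC (/ INR (fact (S n))) * (RtoC u * z) ^ S n)%C t
       (z * (RtoC (/ INR (fact n)) * (RtoC t * z) ^ n))%C).
    { assert (X := RCderiv_mult (fun u => RtoC (u ^ S n)) (fun _ => (RtoC (/ INR (fact (S n))) * z ^ S n)%C)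
        t _ _ (RCderiv_RtoC (fun u => u ^ S n) t _ (is_derive_pow (fun u => u) (S n) t 1 (is_derive_id t)))
        (RCderiv_const _ t)).
      replace (fun u : R => (RtoC (/ INR (fact (S n))) * (RtoC u * z) ^ S n)%C)
       with (fun u : R => (RtoC (u ^ S n) * (RtoC (/ INR (fact (S n))) * z ^ S n))%C).
      - replace (z * (RtoC (/ INR (fact n)) * (RtoC t * z) ^ n))%C with
         (RtoC (INR (S n) * 1 * t ^ Init.Nat.pred (S n)) * (RtoC (/ INR (fact (S n))) * z ^ S n)
           + RtoC (t ^ S n) * 0)%C; [exact X|].
        rewrite Cpow_RtoC_mult, Cpow_S. simpl Init.Nat.pred.
        rewrite fact_simpl, mult_INR, Rinv_mult, !RtoC_mult.
        replace (RtoC (INR (S n)) * 1 * RtoC (t ^ n) * (RtoC (/ INR (S n)) * RtoC (/ INR (fact n)) * (z * z ^ n)) + RtoC (t ^ S n) * 0)%C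
         with ((RtoC (INR (S n)) * RtoC (/ INR (S n))) * (z * (RtoC (/ INR (fact n)) * (RtoC (t ^ n) * z ^ n))))%C by ring.
        rewrite <- RtoC_mult, Rinv_r by (apply not_0_INR; lia). ring.
      - apply functional_extensionality; intros u. rewrite Cpow_RtoC_mult. ring. }
    assert (P := RCderiv_plus _ _ _ _ _ IHn H).
    replace (z * (exp_taylor n (RtoC t * z) + RtoC (/ INR (fact (S n))) * (RtoC t * z) ^ S n
       - RtoC (/ INR (fact (S n))) * (RtoC t * z) ^ S n))%C with
     (z * (exp_taylor n (RtoC t * z) - RtoC (/ INR (fact n)) * (RtoC t * z) ^ n)
        + z * (RtoC (/ INR (fact n)) * (RtoC t * z) ^ n))%C by ring.
    exact P.
Qed.

(* The derivative of [t => Cexp (- t z) * exp_taylor n (t z)] is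
   [- z * Cexp (- t z) * (t z) ^ n / n!]. *)
Lemma exp_taylor_error n z :
  Cmod (exp_taylor n z - Cexp z)%C <= 2 * exp (2 * Cmod z) * (Cmod z ^ S n / INR (fact n)).
Proof.
  assert (Hf : 0 < INR (fact n)) by (apply lt_0_INR, lt_O_fact).
  set (phi := fun t : R => (Cexp (RtoC t * - z) * exp_taylor n (RtoC t * z))%C).
  assert (Hphi : Cmod (phi 1 - phi 0)%C <= 2 * (exp (Cmod z) * (Cmod z ^ S n / INR (fact n)))).
  { apply (RC_mean_value phi (fun t => (- z * Cexp (RtoC t * - z) * exp_taylor n (RtoC t * z)
      + Cexp (RtoC t * - z) * (z * (exp_taylor n (RtoC t * z) - RtoC (/ INR (fact n)) * (RtoC t * z) ^ n)))%C)).
    intros t Ht. split.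
    - apply RCderiv_mult; [apply RCderiv_Cexp|apply RCderiv_exp_taylor].
    - match goal with |- Cmod ?X <= _ =>
        replace X with (- (Cexp (RtoC t * - z) * (RtoC (/ INR (fact n)) * (z * (RtoC t * z) ^ n))))%C by ring end.
      rewrite Cmod_opp, !Cmod_mult, Cmod_pow, !Cmod_mult, !Cmod_R.
      rewrite (Rabs_pos_eq (/ _)) by (apply Rlt_le, Rinv_0_lt_compat; auto).
      rewrite (Rabs_pos_eq t) by lra.
      assert (Hz := Cmod_ge_0 z).
      apply Rmult_le_compat.
      + apply Cmod_ge_0.
      + apply Rmult_le_pos; [apply Rlt_le, Rinv_0_lt_compat; auto|].
        apply Rmult_le_pos; auto. apply pow_le, Rmult_le_pos; lra.
      + eapply Rle_trans; [apply Cmod_Cexp_le|]. apply exp_le.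
        rewrite Cmod_mult, Cmod_opp, Cmod_R, Rabs_pos_eq by lra.
        rewrite <- (Rmult_1_l (Cmod z)) at 2. apply Rmult_le_compat_r; lra.
      + unfold Rdiv. rewrite (Rmult_comm (Cmod z ^ S n)).
        apply Rmult_le_compat_l; [apply Rlt_le, Rinv_0_lt_compat; auto|].
        simpl. apply Rmult_le_compat_l; auto. apply pow_incr. split; [apply Rmult_le_pos; lra|].
        rewrite <- (Rmult_1_l (Cmod z)) at 2. apply Rmult_le_compat_r; lra. }
  unfold phi in Hphi. rewrite !Cmult_0_l, !Cmult_1_l, Cexp_0, Cmult_1_l in Hphi.
  assert (E0 : forall m, exp_taylor m 0 = 1).
  { induction m; auto. simpl. rewrite IHm, Cmult_0_l, Cmult_0_r. ring. }
  rewrite E0 in Hphi.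
  (* Multiplying back by [Cexp z] costs a second factor exp |z|, hence the 2 in the exponent of the
     bound. *)
  replace (exp_taylor n z - Cexp z)%C with (Cexp z * (Cexp (- z) * exp_taylor n z - 1))%C.
  - rewrite Cmod_mult. replace (2 * Cmod z) with (Cmod z + Cmod z) by ring. rewrite exp_plus.
    replace (2 * (exp (Cmod z) * exp (Cmod z)) * (Cmod z ^ S n / INR (fact n)))
      with (exp (Cmod z) * (2 * (exp (Cmod z) * (Cmod z ^ S n / INR (fact n))))) by ring.
    apply Rmult_le_compat; auto using Cmod_ge_0, Cmod_Cexp_le.
  - replace (Cexp z * (Cexp (- z) * exp_taylor n z - 1))%C
      with (Cexp z * Cexp (- z) * exp_taylor n z - Cexp z)%C by ring.
    rewrite Cexp_opp. ring.
Qed.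

(** Stated for all h, not only small ones: besides the derivative of [Cexp] it serves to
    differentiate under the integral sign, where h is multiplied by an unbounded logarithm. *)
Lemma Cexp_quadratic h : Cmod (Cexp h - 1 - h)%C <= 2 * exp (2 * Cmod h) * (Cmod h) ^ 2.
Proof.
  assert (H := exp_taylor_error 1 h). simpl in H.
  replace (1 + (/ 1)%R * (h * 1) - Cexp h)%C with (- (Cexp h - 1 - h))%C in H
    by (rewrite Rinv_1; ring).
  rewrite Cmod_opp in H. simpl. unfold Rdiv in H. rewrite Rinv_1, Rmult_1_r in H. exact H.
Qed.

Lemma Cexp_deriv z : Cderiv Cexp z (Cexp z).
Proof.
  intros eps Heps.
  assert (P : 0 < Cmod (Cexp z)) by (rewrite Cmod_Cexp; apply exp_pos).
  assert (E2 := exp_pos 2).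
  set (K := 2 * exp 2 * Cmod (Cexp z)).
  assert (HK : 0 < K) by (unfold K; repeat apply Rmult_lt_0_compat; lra).
  exists (Rmin 1 (eps / K)); split.
  { apply Rmin_glb_lt; [lra|]. now apply Rdiv_lt_0_compat. }
  intros h Hh.
  assert (H1 := Rlt_le_trans _ _ _ Hh (Rmin_l _ _)).
  assert (H2 := Rlt_le_trans _ _ _ Hh (Rmin_r _ _)).
  rewrite Cexp_plus.
  replace (Cexp z * Cexp h - Cexp z - Cexp z * h)%C with (Cexp z * (Cexp h - 1 - h))%C by ring.
  rewrite Cmod_mult.
  assert (H0 := Cmod_ge_0 h).
  apply Rle_trans with (Cmod (Cexp z) * (2 * exp 2 * (Cmod h) ^ 2)).
  - apply Rmult_le_compat_l; [lra|]. eapply Rle_trans; [apply Cexp_quadratic|].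
    apply Rmult_le_compat_r; [apply pow2_ge_0|]. apply Rmult_le_compat_l; [lra|].
    apply exp_le; lra.
  - replace (Cmod (Cexp z) * (2 * exp 2 * Cmod h ^ 2)) with (K * Cmod h * Cmod h) by (unfold K; ring).
    apply Rmult_le_compat_r; auto.
    apply Rle_trans with (K * (eps / K)); [|right; field; lra].
    apply Rmult_le_compat_l; lra.
Qed.

Lemma Cdiff_Cexp z : Cdiff Cexp z.
Proof. eexists; apply Cexp_deriv. Qed.

(** * The complex sine and cosine *)

Definition Ccos (z : C) : C := ((Cexp (Ci * z) + Cexp (- (Ci * z))) / 2)%C.
Definition Csin (z : C) : C := ((Cexp (Ci * z) - Cexp (- (Ci * z))) / (2 * Ci))%C.

Lemma Ccos_R x : Ccos (RtoC x) = RtoC (cos x).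
Proof.
  unfold Ccos, Cexp; simpl.
  replace (0 * x - 1 * 0) with 0 by ring. replace (0 * 0 + 1 * x) with x by ring.
  rewrite Ropp_0, exp_0, cos_neg, sin_neg. apply injective_projections; simpl; field.
Qed.

Lemma Csin_comp a b : Csin (a, b) = (sin a * cosh b, cos a * sinh b).
Proof.
  unfold Csin, Cexp; simpl.
  replace (0 * a - 1 * b) with (- b) by ring. replace (0 * b + 1 * a) with a by ring.
  rewrite Ropp_involutive, cos_neg, sin_neg. unfold cosh, sinh.
  apply injective_projections; simpl; field.
Qed.

Lemma Cdiff_Cexp_comp f z : Cdiff f z -> Cdiff (fun w => Cexp (f w)) z.
Proof. intros H. apply (Cdiff_comp Cexp f); auto. apply Cdiff_Cexp. Qed.

Lemma Cdiff_Ccos z : Cdiff Ccos z.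
Proof.
  apply Cdiff_mult; [|apply Cdiff_const].
  apply Cdiff_plus; apply Cdiff_Cexp_comp.
  - apply Cdiff_mult; [apply Cdiff_const|apply Cdiff_id].
  - apply (Cdiff_ext_loc (fun w => RtoC 0 - Ci * w)%C).
    + exists 1; split; [lra|]. intros; ring.
    + apply Cdiff_minus; [apply Cdiff_const|]. apply Cdiff_mult; [apply Cdiff_const|apply Cdiff_id].
Qed.

Lemma Ci_neq_0 : Ci <> 0.
Proof. apply Ci_nz. Qed.

Lemma two_Ci_neq_0 : (2 * Ci)%C <> 0.
Proof. apply Cmult_neq_0; [|apply Ci_nz]. intros H. apply RtoC_inj in H. lra. Qed.

(** A simple zero at 0 gives |sin u| >= |u| / 2 for small u, which keeps the quotient in Poisson's
    formula bounded near its singularity. *)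
Lemma Csin_deriv_0 : Cderiv Csin 0 1.
Proof.
  assert (D : forall k, Cderiv (fun w => k * w)%C 0 k).
  { intros k. assert (X := Cderiv_mult (fun _ => k) (fun w => w) 0 _ _ (Cderiv_const k 0) (Cderiv_id 0)).
    simpl in X. replace (0 * 0 + k * 1)%C with k in X by ring. exact X. }
  assert (D1 := D Ci).
  assert (D2 : Cderiv (fun w => - (Ci * w))%C 0 (- Ci)%C).
  { replace (fun w => - (Ci * w))%C with (fun w => (- Ci) * w)%C
      by (apply functional_extensionality; intros; ring).
    apply D. }
  assert (F := Cderiv_comp Cexp _ _ _ _ (Cexp_deriv _) D1).
  assert (G := Cderiv_comp Cexp _ _ _ _ (Cexp_deriv _) D2).
  assert (H := Cderiv_mult _ _ _ _ _ (Cderiv_minus _ _ _ _ _ F G) (Cderiv_const (/ (2 * Ci))%C 0)).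
  simpl in H.
  match type of H with Cderiv _ _ ?l => replace (RtoC 1) with l; [exact H|] end.
  rewrite Cmult_0_r, Copp_0, Cexp_0. field. apply Ci_neq_0.
Qed.

Lemma Cdiff_Csin z : Cdiff Csin z.
Proof.
  apply Cdiff_mult; [|apply Cdiff_const].
  apply Cdiff_minus; apply Cdiff_Cexp_comp.
  - apply Cdiff_mult; [apply Cdiff_const|apply Cdiff_id].
  - apply (Cdiff_ext_loc (fun w => RtoC 0 - Ci * w)%C).
    + exists 1; split; [lra|]. intros; ring.
    + apply Cdiff_minus; [apply Cdiff_const|]. apply Cdiff_mult; [apply Cdiff_const|apply Cdiff_id].
Qed.

Lemma Csin_0 : Csin 0 = 0.
Proof. unfold Csin. rewrite Cmult_0_r, Copp_0. unfold Cdiv, Cminus. rewrite Cplus_opp_r. ring. Qed.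

Lemma Cmod_Ccos_le z : Cmod (Ccos z) <= cosh (Im z).
Proof.
  unfold Ccos, cosh. rewrite Cmod_div by (intros H; apply RtoC_inj in H; lra).
  rewrite Cmod_R, Rabs_pos_eq by lra. unfold Rdiv. apply Rmult_le_compat_r; [lra|].
  eapply Rle_trans; [apply Cmod_triangle|]. rewrite !Cmod_Cexp. simpl.
  replace (0 * fst z - 1 * snd z) with (- Im z) by (unfold Im; ring). rewrite Ropp_involutive. lra.
Qed.

(** The reverse triangle inequality for two exponentials of moduli exp (Im z) and exp (- Im z). *)
Lemma Cmod_Csin_ge z : sinh (Im z) <= Cmod (Csin z).
Proof.
  unfold Csin, sinh. rewrite Cmod_div by apply two_Ci_neq_0.
  rewrite Cmod_mult, Cmod_Ci, Cmod_R, Rabs_pos_eq by lra. unfold Rdiv. rewrite Rmult_1_r.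
  apply Rmult_le_compat_r; [lra|].
  assert (H := Cmod_lower (- Cexp (- (Ci * z))) (Cexp (Ci * z))).
  rewrite Cmod_opp, !Cmod_Cexp in H. simpl in H.
  replace (0 * fst z - 1 * snd z) with (- Im z) in H by (unfold Im; ring). rewrite Ropp_involutive in H.
  unfold Cminus. rewrite (Cplus_comm (Cexp (Ci * z))). exact H.
Qed.

(** * The principal logarithm *)

Lemma Ccont_pair (u v : C -> R) (z : C) :
  @continuous C_UniformSpace R_UniformSpace u z ->
  @continuous C_UniformSpace R_UniformSpace v z -> Ccont (fun w => (u w, v w)) z.
Proof.
  intros Hu Hv eps Heps.
  assert (He : 0 < eps / 2) by lra.
  destruct (proj1 (filterlim_locally _ _) Hu (mkposreal _ He)) as [d Hd].
  destruct (proj1 (filterlim_locally _ _) Hv (mkposreal _ He)) as [d' Hd'].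
  exists (Rmin d d'); split; [apply Rmin_glb_lt; apply cond_pos|]. intros h Hh.
  assert (E : (z + h - z)%C = h) by ring.
  specialize (Hd (z + h)%C). specialize (Hd' (z + h)%C).
  assert (A : Rabs (u (z + h)%C - u z) < eps / 2).
  { apply Hd. apply Cmod_lt_ball. rewrite E. eapply Rlt_le_trans; [exact Hh|apply Rmin_l]. }
  assert (B : Rabs (v (z + h)%C - v z) < eps / 2).
  { apply Hd'. apply Cmod_lt_ball. rewrite E. eapply Rlt_le_trans; [exact Hh|apply Rmin_r]. }
  replace ((u (z + h)%C, v (z + h)%C) - (u z, v z))%C with (u (z + h)%C - u z, v (z + h)%C - v z)
    by (apply injective_projections; simpl; ring).
  eapply Rle_trans; [apply Cmod_R_le|]. lra.
Qed.

Lemma continuous_Cmod (z : C) : @continuous C_UniformSpace R_UniformSpace Cmod z.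
Proof.
  apply filterlim_locally. intros eps.
  assert (He : 0 < eps / 2) by (generalize (cond_pos eps); lra).
  exists (mkposreal _ He). intros w Hw. apply ball_Cmod_lt in Hw. simpl in Hw.
  change (Rabs (Cmod w - Cmod z) < eps).
  assert (A := Cmod_lower w (- z)). assert (B := Cmod_lower z (- w)).
  rewrite Cmod_opp in A, B.
  change (w + - z)%C with (w - z)%C in A. change (z + - w)%C with (z - w)%C in B.
  rewrite (Cmod_minus_sym z) in B.
  apply Rabs_lt_between. lra.
Qed.

(* The principal logarithm on [0 < Re w] only. *)
Definition Clog (w : C) : C := (ln (Cmod w), atan (Im w / Re w)).

Lemma Re_pos_neq_0 w : 0 < Re w -> w <> 0.
Proof. intros H ->. simpl in H. lra. Qed.

Lemma Clog_cont w : 0 < Re w -> Ccont Clog w.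
Proof.
  intros H. assert (P : 0 < Cmod w) by (apply Cmod_gt_0; now apply Re_pos_neq_0).
  apply Ccont_pair.
  - apply (@continuous_comp C_UniformSpace R_UniformSpace R_UniformSpace Cmod ln).
    + apply continuous_Cmod.
    + now apply continuous_ln.
  - apply (@continuous_comp C_UniformSpace R_UniformSpace R_UniformSpace (fun w => Im w / Re w) atan).
    + apply (@continuous_mult C_UniformSpace R_AbsRing).
      * destruct w. apply (@continuous_snd R_UniformSpace R_UniformSpace).
      * apply (@continuous_comp C_UniformSpace R_UniformSpace R_UniformSpace Re Rinv).
        -- destruct w. apply (@continuous_fst R_UniformSpace R_UniformSpace).
        -- apply continuous_Rinv. lra.
    + apply continuous_atan.
Qed.

Lemma Cexp_Clog w : 0 < Re w -> Cexp (Clog w) = w.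
Proof.
  intros H. assert (P : 0 < Cmod w) by (apply Cmod_gt_0; now apply Re_pos_neq_0).
  destruct w as [x y]. unfold Cexp, Clog; simpl in *. rewrite exp_ln by auto.
  rewrite cos_atan, sin_atan.
  assert (E : Cmod (x, y) = x * sqrt (1 + Rsqr (y / x))).
  { unfold Cmod; simpl. rewrite <- (sqrt_square x) at 3 by lra. rewrite <- sqrt_mult_alt by nra.
    f_equal. unfold Rsqr. field. lra. }
  assert (Q : 0 < sqrt (1 + Rsqr (y / x))).
  { apply sqrt_lt_R0. assert (0 <= Rsqr (y / x)) by apply Rle_0_sqr. lra. }
  rewrite E. apply injective_projections; simpl; field; lra.
Qed.

Lemma Clog_R x : 0 < x -> Clog (RtoC x) = RtoC (ln x).
Proof.
  intros H. unfold Clog. rewrite Cmod_R, Rabs_pos_eq by lra. simpl.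
  unfold Rdiv. rewrite Rmult_0_l, atan_0. reflexivity.
Qed.

(* [Clog] is a continuous right inverse of [Cexp], whose derivative does not vanish. *)
Lemma Cdiff_Clog w : 0 < Re w -> Cdiff Clog w.
Proof.
  intros H. assert (Hw : w <> 0) by now apply Re_pos_neq_0.
  assert (P : 0 < Cmod w) by now apply Cmod_gt_0.
  exists (/ w)%C. intros eps Heps.
  (* With q = h / w and k the increment of the logarithm, |q - k| <= e |k|: the bound 1 / 2 gives
     |k| <= 2 |q|, and the other one then makes the error at most eps |h|. *)
  set (e := Rmin (1 / 2) (eps * Cmod w / 2)).
  assert (He : 0 < e).
  { apply Rmin_glb_lt; [lra|]. apply Rdiv_lt_0_compat; [|lra]. now apply Rmult_lt_0_compat. }
  destruct (Cexp_deriv 0 e He) as [d [Hd H1]].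
  assert (Hd2 : 0 < d / 2) by lra.
  destruct (Clog_cont w H _ Hd2) as [d' [Hd' H2]].
  exists (Rmin d' (Re w)); split; [now apply Rmin_glb_lt|]. intros h Hh.
  specialize (H2 h (Rlt_le_trans _ _ _ Hh (Rmin_l _ _))).
  assert (Hre : 0 < Re (w + h)).
  { assert (A := Rlt_le_trans _ _ _ Hh (Rmin_r _ _)). assert (B := re_le_Cmod h).
    rewrite re_plus. apply Rabs_le_between in B. lra. }
  set (k := (Clog (w + h) - Clog w)%C) in *.
  assert (E : (w * (Cexp k - 1))%C = h).
  { assert (E1 : Cexp (Clog w + k) = (w + h)%C).
    { unfold k. rewrite Cplus_minus. now apply Cexp_Clog. }
    rewrite Cexp_plus, Cexp_Clog in E1 by auto. 
    replace h with (w + h - w)%C by ring. rewrite <- E1. ring. }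
  specialize (H1 k). rewrite Cplus_0_l, Cexp_0, Cmult_1_l in H1.
  assert (H3 := H1 ltac:(lra)). clear H1.
  set (q := (h / w)%C).
  assert (Eq : (Cexp k - 1)%C = q) by (unfold q; rewrite <- E; field; auto).
  rewrite Eq in H3.
  assert (Hk : Cmod k <= 2 * Cmod q).
  { assert (A := Cmod_lower (- k) q). rewrite Cmod_opp in A.
    replace (- k + q)%C with (q - k)%C in A by ring.
    assert (e * Cmod k <= 1 / 2 * Cmod k).
    { apply Rmult_le_compat_r; [apply Cmod_ge_0|apply Rmin_l]. }
    lra. }
  replace (k - / w * h)%C with (- (q - k))%C by (unfold q; field; auto).
  rewrite Cmod_opp.
  assert (Hq : Cmod q = Cmod h / Cmod w) by (unfold q; now apply Cmod_div).
  apply Rle_trans with (e * (2 * Cmod q)).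
  - eapply Rle_trans; [exact H3|]. apply Rmult_le_compat_l; lra.
  - apply Rle_trans with ((eps * Cmod w / 2) * (2 * Cmod q)).
    + apply Rmult_le_compat_r; [|apply Rmin_r]. generalize (Cmod_ge_0 q); lra.
    + right. rewrite Hq. field. lra.
Qed.

(** * Integrals over the real line *)

(** Symmetric integer cut-offs match the rectangles [-1/2, 1/2] x [-N, N] of Poisson's formula. *)
Definition Csym (f : R -> C) (N : nat) : C := CInt f (- INR N) (INR N).

Definition Clim (u : nat -> C) (l : C) : Prop :=
  forall eps, 0 < eps -> exists N0, forall N, (N0 <= N)%nat -> Cmod (u N - l)%C <= eps.

Definition is_line_int (f : R -> C) (l : C) : Prop := Clim (Csym f) l.

(* Arbitrary when the limit does not exist. *)
Definition line_int (f : R -> C) : C := epsilon (inhabits (RtoC 0)) (is_line_int f).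

Lemma Clim_unique u l m : Clim u l -> Clim u m -> l = m.
Proof.
  intros H1 H2. destruct (Ceq_dec l m) as [|Hne]; auto. exfalso.
  assert (P : 0 < Cmod (l - m)%C) by (apply Cmod_gt_0; now apply Cminus_eq_contra).
  destruct (H1 (Cmod (l - m)%C / 4)) as [N1 A]; [lra|].
  destruct (H2 (Cmod (l - m)%C / 4)) as [N2 B]; [lra|].
  specialize (A (N1 + N2)%nat ltac:(lia)). specialize (B (N1 + N2)%nat ltac:(lia)).
  set (x := u (N1 + N2)%nat) in *.
  assert (T := Cmod_triangle (x - m) (- (x - l))). rewrite Cmod_opp in T.
  replace (x - m + - (x - l))%C with (l - m)%C in T by ring. lra.
Qed.

Lemma Clim_ext u v l : (forall n, u n = v n) -> Clim u l -> Clim v l.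
Proof.
  intros E H eps Heps. destruct (H eps Heps) as [N0 HN]. exists N0. intros N L.
  rewrite <- E. auto.
Qed.

Lemma Clim_plus u v l m : Clim u l -> Clim v m -> Clim (fun n => u n + v n)%C (l + m)%C.
Proof.
  intros H1 H2 eps Heps.
  destruct (H1 (eps / 2)) as [N1 A]; [lra|]. destruct (H2 (eps / 2)) as [N2 B]; [lra|].
  exists (N1 + N2)%nat. intros N L. specialize (A N ltac:(lia)). specialize (B N ltac:(lia)).
  replace (u N + v N - (l + m))%C with ((u N - l) + (v N - m))%C by ring.
  eapply Rle_trans; [apply Cmod_triangle|]. lra.
Qed.

Lemma Clim_mult_const k u l : Clim u l -> Clim (fun n => k * u n)%C (k * l)%C.
Proof.
  intros H eps Heps. assert (K := Cmod_ge_0 k).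
  destruct (H (eps / (Cmod k + 1))) as [N0 A]; [apply Rdiv_lt_0_compat; lra|].
  exists N0. intros N L. specialize (A N L).
  replace (k * u N - k * l)%C with (k * (u N - l))%C by ring. rewrite Cmod_mult.
  apply Rle_trans with (Cmod k * (eps / (Cmod k + 1))); [now apply Rmult_le_compat_l|].
  apply Rle_trans with ((Cmod k + 1) * (eps / (Cmod k + 1))); [|right; field; lra].
  apply Rmult_le_compat_r; [|lra]. apply Rlt_le, Rdiv_lt_0_compat; lra.
Qed.

Lemma Clim_minus u v l m : Clim u l -> Clim v m -> Clim (fun n => u n - v n)%C (l - m)%C.
Proof.
  intros H1 H2. apply (Clim_mult_const (- RtoC 1)%C) in H2.
  assert (H := Clim_plus _ _ _ _ H1 H2). cbv beta in H.
  replace (l - m)%C with (l + - (1) * m)%C by ring.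
  eapply Clim_ext; [|exact H]. intros; cbv beta; ring.
Qed.

Lemma Clim_const l : Clim (fun _ => l) l.
Proof.
  intros eps Heps. exists 0%nat. intros. replace (l - l)%C with (RtoC 0) by ring. rewrite Cmod_0. lra.
Qed.

Lemma Clim_bound u l M : Clim u l -> (forall n, Cmod (u n) <= M) -> Cmod l <= M.
Proof.
  intros H HM. apply Rnot_lt_le. intros L.
  destruct (H ((Cmod l - M) / 2)) as [N A]; [lra|]. specialize (A N (Nat.le_refl _)).
  specialize (HM N). assert (T := Cmod_triangle (u N) (- (u N - l))). rewrite Cmod_opp in T.
  replace (u N + - (u N - l))%C with l in T by ring. lra.
Qed.

Lemma is_line_int_unique f l m : is_line_int f l -> is_line_int f m -> l = m.
Proof. apply Clim_unique. Qed.

Lemma line_int_eq f l : is_line_int f l -> line_int f = l.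
Proof.
  intros H. apply (is_line_int_unique f); auto.
  unfold line_int. apply epsilon_spec. now exists l.
Qed.

(** A majorant for dominated convergence. Integrability is recorded as a uniform bound on the
    symmetric integrals, which increase with N because [D] is nonnegative. *)
Definition weight (D : R -> R) (M : R) : Prop :=
  (forall t, continuous D t) /\ (forall t, 0 <= D t) /\
  (forall N : nat, RInt D (- INR N) (INR N) <= M).

Lemma weight_ex D M a b : weight D M -> ex_RInt D a b.
Proof. intros [H _]. apply (@ex_RInt_continuous R_CompleteNormedModule). auto. Qed.

Lemma RCcont_ex f a b : (forall t, RCcont f t) -> Cex f a b.
Proof. intros; apply Cex_cont; auto. Qed.

Lemma Csym_plus f g N : (forall t, RCcont f t) -> (forall t, RCcont g t) ->
  Csym (fun t => f t + g t)%C N = (Csym f N + Csym g N)%C.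
Proof. intros F G. apply CInt_plus; now apply RCcont_ex. Qed.

Lemma Csym_minus f g N : (forall t, RCcont f t) -> (forall t, RCcont g t) ->
  Csym (fun t => f t - g t)%C N = (Csym f N - Csym g N)%C.
Proof. intros F G. apply CInt_minus; now apply RCcont_ex. Qed.

Lemma Csym_mult k f N : (forall t, RCcont f t) -> Csym (fun t => k * f t)%C N = (k * Csym f N)%C.
Proof. intros F. apply CInt_mult; now apply RCcont_ex. Qed.

Lemma Nneg_le N : - INR N <= INR N.
Proof. generalize (pos_INR N); lra. Qed.

(** [tau N] is the distance of the N-th integral of [D] from the supremum of all of them. It is the
    same for every function dominated by [D], which makes the later limits uniform. *)
Lemma weight_tail D M : weight D M -> exists tau : nat -> R,
  (forall eps, 0 < eps -> exists N0, forall N, (N0 <= N)%nat -> tau N <= eps) /\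
  forall f N N', (N <= N')%nat -> (forall t, RCcont f t) -> (forall t, Cmod (f t) <= D t) ->
     Cmod (Csym f N' - Csym f N)%C <= tau N.
Proof.
  intros HD. assert (Hex := fun a b => weight_ex D M a b HD). destruct HD as (HC & H0 & HM).
  set (u := fun N : nat => RInt D (- INR N) (INR N)).
  assert (Hsplit : forall N N', (N <= N')%nat ->
     u N' = RInt D (- INR N') (- INR N) + u N + RInt D (INR N) (INR N')).
  { intros N N' L. unfold u.
    assert (E1 := RInt_Chasles D (- INR N') (- INR N) (INR N) (Hex _ _) (Hex _ _)).
    assert (E2 := RInt_Chasles D (- INR N') (INR N) (INR N') (Hex _ _) (Hex _ _)).
    rewrite <- E2, <- E1. reflexivity. }
  assert (Hpos : forall a b, a <= b -> 0 <= RInt D a b).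
  { intros a b Hab. apply RInt_ge_0; auto. }
  assert (Hinc : forall N N', (N <= N')%nat -> u N <= u N').
  { intros N N' L. rewrite (Hsplit N N' L). assert (LL := le_INR _ _ L).
    assert (0 <= RInt D (- INR N') (- INR N)) by (apply Hpos; lra).
    assert (0 <= RInt D (INR N) (INR N')) by (apply Hpos; lra). lra. }
  destruct (completeness (fun r => exists N, r = u N)) as [S [S1 S2]].
  { exists M. intros r [N ->]. apply HM. }
  { exists (u 0%nat); now exists 0%nat. }
  exists (fun N => S - u N). split.
  - intros eps Heps.
    destruct (classic (exists N, S - eps < u N)) as [[N0 HN]|Hn].
    + exists N0. intros N L. assert (A := Hinc N0 N L). lra.
    + exfalso. assert (S <= S - eps); [|lra]. apply S2. intros r [N ->].
      apply Rnot_lt_le. intros A. apply Hn. now exists N.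
  - intros f N N' L Hf Hb. assert (LL := le_INR _ _ L).
    assert (E : (Csym f N' - Csym f N)%C = (CInt f (- INR N') (- INR N) + CInt f (INR N) (INR N'))%C).
    { unfold Csym.
      rewrite <- (CInt_Chasles f (- INR N') (INR N) (INR N')),
              <- (CInt_Chasles f (- INR N') (- INR N) (INR N)) by now apply RCcont_ex.
      ring. }
    rewrite E. eapply Rle_trans; [apply Cmod_triangle|].
    assert (A : Cmod (CInt f (- INR N') (- INR N)) <= RInt D (- INR N') (- INR N)).
    { apply CInt_le; auto; try lra. now apply RCcont_ex. }
    assert (B : Cmod (CInt f (INR N) (INR N')) <= RInt D (INR N) (INR N')).
    { apply CInt_le; auto; try lra. now apply RCcont_ex. }
    assert (F : u N' <= S) by (apply S1; now exists N').
    rewrite (Hsplit N N' L) in F. lra.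
Qed.

Lemma R_cauchy_limit (u : nat -> R) (tau : nat -> R) :
  (forall eps, 0 < eps -> exists N0, forall N, (N0 <= N)%nat -> tau N <= eps) ->
  (forall N N', (N <= N')%nat -> Rabs (u N' - u N) <= tau N) ->
  exists l, forall N, Rabs (u N - l) <= tau N.
Proof.
  intros Ht Hu. destruct (Rcomplete.R_complete u) as [l Hl].
  - intros eps Heps. destruct (Ht (eps / 4)) as [N0 HN]; [lra|].
    exists N0. intros n m Hn Hm. unfold Rdist.
    assert (A := Hu N0 n Hn). assert (B := Hu N0 m Hm). specialize (HN N0 (Nat.le_refl _)).
    replace (u n - u m) with ((u n - u N0) - (u m - u N0)) by ring.
    eapply Rle_lt_trans; [apply Rabs_triang|]. rewrite Rabs_Ropp. lra.
  - exists l. intros N. apply Rnot_lt_le. intros L.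
    destruct (Hl (Rabs (u N - l) - tau N)) as [N1 HN]; [lra|].
    specialize (HN (N + N1)%nat ltac:(lia)). unfold Rdist in HN.
    specialize (Hu N (N + N1)%nat ltac:(lia)).
    assert (T := Rabs_triang (u (N + N1)%nat - l) (- (u (N + N1)%nat - u N))).
    rewrite Rabs_Ropp in T.
    replace (u (N + N1)%nat - l + - (u (N + N1)%nat - u N)) with (u N - l) in T by ring. lra.
Qed.

Lemma line_int_correct D M f : weight D M -> (forall t, RCcont f t) ->
  (forall t, Cmod (f t) <= D t) -> is_line_int f (line_int f).
Proof.
  intros HD Hf Hb. destruct (weight_tail D M HD) as [tau [T1 T2]].
  unfold line_int. apply epsilon_spec.
  destruct (R_cauchy_limit (fun N => fst (Csym f N)) tau T1) as [l1 H1].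
  { intros N N' L. eapply Rle_trans; [|apply (T2 f N N' L Hf Hb)].
    apply (re_le_Cmod (Csym f N' - Csym f N)%C). }
  destruct (R_cauchy_limit (fun N => snd (Csym f N)) tau T1) as [l2 H2].
  { intros N N' L. eapply Rle_trans; [|apply (T2 f N N' L Hf Hb)].
    apply (im_le_Cmod (Csym f N' - Csym f N)%C). }
  exists (l1, l2). intros eps Heps. destruct (T1 (eps / 2)) as [N0 HN]; [lra|].
  exists N0. intros N L. specialize (HN N L). specialize (H1 N). specialize (H2 N).
  replace (Csym f N - (l1, l2))%C with (fst (Csym f N) - l1, snd (Csym f N) - l2)
    by (apply injective_projections; simpl; ring).
  eapply Rle_trans; [apply Cmod_R_le|]. lra.
Qed.

Lemma is_line_int_bound D M f l : weight D M -> (forall t, RCcont f t) ->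
  (forall t, Cmod (f t) <= D t) -> is_line_int f l -> Cmod l <= M.
Proof.
  intros HD Hf Hb H. apply (Clim_bound _ _ _ H). intros N.
  apply Rle_trans with (RInt D (- INR N) (INR N)); [|apply HD].
  apply CInt_le; auto using Nneg_le, RCcont_ex. eapply weight_ex, HD.
Qed.

Lemma weight_scal D M k : 0 <= k -> weight D M -> weight (fun t => k * D t) (k * M).
Proof.
  intros Hk HD. assert (Hex := fun a b => weight_ex D M a b HD). destruct HD as (HC & H0 & HM).
  split; [|split].
  - intros t. apply (@continuous_scal_r R_UniformSpace R_AbsRing R_NormedModule k D t (HC t)).
  - intros t. now apply Rmult_le_pos.
  - intros N. assert (E := @RInt_scal R_CompleteNormedModule D (- INR N) (INR N) k (Hex _ _)).
    change (RInt (fun t => k * D t) (- INR N) (INR N) = k * RInt D (- INR N) (INR N)) in E.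
    rewrite E. now apply Rmult_le_compat_l.
Qed.

(** A cut-off N0 with common tail at most eps / 8 handles all the functions at once; on [-N0, N0]
    uniform convergence does the rest. *)
Lemma line_int_dominated D M (f : nat -> R -> C) (g : R -> C) : weight D M ->
  (forall k t, RCcont (f k) t) -> (forall t, RCcont g t) ->
  (forall k t, Cmod (f k t) <= D t) -> (forall t, Cmod (g t) <= D t) ->
  (forall (T : R) eps, 0 < eps -> exists K, forall k t, (K <= k)%nat -> Rabs t <= T ->
     Cmod (f k t - g t)%C <= eps) ->
  Clim (fun k => line_int (f k)) (line_int g).
Proof.
  intros HD Hf Hg Bf Bg HU eps Heps.
  destruct (weight_tail D M HD) as [tau [T1 T2]].
  destruct (T1 (eps / 8)) as [N0 HN]; [lra|]. specialize (HN N0 (Nat.le_refl _)).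
  assert (Tail : forall h, (forall t, RCcont h t) -> (forall t, Cmod (h t) <= D t) ->
     Cmod (Csym h N0 - line_int h)%C <= eps / 4).
  { intros h Ch Bh. destruct (line_int_correct D M h HD Ch Bh (eps / 8)) as [N1 H1]; [lra|].
    specialize (H1 (N0 + N1)%nat ltac:(lia)).
    specialize (T2 h N0 (N0 + N1)%nat ltac:(lia) Ch Bh).
    assert (T := Cmod_triangle (Csym h (N0 + N1) - line_int h) (- (Csym h (N0 + N1) - Csym h N0))).
    rewrite Cmod_opp in T.
    replace (Csym h (N0 + N1) - line_int h + - (Csym h (N0 + N1) - Csym h N0))%C
      with (Csym h N0 - line_int h)%C in T by ring. lra. }
  assert (P : 0 < 2 * INR N0 + 1) by (generalize (pos_INR N0); lra).
  destruct (HU (INR N0) (eps / 4 / (2 * INR N0 + 1))) as [K HK].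
  { apply Rdiv_lt_0_compat; lra. }
  exists K. intros k Lk.
  assert (Mid : Cmod (Csym (f k) N0 - Csym g N0)%C <= eps / 4).
  { rewrite <- Csym_minus by auto.
    eapply Rle_trans.
    - apply (CInt_le_const _ (- INR N0) (INR N0) (eps / 4 / (2 * INR N0 + 1))); [apply Nneg_le| |].
      + apply RCcont_ex. intros; now apply RCcont_minus.
      + intros t Ht. apply HK; auto. apply Rabs_le; lra.
    - replace (INR N0 - - INR N0) with (2 * INR N0) by ring.
      apply Rle_trans with ((2 * INR N0 + 1) * (eps / 4 / (2 * INR N0 + 1))); [|right; field; lra].
      apply Rmult_le_compat_r; [|lra]. apply Rlt_le, Rdiv_lt_0_compat; lra. }
  assert (A := Tail (f k) (Hf k) (Bf k)). assert (B := Tail g Hg Bg).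
  replace (line_int (f k) - line_int g)%C with
    (- (Csym (f k) N0 - line_int (f k)) + ((Csym (f k) N0 - Csym g N0) + (Csym g N0 - line_int g)))%C by ring.
  eapply Rle_trans; [apply Cmod_triangle|]. rewrite Cmod_opp.
  eapply Rle_trans; [apply Rplus_le_compat_l, Cmod_triangle|]. lra.
Qed.

Lemma is_line_int_plus f g l m : (forall t, RCcont f t) -> (forall t, RCcont g t) ->
  is_line_int f l -> is_line_int g m -> is_line_int (fun t => f t + g t)%C (l + m)%C.
Proof.
  intros F G H1 H2. eapply Clim_ext; [|apply (Clim_plus _ _ _ _ H1 H2)].
  intros N. cbv beta. now rewrite Csym_plus.
Qed.

Lemma is_line_int_minus f g l m : (forall t, RCcont f t) -> (forall t, RCcont g t) ->
  is_line_int f l -> is_line_int g m -> is_line_int (fun t => f t - g t)%C (l - m)%C.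
Proof.
  intros F G H1 H2. eapply Clim_ext; [|apply (Clim_minus _ _ _ _ H1 H2)].
  intros N. cbv beta. now rewrite Csym_minus.
Qed.

Lemma is_line_int_mult k f l : (forall t, RCcont f t) ->
  is_line_int f l -> is_line_int (fun t => k * f t)%C (k * l)%C.
Proof.
  intros F H. eapply Clim_ext; [|apply (Clim_mult_const k _ _ H)].
  intros N. cbv beta. now rewrite Csym_mult.
Qed.

(** * Poisson's formula for a strip *)

Lemma cosh_ge_1 y : 1 <= cosh y.
Proof.
  unfold cosh. assert (A := exp_ineq1_le y). assert (B := exp_ineq1_le (- y)). lra.
Qed.

Lemma sinh_ge_half y : 0 <= y -> y / 2 <= sinh y.
Proof.
  intros H. unfold sinh. assert (A := exp_ineq1_le y).
  assert (B : exp (- y) <= 1) by (rewrite <- exp_0; apply exp_le; lra). lra.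
Qed.

Lemma continuous_inv_cosh t : continuous (fun t => / cosh (PI * t)) t.
Proof.
  apply (@ex_derive_continuous R_AbsRing R_NormedModule).
  unfold cosh. auto_derive. assert (A := cosh_ge_1 (PI * t)). unfold cosh in A. lra.
Qed.

Lemma RCcont_inv_cosh t : RCcont (fun t => RtoC (/ cosh (PI * t))) t.
Proof. apply RCcont_RtoC, continuous_inv_cosh. Qed.

Lemma atan_le_id z : 0 <= z -> 0 <= atan z <= z.
Proof.
  intros Hz. destruct (MVT_gen atan 0 z (fun x => / (1 + x ^ 2))) as [c [Hc E]].
  - intros x _. auto_derive; auto. field. nra.
  - intros x _. apply continuity_pt_filterlim. apply continuous_atan.
  - rewrite atan_0, !Rminus_0_r in E. rewrite E.
    assert (0 < / (1 + c ^ 2) <= 1).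
    { split; [apply Rinv_0_lt_compat; nra|]. rewrite <- Rinv_1. apply Rinv_le_contravar; nra. }
    split; nra.
Qed.

(** The total mass of the Poisson kernel at the centre of the strip, from the primitive (2 / PI)
    atan (exp (PI t)). *)
Lemma is_line_int_inv_cosh : is_line_int (fun t => RtoC (/ cosh (PI * t))) 1.
Proof.
  assert (HPI := PI_RGT_0).
  assert (E : forall N, Csym (fun t => RtoC (/ cosh (PI * t))) N
     = RtoC (1 - 4 / PI * atan (exp (- (PI * INR N))))).
  { intros N. apply CInt_unique, is_RInt_C; simpl. split.
    - replace (1 - 4 / PI * atan (exp (- (PI * INR N)))) with
        (minus (2 / PI * atan (exp (PI * INR N))) (2 / PI * atan (exp (PI * - INR N)))).
      + apply (is_RInt_derive (fun t => 2 / PI * atan (exp (PI * t))) (fun t => / cosh (PI * t))).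
        * intros t _. auto_derive; auto. unfold cosh. rewrite exp_Ropp.
          assert (P := exp_pos (PI * t)). field. split; [|split]; try nra. 
        * intros t _. apply continuous_inv_cosh.
      + unfold minus, plus, opp; simpl.
        replace (PI * - INR N) with (- (PI * INR N)) by ring.
        replace (exp (PI * INR N)) with (/ exp (- (PI * INR N))) by (rewrite exp_Ropp, Rinv_inv; auto).
        rewrite atan_inv by apply exp_pos. field. lra.
    - assert (H := @is_RInt_const R_NormedModule (- INR N) (INR N) 0).
      change (scal (INR N - - INR N) 0) with ((INR N - - INR N) * 0) in H. now rewrite Rmult_0_r in H. }
  intros eps Heps.
  destruct (INR_unbounded (4 / PI / eps)) as [N0 HN].
  exists N0. intros N L. rewrite E, <- RtoC_minus, Cmod_R.
  assert (LL := le_INR _ _ L).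
  replace (1 - 4 / PI * atan (exp (- (PI * INR N))) - 1) with (- (4 / PI * atan (exp (- (PI * INR N))))) by ring.
  assert (P4 : 0 < 4 / PI) by (apply Rdiv_lt_0_compat; lra).
  destruct (atan_le_id (exp (- (PI * INR N)))) as [A B]; [apply Rlt_le, exp_pos|].
  rewrite Rabs_Ropp, Rabs_pos_eq by (apply Rmult_le_pos; lra).
  assert (P0 : 0 < 4 / PI / eps) by (apply Rdiv_lt_0_compat; lra).
  apply Rle_trans with (4 / PI * / INR N).
  - apply Rmult_le_compat_l; [lra|]. eapply Rle_trans; [exact B|].
    rewrite exp_Ropp. apply Rinv_le_contravar; [lra|].
    assert (A1 := exp_ineq1_le (PI * INR N)). assert (INR N <= PI * INR N); [|lra].
    rewrite <- (Rmult_1_l (INR N)) at 1. apply Rmult_le_compat_r; [lra|].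
    assert (P := PI2_1). lra.
  - apply Rmult_le_reg_r with (INR N); [lra|]. rewrite Rmult_assoc, Rinv_l by lra.
    apply Rle_trans with (eps * (4 / PI / eps)); [right; field; lra|].
    apply Rmult_le_compat_l; lra.
Qed.

Lemma PI_mult x y : (RtoC PI * (x, y))%C = (PI * x, PI * y).
Proof. apply injective_projections; simpl; ring. Qed.

Lemma Csin_neq_0 x y : - (1 / 2) <= x <= 1 / 2 -> (x, y) <> (0, 0) -> Csin (RtoC PI * (x, y)) <> 0.
Proof.
  intros Hx Hn E. rewrite PI_mult, Csin_comp in E.
  assert (HPI := PI_RGT_0).
  apply (f_equal (fun z => (fst z, snd z))) in E. simpl in E. injection E as E1 E2.
  assert (C1 := cosh_ge_1 (PI * y)).
  apply Rmult_integral in E1. destruct E1 as [E1|E1]; [|lra].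
  assert (x = 0).
  { destruct (Rtotal_order x 0) as [L|[L|L]]; auto; exfalso.
    - assert (0 < sin (PI * - x)) by (apply sin_gt_0; nra).
      replace (PI * - x) with (- (PI * x)) in H by ring. rewrite sin_neg in H. lra.
    - assert (0 < sin (PI * x)) by (apply sin_gt_0; nra). lra. }
  subst x. rewrite Rmult_0_r, cos_0, Rmult_1_l in E2.
  assert (exp (PI * y) = exp (- (PI * y))) by (unfold sinh in E2; lra).
  apply exp_inv in H. apply Hn. f_equal. nra.
Qed.

Lemma Csin_right y : Csin (RtoC PI * ((1 / 2)%R, y)) = RtoC (cosh (PI * y)).
Proof.
  rewrite PI_mult, Csin_comp. replace (PI * (1 / 2)) with (PI / 2) by field.
  rewrite sin_PI2, cos_PI2. apply injective_projections; simpl; ring.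
Qed.

Lemma Csin_left y : Csin (RtoC PI * ((- (1 / 2))%R, y)) = RtoC (- cosh (PI * y)).
Proof.
  rewrite PI_mult, Csin_comp. replace (PI * - (1 / 2)) with (- (PI / 2)) by field.
  rewrite sin_neg, cos_neg, sin_PI2, cos_PI2. apply injective_projections; simpl; ring.
Qed.

Lemma Cdiff_Csin_comp f z : Cdiff f z -> Cdiff (fun w => Csin (f w)) z.
Proof. intros H. apply (Cdiff_comp Csin f); auto. apply Cdiff_Csin. Qed.

(* Poisson's formula at the centre of a strip: integrate
   [(F v - F 0) / sin (PI v)] around [-1/2, 1/2] x [-N, N]. *)
Lemma strip_mean (F : C -> C) :
  (forall x y, - (1 / 2) <= x <= 1 / 2 -> Cdiff F (x, y)) ->
  (forall eps, 0 < eps -> exists N0, forall (N : nat) x y, (N0 <= N)%nat ->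
     - (1 / 2) <= x <= 1 / 2 -> Rabs y = INR N -> Cmod (F (x, y)) <= eps * sinh (PI * INR N)) ->
  is_line_int (fun t => (F ((1 / 2)%R, t) + F ((- (1 / 2))%R, t)) * RtoC (/ cosh (PI * t)))%C (2 * F 0)%C.
Proof.
  intros HF Hdecay.
  assert (HPI := PI_RGT_0).
  set (G := fun v => ((F v - F 0) / Csin (RtoC PI * v))%C).
  assert (HG : forall x y, - (1 / 2) <= x <= 1 / 2 -> (x, y) <> (0, 0) -> Cdiff G (x, y)).
  { intros x y Hx Hn. apply Cdiff_div.
    - now apply Csin_neq_0.
    - apply Cdiff_minus; auto. apply Cdiff_const.
    - apply Cdiff_Csin_comp, Cdiff_mult; [apply Cdiff_const|apply Cdiff_id]. }
  assert (HB : exists r M, 0 < r /\ forall h, 0 < Cmod h < r -> Cmod (G ((0, 0) + h)%C) <= M).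
  { destruct (HF 0 0) as [l Hl]; [lra|]. destruct (Cderiv_lip _ _ _ Hl) as [d [Hd HL]].
    destruct (Csin_deriv_0 (1 / 2)) as [d' [Hd' HS]]; [lra|].
    exists (Rmin d (d' / PI)), ((Cmod l + 1) * 2 / PI). split.
    { apply Rmin_glb_lt; auto. now apply Rdiv_lt_0_compat. }
    intros h [H0 Hh].
    assert (H1 := Rlt_le_trans _ _ _ Hh (Rmin_l _ _)).
    assert (H2 := Rlt_le_trans _ _ _ Hh (Rmin_r _ _)).
    assert (Eh : ((0, 0) + h)%C = h) by (apply injective_projections; simpl; ring).
    specialize (HL h H1). rewrite Eh in *.
    assert (Epi : Cmod (RtoC PI * h) = PI * Cmod h) by (rewrite Cmod_mult, Cmod_R, Rabs_pos_eq; lra).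
    assert (Hs : PI * Cmod h / 2 <= Cmod (Csin (RtoC PI * h))).
    { specialize (HS (RtoC PI * h)%C). rewrite Epi, Cplus_0_l, Csin_0 in HS.
      assert (Q : PI * Cmod h < d').
      { apply (Rmult_lt_compat_l PI) in H2; auto. replace (PI * (d' / PI)) with d' in H2 by (field; lra). auto. }
      specialize (HS Q).
      assert (T := Cmod_lower (RtoC PI * h) (Csin (RtoC PI * h) - 0 - 1 * (RtoC PI * h))).
      replace (RtoC PI * h + (Csin (RtoC PI * h) - 0 - 1 * (RtoC PI * h)))%C with (Csin (RtoC PI * h)) in T by ring.
      rewrite Epi in T. lra. }
    assert (PP : 0 < PI * Cmod h) by (apply Rmult_lt_0_compat; lra).
    unfold G. rewrite Cmod_div by (apply Cmod_gt_0; lra).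
    change (RtoC 0) with ((0, 0) : C) in *.
    apply Rle_trans with ((Cmod l + 1) * Cmod h * / (PI * Cmod h / 2)).
    - apply Rmult_le_compat; auto using Cmod_ge_0.
      + apply Rlt_le, Rinv_0_lt_compat; lra.
      + apply Rinv_le_contravar; lra.
    - right. field. split; lra. }
  destruct HB as (r & M & Hr & HM).
  assert (Hrect : forall N, (0 < N)%nat -> rect_int G (- (1 / 2)) (1 / 2) (- INR N) (INR N) = 0).
  { intros N HN. assert (PN := lt_0_INR N HN).
    apply (goursat_rect_except G _ _ _ _ 0 0 M r); auto; try lra. }
  set (R1 := fun t => ((F ((1 / 2)%R, t) - F 0) * RtoC (/ cosh (PI * t)))%C).
  set (L1 := fun t => ((F ((- (1 / 2))%R, t) - F 0) * RtoC (/ cosh (PI * t)))%C).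
  assert (CF : forall x t, - (1 / 2) <= x <= 1 / 2 -> RCcont (fun t => F (x, t)) t).
  { intros x t Hx. apply (RCcont_comp F (fun t => (x, t))); [|apply RCcont_ver].
    now apply Cdiff_cont, HF. }
  assert (CR : forall t, RCcont R1 t).
  { intros t. apply RCcont_mult; [|apply RCcont_inv_cosh].
    apply RCcont_minus; [apply CF; lra|apply RCcont_const]. }
  assert (CL : forall t, RCcont L1 t).
  { intros t. apply RCcont_mult; [|apply RCcont_inv_cosh].
    apply RCcont_minus; [apply CF; lra|apply RCcont_const]. }
  assert (Hc : forall t, cosh (PI * t) <> 0) by (intros t; generalize (cosh_ge_1 (PI * t)); lra).
  assert (EVR : forall N, Ver G (1 / 2) (- INR N) (INR N) = Csym R1 N).
  { intros N. apply CInt_ext; [apply Nneg_le|]. intros t _. unfold G, R1.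
    rewrite Csin_right, RtoC_inv by auto. reflexivity. }
  (* The sign of the sine on the left side cancels the downward orientation, so the two vertical
     sides add up instead of subtracting. *)
  assert (EVL : forall N, Ver G (- (1 / 2)) (- INR N) (INR N) = (- (1) * Csym L1 N)%C).
  { intros N. rewrite <- Csym_mult by auto. apply CInt_ext; [apply Nneg_le|]. intros t _. unfold G, L1.
    rewrite Csin_left, RtoC_opp, RtoC_inv by auto. field.
    intros H. apply RtoC_inj in H. now apply (Hc t). }
  assert (Hzero : is_line_int (fun t => R1 t + L1 t)%C 0).
  { intros eps Heps.
    destruct (Hdecay (eps / 4)) as [N1 HN1]; [lra|].
    (* The decay hypothesis concerns [F] only; the subtracted constant [F 0] is absorbed by sinh (PI
       N) >= N. *)
    destruct (INR_unbounded (4 * (Cmod (F 0) / eps))) as [N2 HN2].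
    exists (S (N1 + N2)). intros N L.
    assert (PN : 1 <= INR N) by (apply (le_INR 1); lia).
    assert (N2N : INR N2 <= INR N) by (apply le_INR; lia).
    assert (PIN : 1 <= PI / 2) by (generalize PI2_1; lra).
    assert (SN : INR N <= sinh (PI * INR N)).
    { apply Rle_trans with (PI * INR N / 2); [nra|]. apply sinh_ge_half. nra. }
    assert (F0 : Cmod (F 0) <= eps / 4 * sinh (PI * INR N)).
    { apply Rle_trans with (eps / 4 * (4 * (Cmod (F 0) / eps))); [right; field; lra|].
      apply Rmult_le_compat_l; lra. }
    assert (HH : forall y, Rabs y = INR N -> Cmod (Hor G (- (1 / 2)) (1 / 2) y) <= eps / 2).
    { intros y Hy.
      replace (eps / 2) with ((1 / 2 - - (1 / 2)) * (eps / 2)) by field.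
      assert (Hy0 : y <> 0) by (intros ->; rewrite Rabs_R0 in Hy; lra).
      assert (Hn : forall x, (x, y) <> (0, 0)) by (intros x E; inversion E; lra).
      apply CInt_le_const; [lra| |].
      - apply Hor_ex; [lra|]. intros x Hx. now apply Cdiff_cont, HG.
      - intros x Hx. unfold G.
        assert (Sy : sinh (PI * INR N) <= Cmod (Csin (RtoC PI * (x, y)))).
        { rewrite <- Hy. unfold Rabs. destruct (Rcase_abs y) as [Ly|Ly].
          - assert (T := Cmod_Csin_ge (RtoC PI * ((- x)%R, (- y)%R))).
            replace (Im (RtoC PI * ((- x)%R, (- y)%R))) with (PI * - y) in T by (simpl; ring).
            replace (RtoC PI * ((- x)%R, (- y)%R))%C with (- (RtoC PI * (x, y)))%C in T
              by (apply injective_projections; simpl; ring).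
            replace (Csin (- (RtoC PI * (x, y))))%C with (- (Csin (RtoC PI * (x, y))))%C in T;
              [now rewrite Cmod_opp in T|].
            unfold Csin. replace (Ci * - (RtoC PI * (x, y)))%C with (- (Ci * (RtoC PI * (x, y))))%C by ring.
            replace (- - (Ci * (RtoC PI * (x, y))))%C with (Ci * (RtoC PI * (x, y)))%C by ring.
            field. apply Ci_neq_0.
          - assert (T := Cmod_Csin_ge (RtoC PI * (x, y))).
            replace (Im (RtoC PI * (x, y))) with (PI * y) in T by (simpl; ring). exact T. }
        rewrite Cmod_div by (apply Cmod_gt_0; lra).
        assert (A : Cmod (F (x, y) - F 0)%C <= eps / 2 * sinh (PI * INR N)).
        { eapply Rle_trans; [apply Cmod_triangle|]. rewrite Cmod_opp.
          specialize (HN1 N x y ltac:(lia) Hx Hy). lra. }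
        apply Rle_trans with (eps / 2 * sinh (PI * INR N) * / sinh (PI * INR N)).
        + apply Rmult_le_compat; auto using Cmod_ge_0.
          * apply Rlt_le, Rinv_0_lt_compat; lra.
          * apply Rinv_le_contravar; lra.
        + right; field; lra. }
    rewrite Csym_plus by auto.
    assert (Z := Hrect N ltac:(lia)). unfold rect_int in Z. rewrite EVR, EVL in Z.
    assert (A := HH (- INR N)). assert (B := HH (INR N)).
    rewrite Rabs_Ropp, Rabs_pos_eq in A by lra. rewrite Rabs_pos_eq in B by lra.
    specialize (A eq_refl). specialize (B eq_refl).
    set (H1 := Hor G (- (1 / 2)) (1 / 2) (- INR N)) in *.
    set (H2 := Hor G (- (1 / 2)) (1 / 2) (INR N)) in *.
    (* The vanishing contour integral, solved for the vertical sides: they equal [Ci] times the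
       difference of the horizontal ones, each at most eps / 2. *)
    replace (Csym R1 N + Csym L1 N - 0)%C with (Ci * (H1 + - H2) - Ci * (H1 + Ci * Csym R1 N - H2 - Ci * (- (1) * Csym L1 N)))%C.
    - rewrite Z, Cmult_0_r. unfold Cminus. rewrite Copp_0, Cplus_0_r.
      rewrite Cmod_mult, Cmod_Ci. assert (T := Cmod_triangle H1 (- H2)). rewrite Cmod_opp in T. lra.
    - generalize (Csym R1 N) (Csym L1 N). clearbody H1 H2. clear. intros u v.
      destruct u, v, H1, H2. apply injective_projections; simpl; ring. }
  (* Both sides had [F 0] subtracted; adding 2 [F 0] times the kernel, of mass 1, restores it. *)
  assert (K := is_line_int_plus _ _ _ _ (fun t => RCcont_plus _ _ t (CR t) (CL t))
     (fun t => RCcont_mult _ _ t (RCcont_const (2 * F 0)%C t) (RCcont_inv_cosh t)) Hzero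
     (is_line_int_mult (2 * F 0)%C _ _ RCcont_inv_cosh is_line_int_inv_cosh)).
  replace (2 * F 0)%C with (0 + 2 * F 0 * 1)%C by ring.
  replace (fun t => ((F ((1 / 2)%R, t) + F ((- (1 / 2))%R, t)) * RtoC (/ cosh (PI * t)))%C)
    with (fun t => (R1 t + L1 t + 2 * F 0 * RtoC (/ cosh (PI * t)))%C); [exact K|].
  apply functional_extensionality; intros t. unfold R1, L1. ring.
Qed.

(** * The cosine series as an integral *)

(** Real powers of 1 + |t| are written [exp (m * ln_1_abs t)], so that comparing them amounts to
    comparing exponents. *)
Definition ln_1_abs (t : R) : R := ln (1 + Rabs t).

Lemma ln_1_abs_ge_0 t : 0 <= ln_1_abs t.
Proof. unfold ln_1_abs. rewrite <- ln_1. apply ln_le; [lra|]. generalize (Rabs_pos t); lra. Qed.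

Lemma continuous_ln_1_abs t : continuous ln_1_abs t.
Proof.
  apply (@continuous_comp R_UniformSpace R_UniformSpace R_UniformSpace (fun t => 1 + Rabs t) ln).
  - apply (@continuous_plus R_UniformSpace R_AbsRing R_NormedModule);
      [apply continuous_const|apply continuous_Rabs].
  - apply continuous_ln. generalize (Rabs_pos t); lra.
Qed.

Lemma exp_ln_1_abs t : exp (ln_1_abs t) = 1 + Rabs t.
Proof. unfold ln_1_abs. apply exp_ln. generalize (Rabs_pos t); lra. Qed.

Lemma RInt_power (sigma : R) (N : nat) : 1 < sigma ->
  is_RInt (fun t => exp (- sigma * ln (1 + t))) 0 (INR N)
    ((1 - exp ((1 - sigma) * ln (1 + INR N))) / (sigma - 1)).
Proof.
  intros Hs. assert (HN := pos_INR N).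
  replace ((1 - exp ((1 - sigma) * ln (1 + INR N))) / (sigma - 1)) with
   (minus (exp ((1 - sigma) * ln (1 + INR N)) / (1 - sigma)) (exp ((1 - sigma) * ln (1 + 0)) / (1 - sigma))).
  - apply (is_RInt_derive (fun t => exp ((1 - sigma) * ln (1 + t)) / (1 - sigma))).
    + intros t. rewrite Rmin_left, Rmax_right by lra. intros Ht. auto_derive; [lra|].
      replace ((1 - sigma) * ln (1 + t)) with (- sigma * ln (1 + t) + ln (1 + t)) by ring.
      rewrite exp_plus, exp_ln by lra. field. lra.
    + intros t. rewrite Rmin_left, Rmax_right by lra. intros Ht.
      apply (@ex_derive_continuous R_AbsRing R_NormedModule). auto_derive. lra.
  - unfold minus, plus, opp; simpl. rewrite Rplus_0_r, ln_1, Rmult_0_r, exp_0. field. lra.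
Qed.

Lemma weight_ln_1_abs sigma : 1 < sigma -> weight (fun t => exp (- sigma * ln_1_abs t)) (2 / (sigma - 1)).
Proof.
  intros Hs.
  assert (HC : forall t, continuous (fun t => exp (- sigma * ln_1_abs t)) t).
  { intros t. apply (@continuous_comp R_UniformSpace R_UniformSpace R_UniformSpace
      (fun t => - sigma * ln_1_abs t) exp).
    - apply (@continuous_scal_r R_UniformSpace R_AbsRing R_NormedModule). apply continuous_ln_1_abs.
    - apply continuous_exp. }
  assert (Hex : forall a b, ex_RInt (fun t => exp (- sigma * ln_1_abs t)) a b).
  { intros. apply (@ex_RInt_continuous R_CompleteNormedModule). auto. }
  split; [auto|split]; [intros; apply Rlt_le, exp_pos|].
  intros N. assert (HN := pos_INR N).
  assert (E1 : RInt (fun t => exp (- sigma * ln_1_abs t)) 0 (INR N)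
     = (1 - exp ((1 - sigma) * ln (1 + INR N))) / (sigma - 1)).
  { apply is_RInt_unique. eapply is_RInt_ext; [|apply RInt_power; auto].
    intros t. rewrite Rmin_left, Rmax_right by lra. intros Ht. unfold ln_1_abs.
    rewrite Rabs_pos_eq by lra. reflexivity. }
  assert (E2 : RInt (fun t => exp (- sigma * ln_1_abs t)) (- INR N) 0
     = (1 - exp ((1 - sigma) * ln (1 + INR N))) / (sigma - 1)).
  { apply is_RInt_unique. set (I := (1 - exp ((1 - sigma) * ln (1 + INR N))) / (sigma - 1)) in *.
    assert (H : is_RInt (fun t => exp (- sigma * ln_1_abs t)) (- - INR N) (- 0) (opp I)).
    { rewrite Ropp_involutive, Ropp_0. apply (@is_RInt_swap R_NormedModule).
      rewrite <- E1. apply (@RInt_correct R_CompleteNormedModule), Hex. }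
    apply (@is_RInt_comp_opp R_NormedModule), (@is_RInt_opp R_NormedModule) in H.
    change (opp (opp I)) with (- - I) in H. rewrite Ropp_involutive in H. eapply is_RInt_ext; [|exact H].
    intros t _. change (- - exp (- sigma * ln_1_abs (- t)) = exp (- sigma * ln_1_abs t)).
    rewrite Ropp_involutive. unfold ln_1_abs. now rewrite Rabs_Ropp. }
  rewrite <- (RInt_Chasles _ (- INR N) 0 (INR N)) by auto. rewrite E1, E2.
  unfold plus; simpl. assert (P := exp_pos ((1 - sigma) * ln (1 + INR N))).
  apply Rle_trans with (2 * ((1 - exp ((1 - sigma) * ln (1 + INR N))) * / (sigma - 1)));
    [right; field; lra|].
  unfold Rdiv. apply Rmult_le_compat_l; [lra|].
  rewrite <- (Rmult_1_l (/ (sigma - 1))) at 2. apply Rmult_le_compat_r; [|lra].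
  apply Rlt_le, Rinv_0_lt_compat; lra.
Qed.

Lemma cosh_abs a : cosh (Rabs a) = cosh a.
Proof.
  unfold Rabs. destruct (Rcase_abs a); auto. unfold cosh. rewrite Ropp_involutive. lra.
Qed.

Lemma cosh_le a b : Rabs a <= Rabs b -> cosh a <= cosh b.
Proof.
  intros H. rewrite <- (cosh_abs a), <- (cosh_abs b).
  generalize (Rabs_pos a). revert H. generalize (Rabs a) (Rabs b). clear. intros a b Hab Ha.
  (* This product is 2 (cosh b - cosh a). *)
  unfold cosh. enough (0 <= (exp b - exp a) * (1 - exp (- a) * exp (- b))).
  { assert (A : exp a * exp (- a) = 1) by (rewrite <- exp_plus, Rplus_opp_r; apply exp_0).
    assert (B : exp b * exp (- b) = 1) by (rewrite <- exp_plus, Rplus_opp_r; apply exp_0).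
    replace ((exp b - exp a) * (1 - exp (- a) * exp (- b))) with
      (exp b - exp a - (exp b * exp (- b)) * exp (- a) + (exp a * exp (- a)) * exp (- b)) in H by ring.
    rewrite A, B in H. lra. }
  apply Rmult_le_pos.
  - assert (X := exp_le a b Hab). lra.
  - rewrite <- exp_plus. assert (X : exp (- a + - b) <= exp 0) by (apply exp_le; lra).
    rewrite exp_0 in X. lra.
Qed.

Lemma exp_abs_le_cosh y : exp (Rabs y) <= 2 * cosh y.
Proof. rewrite <- cosh_abs. unfold cosh. generalize (exp_pos (- Rabs y)); lra. Qed.

Lemma ln_4_le_2 : ln 4 <= 2.
Proof.
  rewrite <- (ln_exp 2). apply ln_le; [lra|].
  assert (A := exp_ineq1_le 1). replace 2 with (1 + 1) by ring. rewrite exp_plus. nra.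
Qed.

(** The power w^(-s), on the principal branch: the minus sign of the Dirichlet series is built in,
    unlike in [nat_Cpower]. *)
Definition Cpower (w s : C) : C := Cexp (- s * Clog w).

(** |w| is at least (1 + |t|) / 4, and 2 bounds ln 4. The bound is uniform in [x], so that one
    weight dominates the integrands on all the lines. *)
Lemma Cmod_ge_ln_1_abs x t : 1 / 2 <= x -> ln_1_abs t - 2 <= ln (Cmod (x, t)).
Proof.
  intros Hx.
  assert (R := Rmax_Cmod (x, t)). simpl in R.
  assert (A := Rle_trans _ _ _ (Rmax_l _ _) R). assert (B := Rle_trans _ _ _ (Rmax_r _ _) R).
  rewrite Rabs_pos_eq in A by lra.
  apply Rle_trans with (ln ((1 + Rabs t) / 4)).
  - rewrite ln_div by (generalize (Rabs_pos t); lra). unfold ln_1_abs. generalize ln_4_le_2; lra.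
  - apply ln_le; generalize (Rabs_pos t); lra.
Qed.

Lemma Cmod_le_ln_1_abs t : ln (Cmod (1 / 2, t)) <= ln_1_abs t.
Proof.
  unfold ln_1_abs. apply ln_le.
  - apply Cmod_gt_0. intros E; inversion E; lra.
  - eapply Rle_trans; [apply Cmod_R_le|]. rewrite (Rabs_pos_eq (1 / 2)); lra.
Qed.

Lemma atan_abs_le_2 x : Rabs (atan x) <= 2.
Proof. apply Rabs_le. generalize (atan_bound x) PI_4. lra. Qed.

(** The modulus of w^(-s) is |w|^(- Re s) exp (Im s arg w), and 2 bounds |arg w|. *)
Lemma Cmod_Cpower w s : Cmod (Cpower w s) <= exp (2 * Rabs (Im s)) * exp (- Re s * ln (Cmod w)).
Proof.
  unfold Cpower. rewrite Cmod_Cexp, <- exp_plus. apply exp_le.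
  destruct s as [a b]. unfold Clog; simpl.
  set (T := atan (Im w / Re w)). assert (HT := atan_abs_le_2 (Im w / Re w)). fold T in HT.
  assert (b * T <= Rabs b * 2).
  { eapply Rle_trans; [apply Rle_abs|]. rewrite Rabs_mult. apply Rmult_le_compat_l; auto. apply Rabs_pos. }
  lra.
Qed.

Lemma Cmod_Cpower_right x t s : 1 / 2 <= x -> 0 <= Re s ->
  Cmod (Cpower (x, t) s) <= exp (2 * Rabs (Im s) + 2 * Re s) * exp (- Re s * ln_1_abs t).
Proof.
  intros Hx Hs. eapply Rle_trans; [apply Cmod_Cpower|].
  rewrite <- !exp_plus. apply exp_le.
  assert (H := Cmod_ge_ln_1_abs x t Hx). nra.
Qed.

(** For Re s < 0 an upper bound for |w| is required as well, which holds on a fixed line only; this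
    case arises from the arguments s - 2k. *)
Lemma Cmod_Cpower_half t s :
  Cmod (Cpower (1 / 2, t) s) <= exp (2 * Rabs (Im s) + 2 * Rabs (Re s)) * exp (- Re s * ln_1_abs t).
Proof.
  eapply Rle_trans; [apply Cmod_Cpower|].
  rewrite <- !exp_plus. apply exp_le.
  assert (H := Cmod_ge_ln_1_abs (1 / 2) t (Rle_refl _)). assert (H' := Cmod_le_ln_1_abs t).
  unfold Rabs at 3. destruct (Rcase_abs (Re s)); nra.
Qed.

Lemma Cdiff_Cpower s w : 0 < Re w -> Cdiff (fun w => Cpower w s) w.
Proof.
  intros H. apply Cdiff_Cexp_comp, Cdiff_mult; [apply Cdiff_const|now apply Cdiff_Clog].
Qed.

Lemma Cpower_nat n s : Cpower (RtoC (INR (S n))) s = (/ nat_Cpower (S n) s)%C.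
Proof.
  unfold Cpower, nat_Cpower. rewrite Clog_R by (apply lt_0_INR; lia).
  rewrite <- Cexp_opp_inv. f_equal. ring.
Qed.

Lemma Cpower_minus_nat w s n : 0 < Re w -> Cpower w (s - RtoC (INR n)) = (Cpower w s * w ^ n)%C.
Proof.
  intros H. rewrite <- (Cexp_Clog w H) at 3. rewrite Cexp_pow. unfold Cpower.
  rewrite <- Cexp_plus. f_equal. ring.
Qed.

(* [w] is the summation index [n], made complex. *)
Definition summand (s : C) (th : R) (w : C) : C := (Cpower w s * Ccos (RtoC th * w))%C.

Lemma Cdiff_summand s th w : 0 < Re w -> Cdiff (summand s th) w.
Proof.
  intros H. apply Cdiff_mult; [now apply Cdiff_Cpower|].
  apply (Cdiff_comp Ccos (fun w => RtoC th * w)%C); [apply Cdiff_Ccos|].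
  apply Cdiff_mult; [apply Cdiff_const|apply Cdiff_id].
Qed.

Lemma Cmod_Ccos_cosh th x t : Rabs th <= PI -> Cmod (Ccos (RtoC th * (x, t))) <= cosh (PI * t).
Proof.
  intros H. eapply Rle_trans; [apply Cmod_Ccos_le|].
  replace (Im (RtoC th * (x, t))) with (th * t) by (simpl; ring).
  apply cosh_le. rewrite !Rabs_mult. apply Rmult_le_compat_r; [apply Rabs_pos|].
  rewrite (Rabs_pos_eq PI); auto. apply Rlt_le, PI_RGT_0.
Qed.

(** * Integrals over the lines Re w = n + 1/2 *)

Definition line_summand (s : C) (th : R) (n : nat) (t : R) : C :=
  (summand s th ((INR n + 1 / 2)%R, t) * RtoC (/ cosh (PI * t)))%C.

Lemma inv_cosh_pos t : 0 < / cosh (PI * t).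
Proof. apply Rinv_0_lt_compat. generalize (cosh_ge_1 (PI * t)); lra. Qed.

Lemma line_summand_cont s th n t : RCcont (line_summand s th n) t.
Proof.
  apply RCcont_mult; [|apply RCcont_inv_cosh].
  apply (RCcont_comp (summand s th) (fun t => ((INR n + 1 / 2)%R, t))); [|apply RCcont_ver].
  apply Cdiff_cont, Cdiff_summand. simpl. generalize (pos_INR n); lra.
Qed.

Lemma line_summand_le s th n t : Rabs th <= PI ->
  Cmod (line_summand s th n t) <= Cmod (Cpower ((INR n + 1 / 2)%R, t) s).
Proof.
  intros H. unfold line_summand, summand. rewrite !Cmod_mult, Cmod_R.
  assert (P := inv_cosh_pos t). rewrite (Rabs_pos_eq (/ _)) by lra.
  rewrite Rmult_assoc. rewrite <- (Rmult_1_r (Cmod (Cpower _ _))) at 2.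
  apply Rmult_le_compat_l; [apply Cmod_ge_0|].
  assert (C1 := cosh_ge_1 (PI * t)).
  rewrite <- (Rinv_r (cosh (PI * t))) by lra.
  apply Rmult_le_compat_r; [lra|]. now apply Cmod_Ccos_cosh.
Qed.

Lemma line_summand_dominated s th n t : Rabs th <= PI -> 0 <= Re s ->
  Cmod (line_summand s th n t) <= exp (2 * Rabs (Im s) + 2 * Re s) * exp (- Re s * ln_1_abs t).
Proof.
  intros H Hs. eapply Rle_trans; [now apply line_summand_le|].
  apply Cmod_Cpower_right; auto. generalize (pos_INR n); lra.
Qed.

Lemma line_summand_weight s : 1 < Re s ->
  weight (fun t => exp (2 * Rabs (Im s) + 2 * Re s) * exp (- Re s * ln_1_abs t))
    (exp (2 * Rabs (Im s) + 2 * Re s) * (2 / (Re s - 1))).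
Proof. intros H. apply weight_scal; [apply Rlt_le, exp_pos|]. now apply weight_ln_1_abs. Qed.

Definition shifted_int (s : C) (th : R) (n : nat) : C := line_int (line_summand s th n).

Lemma shifted_int_correct s th n : 1 < Re s -> Rabs th <= PI -> is_line_int (line_summand s th n) (shifted_int s th n).
Proof.
  intros Hs Hth. eapply line_int_correct; [apply (line_summand_weight s Hs)| |].
  - apply line_summand_cont.
  - intros t. apply line_summand_dominated; auto; lra.
Qed.

(** Poisson's formula in the strip centred at [S n], whose two edges are the lines of index [n] and
    [S n]. The same positive kernel 1 / cosh stands on both edges, whence a sum of integrals rather
    than a difference. *)
Lemma shifted_int_step s th n : 1 < Re s -> Rabs th <= PI ->
  (shifted_int s th (S n) + shifted_int s th n)%C = (2 * summand s th (RtoC (INR (S n))))%C.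
Proof.
  intros Hs Hth. set (p := RtoC (INR (S n))).
  assert (HPI := PI_RGT_0).
  assert (Hp : 1 <= INR (S n)) by (apply (le_INR 1); lia).
  assert (M := strip_mean (fun v => summand s th (p + v)%C)).
  assert (Ep : forall x y, (p + (x, y))%C = ((INR (S n) + x)%R, y))
    by (unfold p; generalize (INR (S n)); intros; apply injective_projections; simpl; ring).
  apply (is_line_int_unique (fun t => line_summand s th (S n) t + line_summand s th n t)%C).
  - apply is_line_int_plus; auto using line_summand_cont, shifted_int_correct.
  - replace (summand s th p) with (summand s th (p + 0)%C) by (f_equal; ring).
    replace (fun t => line_summand s th (S n) t + line_summand s th n t)%C with
      (fun t => ((summand s th (p + ((1 / 2)%R, t)) + summand s th (p + ((- (1 / 2))%R, t))) *
         RtoC (/ cosh (PI * t)))%C).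
    2:{ apply functional_extensionality; intros t. unfold line_summand. rewrite !Ep.
        replace (INR (S n) + - (1 / 2)) with (INR n + 1 / 2) by (rewrite S_INR; field). ring. }
    apply M.
    + intros x y Hx. apply (Cdiff_comp (summand s th) (fun v => p + v)%C).
      * apply Cdiff_summand. rewrite Ep. change (0 < INR (S n) + x). lra.
      * apply Cdiff_plus; [apply Cdiff_const|apply Cdiff_id].
    + intros eps Heps.
      set (K := exp (2 * Rabs (Im s) + 2 * Re s)). assert (HK : 0 < K) by apply exp_pos.
      destruct (INR_unbounded (2 * K / eps)) as [N0 HN0].
      exists (S N0). intros N x y L Hx Hy.
      assert (PN : 1 <= INR N) by (apply (le_INR 1); lia).
      assert (LN : INR N0 <= INR N) by (apply le_INR; lia).
      assert (PIN : 2 <= PI) by (generalize PI2_1; lra).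
      assert (SN : 1 <= sinh (PI * INR N)).
      { apply Rle_trans with (PI * INR N / 2); [nra|]. apply sinh_ge_half. nra. }
      assert (CS : cosh (PI * INR N) <= 2 * sinh (PI * INR N)).
      { assert (X : exp (- (PI * INR N)) <= 1) by (rewrite <- exp_0; apply exp_le; nra).
        unfold cosh, sinh in *. lra. }
      rewrite Ep. unfold summand. rewrite Cmod_mult.
      (* For |th| = PI the cosine on the horizontal sides is as large as the sine, so the decay
         demanded by Poisson's formula is that of w^(-s). *)
      assert (B1 : Cmod (Cpower ((INR (S n) + x)%R, y) s) <= K * (/ INR N)).
      { eapply Rle_trans; [apply Cmod_Cpower_right; lra|].
        apply Rmult_le_compat_l; [lra|].
        assert (E0 := ln_1_abs_ge_0 y).
        apply Rle_trans with (exp (- ln_1_abs y)); [apply exp_le; nra|].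
        rewrite exp_Ropp, exp_ln_1_abs, Hy. apply Rinv_le_contravar; lra. }
      assert (B2 : Cmod (Ccos (RtoC th * ((INR (S n) + x)%R, y))) <= 2 * sinh (PI * INR N)).
      { eapply Rle_trans; [now apply Cmod_Ccos_cosh|]. eapply Rle_trans; [|exact CS].
        apply cosh_le. rewrite !Rabs_mult, Hy, (Rabs_pos_eq (INR N)); lra. }
      apply Rle_trans with (K * / INR N * (2 * sinh (PI * INR N))).
      * apply Rmult_le_compat; auto using Cmod_ge_0.
      * replace (K * / INR N * (2 * sinh (PI * INR N))) with ((2 * K * / INR N) * sinh (PI * INR N)) by ring.
        apply Rmult_le_compat_r; [lra|].
        apply Rmult_le_reg_r with (INR N); [lra|]. rewrite Rmult_assoc, Rinv_l by lra.
        apply Rle_trans with (eps * (2 * K / eps)); [right; field; lra|].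
        apply Rmult_le_compat_l; lra.
Qed.

(** On the n-th line |w| >= n, so the integrand is at most a constant over n, uniformly in t, while
    one weight dominates all of them. *)
Lemma shifted_int_lim s th : 1 < Re s -> Rabs th <= PI -> Clim (shifted_int s th) 0.
Proof.
  intros Hs Hth.
  assert (Z : line_int (fun _ => RtoC 0) = 0).
  { apply line_int_eq. eapply Clim_ext; [|apply Clim_const]. intros N; simpl.
    unfold Csym. rewrite CInt_const. ring. }
  rewrite <- Z.
  apply (line_int_dominated _ _ (fun n => line_summand s th n) (fun _ => RtoC 0) (line_summand_weight s Hs)).
  - intros; apply line_summand_cont.
  - intros; apply RCcont_const.
  - intros; apply line_summand_dominated; auto; lra.
  - intros. rewrite Cmod_0. apply Rmult_le_pos; apply Rlt_le, exp_pos.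
  - intros T eps Heps.
    set (K := exp (2 * Rabs (Im s))). assert (HK : 0 < K) by apply exp_pos.
    destruct (INR_unbounded (K / eps)) as [N0 HN0].
    exists (S N0). intros n t L _.
    assert (PN : 1 <= INR n) by (apply (le_INR 1); lia).
    assert (LN : INR N0 <= INR n) by (apply le_INR; lia).
    replace (line_summand s th n t - 0)%C with (line_summand s th n t) by ring.
    eapply Rle_trans; [now apply line_summand_le|].
    eapply Rle_trans; [apply Cmod_Cpower|]. fold K.
    set (w := ((INR n + 1 / 2)%R, t)).
    assert (Hw : INR n <= Cmod w).
    { eapply Rle_trans; [|apply (re_le_Cmod w)]. unfold w; simpl. rewrite Rabs_pos_eq; lra. }
    assert (Hl : 0 <= ln (INR n)) by (rewrite <- ln_1; apply ln_le; lra).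
    assert (Hl' : ln (INR n) <= ln (Cmod w)) by (apply ln_le; lra).
    apply Rle_trans with (K * / INR n).
    + apply Rmult_le_compat_l; [lra|].
      rewrite <- (exp_ln (INR n)) by lra. rewrite <- exp_Ropp. apply exp_le. nra.
    + apply Rmult_le_reg_r with (INR n); [lra|]. rewrite Rmult_assoc, Rinv_l by lra.
      apply Rle_trans with (eps * (K / eps)); [right; field; lra|].
      apply Rmult_le_compat_l; lra.
Qed.

(** * Partial sums of the alternating cosine series *)

Definition csum (u : nat -> C) (n : nat) : C := @sum_n C_AbelianMonoid u n.

Lemma csum_S u n : csum u (S n) = (csum u n + u (S n))%C.
Proof. apply (@sum_Sn C_AbelianMonoid). Qed.
Lemma csum_O u : csum u 0 = u 0%nat.
Proof. apply (@sum_O C_AbelianMonoid). Qed.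

Lemma is_series_Clim (u : nat -> C) l : Clim (csum u) l -> @is_series C_AbsRing C_NormedModule u l.
Proof.
  intros H. apply (proj2 (@filterlim_locally nat C_UniformSpace eventually _ (csum u) l)).
  intros eps. assert (He : 0 < eps / 2) by (generalize (cond_pos eps); lra).
  destruct (H _ He) as [N HN]. exists N. intros n L. apply Cmod_lt_ball.
  eapply Rle_lt_trans; [now apply HN|]. generalize (cond_pos eps); lra.
Qed.

(** Each term is half the sum of two consecutive line integrals, so the alternating partial sums
    telescope to half the integral of index 0 plus or minus half that of index [S n], which tends to
    0. *)
Lemma alternating_cos_series s th : 1 < Re s -> Rabs th <= PI ->
  Clim (csum (fun m => RtoC ((-1) ^ m) * summand s th (RtoC (INR (S m))))%C) (shifted_int s th 0 / 2)%C.
Proof.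
  intros Hs Hth.
  assert (E : forall n, csum (fun m => RtoC ((-1) ^ m) * summand s th (RtoC (INR (S m))))%C n
     = (/ 2 * (shifted_int s th 0 + RtoC ((-1) ^ n) * shifted_int s th (S n)))%C).
  { assert (T : forall n, summand s th (RtoC (INR (S n))) = (/ 2 * (shifted_int s th (S n) + shifted_int s th n))%C).
    { intros n. rewrite shifted_int_step by auto. field. }
    induction n.
    - rewrite csum_O, T. simpl. ring.
    - rewrite csum_S, IHn, T. simpl ((-1) ^ S n). rewrite RtoC_mult. ring. }
  assert (H : Clim (fun n => shifted_int s th 0 + RtoC ((-1) ^ n) * shifted_int s th (S n))%C (shifted_int s th 0)).
  { intros eps Heps. destruct (shifted_int_lim s th Hs Hth eps Heps) as [N HN].
    exists N. intros n L. specialize (HN (S n) ltac:(lia)).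
    replace (shifted_int s th 0 + RtoC ((-1) ^ n) * shifted_int s th (S n) - shifted_int s th 0)%C
      with (RtoC ((-1) ^ n) * (shifted_int s th (S n) - 0))%C by ring.
    rewrite Cmod_mult, Cmod_R, pow_1_abs, Rmult_1_l. exact HN. }
  apply (Clim_mult_const (/ 2)%C) in H. unfold Cdiv. rewrite (Cmult_comm (shifted_int s th 0)).
  eapply Clim_ext; [|exact H]. intros n. now rewrite E.
Qed.

(** * Lindelöf's integral and the Taylor expansion *)

(** The exponential growth of cosh beats every power of 1 + |t|; the exponent -2 on the right is
    just an integrable one. This makes the integral for th = 0 converge for all s. *)
Lemma exp_ln_1_abs_cosh (m : R) : exists K, 0 < K /\
  forall t, exp (m * ln_1_abs t) * / cosh (PI * t) <= K * exp (- (2) * ln_1_abs t).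
Proof.
  set (p := Rmax (m + 2) 1).
  assert (Hp : 1 <= p) by apply Rmax_r. assert (Hm : m + 2 <= p) by apply Rmax_l.
  exists (2 * exp (1 + p * ln p)). split.
  { generalize (exp_pos (1 + p * ln p)); lra. }
  intros t. assert (C1 := cosh_ge_1 (PI * t)). assert (Ht := Rabs_pos t). assert (E0 := ln_1_abs_ge_0 t).
  apply Rmult_le_reg_r with (cosh (PI * t)); [lra|].
  rewrite Rmult_assoc, Rinv_l, Rmult_1_r by lra.
  (* The tangent of the logarithm at p, with u = 1 + |t|: p ln u <= p ln p + u - p. *)
  assert (L : p * ln_1_abs t <= 1 + p * ln p + Rabs t).
  { assert (X : ln_1_abs t - ln p <= (1 + Rabs t) / p - 1).
    { unfold ln_1_abs. rewrite <- ln_div by lra.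
      assert (P : 0 < (1 + Rabs t) / p) by (apply Rdiv_lt_0_compat; lra).
      assert (Y := exp_ineq1_le (ln ((1 + Rabs t) / p))). rewrite exp_ln in Y; lra. }
    apply (Rmult_le_compat_l p) in X; [|lra].
    replace (p * ((1 + Rabs t) / p - 1)) with (1 + Rabs t - p) in X by (field; lra). lra. }
  assert (Q : exp ((m + 2) * ln_1_abs t) <= exp (1 + p * ln p) * (2 * cosh (PI * t))).
  { apply Rle_trans with (exp (1 + p * ln p + Rabs t)); [apply exp_le; nra|].
    rewrite exp_plus. apply Rmult_le_compat_l; [apply Rlt_le, exp_pos|].
    eapply Rle_trans; [apply exp_abs_le_cosh|]. apply Rmult_le_compat_l; [lra|].
    apply cosh_le. rewrite Rabs_mult, (Rabs_pos_eq PI) by (generalize PI_RGT_0; lra).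
    generalize PI2_1; nra. }
  replace (exp (m * ln_1_abs t)) with (exp ((m + 2) * ln_1_abs t) * exp (- (2) * ln_1_abs t))
    by (rewrite <- exp_plus; f_equal; ring).
  replace (2 * exp (1 + p * ln p) * exp (- (2) * ln_1_abs t) * cosh (PI * t)) with
    (exp (1 + p * ln p) * (2 * cosh (PI * t)) * exp (- (2) * ln_1_abs t)) by ring.
  apply Rmult_le_compat_r; [apply Rlt_le, exp_pos|auto].
Qed.

Lemma weight_exp_ln_1_abs m k : 0 <= k -> exists D M, weight D M /\
  forall t, k * (exp (m * ln_1_abs t) * / cosh (PI * t)) <= D t.
Proof.
  intros Hk. destruct (exp_ln_1_abs_cosh m) as [K [HK H]].
  exists (fun t => (k * K) * exp (- (2) * ln_1_abs t)), ((k * K) * (2 / (2 - 1))). split.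
  - apply weight_scal; [nra|]. apply weight_ln_1_abs; lra.
  - intros t. rewrite Rmult_assoc. apply Rmult_le_compat_l; auto.
Qed.

Definition kernel (s : C) (t : R) : C := (Cpower ((1 / 2)%R, t) s * RtoC (/ cosh (PI * t)))%C.

(** Without the factor 1/2 of Lindelöf's formula, so its value is twice the alternating zeta
    function. *)
Definition lindelof (s : C) : C := line_int (kernel s).

Lemma half_line_cont (F : C -> C) t : (forall w, 0 < Re w -> Cdiff F w) ->
  RCcont (fun t => F ((1 / 2)%R, t)) t.
Proof.
  intros H. apply (RCcont_comp F (fun t => ((1 / 2)%R, t))); [|apply RCcont_ver].
  apply Cdiff_cont, H. simpl; lra.
Qed.

Lemma kernel_cont s t : RCcont (kernel s) t.
Proof.
  apply RCcont_mult; [|apply RCcont_inv_cosh].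
  apply (half_line_cont (fun w => Cpower w s)). intros; now apply Cdiff_Cpower.
Qed.

Definition kernel_bound (s : C) : R := exp (2 * Rabs (Im s) + 2 * Rabs (Re s)).

Lemma Cmod_kernel s t : Cmod (kernel s t) <= kernel_bound s * (exp (- Re s * ln_1_abs t) * / cosh (PI * t)).
Proof.
  unfold kernel. rewrite Cmod_mult, Cmod_R, Rabs_pos_eq by (apply Rlt_le, inv_cosh_pos).
  rewrite <- Rmult_assoc. apply Rmult_le_compat_r; [apply Rlt_le, inv_cosh_pos|].
  apply Cmod_Cpower_half.
Qed.

Lemma lindelof_correct s : is_line_int (kernel s) (lindelof s).
Proof.
  destruct (weight_exp_ln_1_abs (- Re s) (kernel_bound s)) as (D & M & HD & HB); [apply Rlt_le, exp_pos|].
  apply (line_int_correct D M); auto using kernel_cont.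
  intros t. eapply Rle_trans; [apply Cmod_kernel|apply HB].
Qed.

Lemma Cmod_Clog_half t : Cmod (Clog ((1 / 2)%R, t)) <= ln_1_abs t + 4.
Proof.
  unfold Clog. eapply Rle_trans; [apply Cmod_R_le|].
  assert (H1 := Cmod_ge_ln_1_abs (1 / 2) t (Rle_refl _)). assert (H2 := Cmod_le_ln_1_abs t).
  assert (H3 := atan_abs_le_2 (Im ((1 / 2)%R, t) / Re ((1 / 2)%R, t))). assert (H0 := ln_1_abs_ge_0 t).
  assert (Rabs (ln (Cmod ((1 / 2)%R, t))) <= ln_1_abs t + 2) by (apply Rabs_le; lra). lra.
Qed.

Lemma square_le_exp x : 0 <= x -> x ^ 2 <= exp (2 * x).
Proof.
  intros H. replace (2 * x) with (x + x) by ring. rewrite exp_plus.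
  assert (A := exp_ineq1_le x). nra.
Qed.

(** Differentiation under the integral sign: w^(-s) has s-derivative - log w times w^(-s), and the
    remainder is at most |h|^2 [D t] pointwise for |h| < 1, with [D] of bounded integral. *)
Lemma Cdiff_lindelof s : Cdiff lindelof s.
Proof.
  set (L := fun t => Clog ((1 / 2)%R, t)).
  assert (HL : forall t, Cmod (L t) <= ln_1_abs t + 4) by apply Cmod_Clog_half.
  assert (CL : forall t, RCcont L t).
  { intros t. apply (half_line_cont Clog). apply Cdiff_Clog. }
  set (dk := fun t => (- L t * kernel s t)%C).
  assert (Cdk : forall t, RCcont dk t).
  { intros t. apply RCcont_mult; [|apply kernel_cont].
    replace (fun u => - L u)%C with (fun u => RtoC 0 - L u)%C
      by (apply functional_extensionality; intros; ring).
    apply RCcont_minus; [apply RCcont_const|auto]. }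
  (* For |h| < 1 the quantity exp (4 |L|) covers exp (2 |h L|) |L|^2. Since |L| <= ln_1_abs + 4, it
     is at most exp 16 times the fourth power of 1 + |t|, hence the exponent 4 - Re s below. The
     factor 2 is that of [Cexp_quadratic]. *)
  set (K := 2 * exp 16 * kernel_bound s).
  assert (K1 := exp_pos 16). assert (K2 : 0 < kernel_bound s) by apply exp_pos.
  assert (HK : 0 <= K) by (unfold K; apply Rlt_le; repeat apply Rmult_lt_0_compat; lra).
  destruct (weight_exp_ln_1_abs (4 - Re s) K HK) as (D & M & HD & HB).
  assert (Hexp : forall t, exp (4 * Cmod (L t)) * Cmod (kernel s t) <= D t / 2).
  { intros t. specialize (HB t). specialize (HL t).
    apply Rle_trans with (exp (16 + 4 * ln_1_abs t) * (kernel_bound s * (exp (- Re s * ln_1_abs t) * / cosh (PI * t)))).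
    - apply Rmult_le_compat; [apply Rlt_le, exp_pos|apply Cmod_ge_0|apply exp_le; lra|apply Cmod_kernel].
    - apply Rmult_le_reg_l with 2; [lra|]. replace (2 * (D t / 2)) with (D t) by field.
      eapply Rle_trans; [|exact HB]. right. unfold K.
      replace ((4 - Re s) * ln_1_abs t) with (4 * ln_1_abs t + - Re s * ln_1_abs t) by ring.
      rewrite !exp_plus. ring. }
  assert (Hdk : is_line_int dk (line_int dk)).
  { apply (line_int_correct D M); auto. intros t. unfold dk. rewrite Cmod_mult, Cmod_opp.
    assert (N0 := Cmod_ge_0 (L t)). assert (N1 := Cmod_ge_0 (kernel s t)).
    assert (D0 : 0 <= D t) by apply HD.
    apply Rle_trans with (exp (4 * Cmod (L t)) * Cmod (kernel s t)).
    - apply Rmult_le_compat_r; auto. generalize (exp_ineq1_le (4 * Cmod (L t))). lra.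
    - specialize (Hexp t). lra. }
  exists (line_int dk). intros eps Heps.
  assert (HM : 0 <= M) by (eapply Rle_trans; [|apply (proj2 (proj2 HD) 0%nat)];
     apply RInt_ge_0; [simpl; lra|eapply weight_ex, HD|intros; apply HD]).
  exists (Rmin 1 (eps / (M + 1))). split.
  { apply Rmin_glb_lt; [lra|]. apply Rdiv_lt_0_compat; lra. }
  intros h Hh. assert (H1 := Rlt_le_trans _ _ _ Hh (Rmin_l _ _)).
  assert (H2 := Rlt_le_trans _ _ _ Hh (Rmin_r _ _)). assert (H0 := Cmod_ge_0 h).
  assert (HI : is_line_int (fun t => kernel (s + h) t - kernel s t - h * dk t)%C
     (lindelof (s + h) - lindelof s - h * line_int dk)%C).
  { apply is_line_int_minus.
    - intros; apply RCcont_minus; apply kernel_cont.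
    - intros; apply RCcont_mult; [apply RCcont_const|auto].
    - apply is_line_int_minus; auto using kernel_cont, lindelof_correct.
    - now apply is_line_int_mult. }
  rewrite (Cmult_comm (line_int dk)).
  apply Rle_trans with ((Cmod h) ^ 2 * M).
  - apply (is_line_int_bound (fun t => (Cmod h) ^ 2 * D t) _ _ _ (weight_scal D M _ (pow2_ge_0 _) HD)) in HI; auto.
    + intros t. apply RCcont_minus; [apply RCcont_minus; apply kernel_cont|].
      apply RCcont_mult; [apply RCcont_const|auto].
    + intros t.
      assert (Ek : kernel (s + h) t = (kernel s t * Cexp (- h * L t))%C).
      { unfold kernel, Cpower. fold (L t).
        replace (- (s + h) * L t)%C with (- s * L t + - h * L t)%C by ring. rewrite Cexp_plus. ring. }
      unfold dk. rewrite Ek.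
      replace (kernel s t * Cexp (- h * L t) - kernel s t - h * (- L t * kernel s t))%C
        with (kernel s t * (Cexp (- h * L t) - 1 - - h * L t))%C by ring.
      rewrite Cmod_mult.
      assert (N0 := Cmod_ge_0 (L t)). assert (N1 := Cmod_ge_0 (kernel s t)).
      assert (Q : Cmod (Cexp (- h * L t) - 1 - - h * L t)%C <= Cmod h ^ 2 * (2 * exp (4 * Cmod (L t)))).
      { eapply Rle_trans; [apply Cexp_quadratic|]. rewrite Cmod_mult, Cmod_opp.
        apply Rle_trans with (2 * exp (2 * Cmod (L t)) * (Cmod h * Cmod (L t)) ^ 2).
        - apply Rmult_le_compat_r; [apply pow2_ge_0|]. apply Rmult_le_compat_l; [lra|].
          apply exp_le. nra.
        - replace (4 * Cmod (L t)) with (2 * Cmod (L t) + 2 * Cmod (L t)) by ring. rewrite exp_plus.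
          replace (2 * exp (2 * Cmod (L t)) * (Cmod h * Cmod (L t)) ^ 2) with
           (Cmod h ^ 2 * (2 * (exp (2 * Cmod (L t)) * Cmod (L t) ^ 2))) by ring.
          apply Rmult_le_compat_l; [apply pow2_ge_0|]. apply Rmult_le_compat_l; [lra|].
          apply Rmult_le_compat_l; [apply Rlt_le, exp_pos|now apply square_le_exp]. }
      apply Rle_trans with (Cmod (kernel s t) * (Cmod h ^ 2 * (2 * exp (4 * Cmod (L t))))).
      * now apply Rmult_le_compat_l.
      * replace (Cmod (kernel s t) * (Cmod h ^ 2 * (2 * exp (4 * Cmod (L t))))) with
         (Cmod h ^ 2 * (2 * (exp (4 * Cmod (L t)) * Cmod (kernel s t)))) by ring.
        apply Rmult_le_compat_l; [apply pow2_ge_0|]. specialize (Hexp t). lra.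
  - simpl. rewrite Rmult_1_r. rewrite Rmult_assoc, (Rmult_comm eps).
    apply Rmult_le_compat_l; auto.
    apply Rle_trans with (eps / (M + 1) * (M + 1)); [|right; field; lra].
    apply Rmult_le_compat; lra.
Qed.

Lemma shifted_int_0_0 s : shifted_int s 0 0 = lindelof s.
Proof.
  unfold shifted_int, lindelof. f_equal. apply functional_extensionality; intros t.
  unfold line_summand, summand, kernel. simpl INR. rewrite Rplus_0_l, Cmult_0_l, Ccos_R, cos_0. ring.
Qed.

Lemma is_series_C_unique (u : nat -> C) l m :
  @is_series C_AbsRing C_NormedModule u l -> @is_series C_AbsRing C_NormedModule u m -> l = m.
Proof.
  intros H1 H2.
  apply (@filterlim_locally_unique nat C_AbsRing C_NormedModule eventually _ (@sum_n C_NormedModule u) l m H1 H2).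
Qed.

Lemma alternating_zeta_eq eta : is_alternating_zeta eta -> forall s, eta s = (lindelof s / 2)%C.
Proof.
  intros [Hent Hser].
  assert (H1 : forall s, 1 < Re s -> (eta s - lindelof s / 2)%C = 0).
  { intros s Hs. apply (proj1 (Ceq_minus (eta s) (lindelof s / 2)%C)).
    apply (is_series_C_unique _ _ _ (Hser s ltac:(lra))).
    rewrite <- shifted_int_0_0. apply is_series_Clim.
    eapply Clim_ext; [|apply (alternating_cos_series s 0 Hs)].
    - intros n. unfold csum. apply (@sum_n_ext C_AbelianMonoid). intros m.
      unfold summand. rewrite Cpower_nat, Cmult_0_l, Ccos_R, cos_0.
      match goal with |- ?a = ?b => change (@eq C a b) end. unfold Cdiv. ring.
    - rewrite Rabs_R0. apply Rlt_le, PI_RGT_0. }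
  intros s. apply Ceq_minus.
  (* The unit disc around 3 lies in the half-plane Re s > 1, where both functions are sums of the
     same series. *)
  apply (unique_continuation (fun s => eta s - lindelof s / 2)%C (RtoC 3) 1).
  - lra.
  - intros z. apply Cdiff_minus; [apply Cdiff_ex_derive, Hent|].
    apply Cdiff_mult; [apply Cdiff_lindelof|apply Cdiff_const].
  - intros h Hh. apply H1. rewrite re_plus, re_RtoC.
    assert (T := re_le_Cmod h). apply Rabs_le_between in T. lra.
Qed.

(** * Taylor polynomials of the cosine and the exchange of sum and integral *)

Fixpoint cos_taylor (n : nat) (z : C) : C :=
  match n with
  | O => RtoC 1
  | S m => (cos_taylor m z + RtoC ((-1) ^ S m / INR (fact (2 * S m))) * z ^ (2 * S m))%C
  end.

Lemma Ci_sqr : (Ci * Ci)%C = RtoC (-1).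
Proof. apply injective_projections; simpl; ring. Qed.

Lemma Ci_pow_even z n : ((Ci * z) ^ (2 * n))%C = (RtoC ((-1) ^ n) * z ^ (2 * n))%C.
Proof.
  rewrite Cpow_mult_l, (Cpow_mult_r Ci). f_equal. rewrite RtoC_pow, <- Ci_sqr. f_equal.
  simpl. ring.
Qed.

Lemma Copp_pow_even z n : ((- z) ^ (2 * n))%C = (z ^ (2 * n))%C.
Proof. rewrite !Cpow_mult_r. f_equal. simpl. ring. Qed.

(** The odd terms cancel between the arguments iz and -iz, so the error estimate for the exponential
    carries over to the cosine. *)
Lemma cos_taylor_exp n z :
  cos_taylor n z = ((exp_taylor (2 * n) (Ci * z) + exp_taylor (2 * n) (- (Ci * z))) / 2)%C.
Proof.
  induction n.
  - simpl. field.
  - replace (2 * S n)%nat with (S (S (2 * n))) by lia.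
    change (exp_taylor (S (S (2 * n)))) with (fun z => (exp_taylor (2 * n) z + RtoC (/ INR (fact (S (2 * n)))) * z ^ S (2 * n)
       + RtoC (/ INR (fact (S (S (2 * n))))) * z ^ S (S (2 * n)))%C). cbv beta.
    change (cos_taylor (S n) z) with
      (cos_taylor n z + RtoC ((-1) ^ S n / INR (fact (2 * S n))) * z ^ (2 * S n))%C.
    rewrite IHn.
    assert (E1 : ((- (Ci * z)) ^ S (2 * n))%C = (- ((Ci * z) ^ S (2 * n)))%C).
    { rewrite !Cpow_S, Copp_pow_even. ring. }
    rewrite E1.
    replace (S (S (2 * n))) with (2 * S n)%nat by lia.
    rewrite Copp_pow_even, Ci_pow_even. unfold Rdiv. rewrite RtoC_mult. field.
Qed.

(** Independent of [n], as dominated convergence requires: the moduli of the terms are among those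
    of the series of exp |z|. *)
Lemma Cmod_cos_taylor_le n z : Cmod (cos_taylor n z) <= exp (Cmod z).
Proof.
  apply Rle_trans with (sum_f_R0 (fun k => Cmod z ^ k / INR (fact k)) (2 * n));
    [|apply exp_ge_taylor, Cmod_ge_0].
  assert (P : forall k, 0 <= Cmod z ^ k / INR (fact k)).
  { intros k. apply Rmult_le_pos; [apply pow_le, Cmod_ge_0|].
    apply Rlt_le, Rinv_0_lt_compat, lt_0_INR, lt_O_fact. }
  induction n.
  - simpl. rewrite Cmod_1. lra.
  - change (cos_taylor (S n) z) with
      (cos_taylor n z + RtoC ((-1) ^ S n / INR (fact (2 * S n))) * z ^ (2 * S n))%C.
    eapply Rle_trans; [apply Cmod_triangle|].
    replace (sum_f_R0 (fun k => Cmod z ^ k / INR (fact k)) (2 * S n)) with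
      (sum_f_R0 (fun k => Cmod z ^ k / INR (fact k)) (2 * n)
       + Cmod z ^ S (2 * n) / INR (fact (S (2 * n))) + Cmod z ^ (2 * S n) / INR (fact (2 * S n))).
    2:{ replace (2 * S n)%nat with (S (S (2 * n))) by lia. reflexivity. }
    specialize (P (S (2 * n))).
    assert (Q : Cmod (RtoC ((-1) ^ S n / INR (fact (2 * S n))) * z ^ (2 * S n))
      = Cmod z ^ (2 * S n) / INR (fact (2 * S n))).
    { rewrite Cmod_mult, Cmod_pow, Cmod_R. unfold Rdiv. rewrite Rabs_mult, pow_1_abs, Rmult_1_l.
      rewrite Rabs_pos_eq by (apply Rlt_le, Rinv_0_lt_compat, lt_0_INR, lt_O_fact). ring. }
    rewrite Q. lra.
Qed.

Lemma cos_taylor_error n z :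
  Cmod (cos_taylor n z - Ccos z)%C <= 2 * exp (2 * Cmod z) * (Cmod z ^ S (2 * n) / INR (fact (2 * n))).
Proof.
  assert (H1 := exp_taylor_error (2 * n) (Ci * z)).
  assert (H2 := exp_taylor_error (2 * n) (- (Ci * z))).
  rewrite Cmod_opp in H2. rewrite Cmod_mult, Cmod_Ci, Rmult_1_l in H1, H2.
  replace (cos_taylor n z - Ccos z)%C with
    (((exp_taylor (2 * n) (Ci * z) - Cexp (Ci * z)) + (exp_taylor (2 * n) (- (Ci * z)) - Cexp (- (Ci * z)))) / 2)%C.
  - rewrite Cmod_div by (intros X; apply RtoC_inj in X; lra). rewrite Cmod_R, Rabs_pos_eq by lra.
    assert (T := Cmod_triangle (exp_taylor (2 * n) (Ci * z) - Cexp (Ci * z)) (exp_taylor (2 * n) (- (Ci * z)) - Cexp (- (Ci * z)))).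
    lra.
  - rewrite cos_taylor_exp. unfold Ccos. field.
Qed.

Definition taylor_kernel (s : C) (th : R) (n : nat) (t : R) : C :=
  (kernel s t * cos_taylor n (RtoC th * ((1 / 2)%R, t)))%C.

Lemma Cdiff_cos_taylor n th w : Cdiff (fun w => cos_taylor n (RtoC th * w)) w.
Proof.
  assert (H : Cdiff (fun w => RtoC th * w)%C w)
    by (apply Cdiff_mult; [apply Cdiff_const|apply Cdiff_id]).
  induction n; [apply (Cdiff_const 1)|].
  apply Cdiff_plus; auto. apply Cdiff_mult; [apply Cdiff_const|now apply Cdiff_pow].
Qed.

Lemma taylor_kernel_cont s th n t : RCcont (taylor_kernel s th n) t.
Proof.
  apply RCcont_mult; [apply kernel_cont|].
  apply (half_line_cont (fun w => cos_taylor n (RtoC th * w))). intros; apply Cdiff_cos_taylor.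
Qed.

Lemma taylor_kernel_int s th n :
  is_line_int (taylor_kernel s th n)
    (csum (fun k => RtoC ((-1) ^ k / INR (fact (2 * k))) * RtoC (th ^ (2 * k))
       * lindelof (s - RtoC (INR (2 * k))))%C n).
Proof.
  induction n.
  - rewrite csum_O.
    replace (taylor_kernel s th 0) with (kernel s)
      by (apply functional_extensionality; intros; unfold taylor_kernel; simpl; ring).
    simpl. replace (s - 0)%C with s by ring. replace (1 / 1) with 1 by field.
    replace (1 * 1 * lindelof s)%C with (lindelof s) by ring. apply lindelof_correct.
  - rewrite csum_S. set (k := S n) in *.
    assert (P := is_line_int_mult (RtoC ((-1) ^ k / INR (fact (2 * k))) * RtoC (th ^ (2 * k)))%C _ _
      (kernel_cont (s - RtoC (INR (2 * k)))) (lindelof_correct (s - RtoC (INR (2 * k))))).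
    assert (Q := is_line_int_plus _ _ _ _ (taylor_kernel_cont s th n)
      (fun t => RCcont_mult _ _ t (RCcont_const _ t) (kernel_cont (s - RtoC (INR (2 * k))) t)) IHn P).
    replace (taylor_kernel s th k) with
     (fun t : R => (taylor_kernel s th n t + RtoC ((-1) ^ k / INR (fact (2 * k))) * RtoC (th ^ (2 * k)) *
         kernel (s - RtoC (INR (2 * k))) t)%C); [exact Q|].
    apply functional_extensionality; intros t. unfold taylor_kernel.
    change (cos_taylor k (RtoC th * ((1 / 2)%R, t))) with
      (cos_taylor n (RtoC th * ((1 / 2)%R, t)) + RtoC ((-1) ^ k / INR (fact (2 * k))) * (RtoC th * ((1 / 2)%R, t)) ^ (2 * k))%C.
    unfold kernel at 2. rewrite Cpower_minus_nat by (simpl; lra).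
    rewrite Cpow_mult_l, RtoC_pow. unfold kernel. ring.
Qed.

Lemma Cmod_taylor_kernel s th n t : Rabs th <= PI -> 0 <= Re s ->
  Cmod (taylor_kernel s th n t) <= (2 * exp PI * kernel_bound s) * exp (- Re s * ln_1_abs t).
Proof.
  intros Hth Hs. unfold taylor_kernel. rewrite Cmod_mult.
  assert (HPI := PI_RGT_0).
  (* Since |th w| <= PI + |PI t|, the polynomial is at most exp PI times 2 cosh (PI t), and the
     hyperbolic cosine cancels that of the kernel. *)
  apply Rle_trans with (kernel_bound s * (exp (- Re s * ln_1_abs t) * / cosh (PI * t)) * (exp PI * (2 * cosh (PI * t)))).
  - apply Rmult_le_compat; auto using Cmod_ge_0, Cmod_kernel.
    eapply Rle_trans; [apply Cmod_cos_taylor_le|].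
    apply Rle_trans with (exp (PI + Rabs (PI * t))).
    + apply exp_le. rewrite Cmod_mult, Cmod_R, Rabs_mult, (Rabs_pos_eq PI) by lra.
      assert (X := Cmod_R_le (1 / 2) t). rewrite (Rabs_pos_eq (1 / 2)) in X by lra.
      assert (Y := Rabs_pos th). assert (Z := Cmod_ge_0 ((1 / 2)%R, t)). assert (Z' := Rabs_pos t).
      apply Rle_trans with (PI * (1 / 2 + Rabs t)); [apply Rmult_le_compat; auto|nra].
    + rewrite exp_plus. apply Rmult_le_compat_l; [apply Rlt_le, exp_pos|apply exp_abs_le_cosh].
  - right. field. generalize (cosh_ge_1 (PI * t)); lra.
Qed.

Lemma taylor_kernel_lim s th : 1 < Re s -> Rabs th <= PI ->
  Clim (fun n => line_int (taylor_kernel s th n)) (shifted_int s th 0).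
Proof.
  intros Hs Hth. assert (HPI := PI_RGT_0).
  (* Large enough for one weight to dominate both the Taylor approximants and their limit. *)
  set (K := 2 * exp PI * kernel_bound s).
  assert (Kb : 0 < kernel_bound s) by apply exp_pos.
  assert (EP : 1 <= exp PI) by (generalize (exp_ineq1_le PI); lra).
  assert (HK : kernel_bound s <= K) by (unfold K; nra).
  apply (line_int_dominated _ _ (taylor_kernel s th) (line_summand s th 0)
    (weight_scal _ _ K ltac:(lra) (weight_ln_1_abs (Re s) Hs))).
  - intros; apply taylor_kernel_cont.
  - intros; apply line_summand_cont.
  - intros; apply Cmod_taylor_kernel; auto; lra.
  - intros t. eapply Rle_trans; [apply line_summand_dominated; auto; lra|].
    apply Rmult_le_compat_r; [apply Rlt_le, exp_pos|].
    replace (2 * Rabs (Im s) + 2 * Re s) with (2 * Rabs (Im s) + 2 * Rabs (Re s))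
      by (rewrite (Rabs_pos_eq (Re s)); lra). exact HK.
  - intros T eps Heps.
    (* [B] bounds |th w| for |t| <= T; the Taylor error there is at most [k] times B^(2n) / (2n)!,
       which tends to 0. *)
    set (B := PI * (1 + Rabs T)). assert (HB : 0 < B) by (unfold B; generalize (Rabs_pos T); nra).
    set (k := kernel_bound s * (2 * exp (2 * B) * B)).
    assert (Hk : 0 < k).
    { assert (X := exp_pos (2 * B)). unfold k. apply Rmult_lt_0_compat; [lra|]. apply Rmult_lt_0_compat; lra. }
    destruct (cv_speed_pow_fact B (eps / k)) as [N HN]; [apply Rdiv_lt_0_compat; lra|].
    exists N. intros n t Ln Lt.
    specialize (HN (2 * n)%nat ltac:(lia)). unfold Rdist in HN. rewrite Rminus_0_r in HN.
    assert (Ff : 0 < INR (fact (2 * n))) by (apply lt_0_INR, lt_O_fact).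
    rewrite Rabs_pos_eq in HN
      by (apply Rmult_le_pos; [apply pow_le; lra|apply Rlt_le, Rinv_0_lt_compat; auto]).
    set (z := (RtoC th * ((1 / 2)%R, t))%C).
    assert (Hz : Cmod z <= B).
    { unfold z. rewrite Cmod_mult, Cmod_R. assert (X := Cmod_R_le (1 / 2) t).
      rewrite (Rabs_pos_eq (1 / 2)) in X by lra.
      assert (Rabs t <= Rabs T) by (eapply Rle_trans; [exact Lt|apply Rle_abs]).
      apply Rmult_le_compat; auto using Rabs_pos, Cmod_ge_0; lra. }
    assert (Hz0 := Cmod_ge_0 z).
    replace (taylor_kernel s th n t - line_summand s th 0 t)%C
      with (kernel s t * (cos_taylor n z - Ccos z))%C.
    2:{ unfold taylor_kernel, line_summand, summand, kernel, z. simpl INR. rewrite Rplus_0_l. ring. }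
    rewrite Cmod_mult.
    assert (Hker : Cmod (kernel s t) <= kernel_bound s).
    { eapply Rle_trans; [apply Cmod_kernel|]. rewrite <- (Rmult_1_r (kernel_bound s)) at 2.
      apply Rmult_le_compat_l; [lra|]. rewrite <- (Rmult_1_r 1).
      apply Rmult_le_compat; [apply Rlt_le, exp_pos|apply Rlt_le, inv_cosh_pos| |].
      - rewrite <- exp_0. apply exp_le. generalize (ln_1_abs_ge_0 t); nra.
      - rewrite <- Rinv_1. apply Rinv_le_contravar; [lra|apply cosh_ge_1]. }
    assert (Herr : Cmod (cos_taylor n z - Ccos z)%C <= 2 * exp (2 * B) * B * (B ^ (2 * n) / INR (fact (2 * n)))).
    { eapply Rle_trans; [apply cos_taylor_error|].
      apply Rle_trans with (2 * exp (2 * B) * (B ^ S (2 * n) / INR (fact (2 * n)))).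
      - apply Rmult_le_compat.
        + generalize (exp_pos (2 * Cmod z)); lra.
        + apply Rmult_le_pos; [apply pow_le; lra|apply Rlt_le, Rinv_0_lt_compat; auto].
        + apply Rmult_le_compat_l; [lra|]. apply exp_le; lra.
        + apply Rmult_le_compat_r; [apply Rlt_le, Rinv_0_lt_compat; auto|]. apply pow_incr; lra.
      - right. rewrite <- tech_pow_Rmult. field. lra. }
    apply Rle_trans with (k * (B ^ (2 * n) / INR (fact (2 * n)))).
    + unfold k. rewrite Rmult_assoc. apply Rmult_le_compat; auto using Cmod_ge_0.
    + apply Rle_trans with (k * (eps / k)); [|right; field; lra].
      apply Rmult_le_compat_l; lra.
Qed.

Theorem theorem3p6 (eta : C -> C) (Heta : is_alternating_zeta eta)
  (c : R) (hc : 0 < c) (s : C) (hs : 1 < Re s) (x : R) (hx : Rabs x <= c) :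
  exists l : C,
    @is_series C_AbsRing C_NormedModule
      (fun m : nat =>
         RtoC ((-1) ^ m) / nat_Cpower (S m) s
         * RtoC (cos (INR (S m) * PI * x / c)))%C l
    /\
    @is_series C_AbsRing C_NormedModule
      (fun k : nat =>
         RtoC ((-1) ^ k / INR (fact (2 * k)))
         * RtoC ((PI * x / c) ^ (2 * k))
         * eta (s - RtoC (INR (2 * k))))%C l.
Proof.
  set (th := PI * x / c).
  assert (HPI := PI_RGT_0).
  assert (Hth : Rabs th <= PI).
  { unfold th, Rdiv. rewrite !Rabs_mult, Rabs_inv, (Rabs_pos_eq PI), (Rabs_pos_eq c) by lra.
    apply Rmult_le_reg_r with c; auto. rewrite Rmult_assoc, Rinv_l, Rmult_1_r by lra.
    apply Rmult_le_compat_l; lra. }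
  (* The common value of both series is Lindelöf's integral over the line Re w = 1/2, with the
     cosine inside. *)
  exists (shifted_int s th 0 / 2)%C. split.
  - apply is_series_Clim. eapply Clim_ext; [|apply (alternating_cos_series s th hs Hth)].
    intros n. apply (@sum_n_ext C_AbelianMonoid). intros m.
    unfold summand. rewrite Cpower_nat, <- RtoC_mult, Ccos_R.
    replace (th * INR (S m)) with (INR (S m) * PI * x / c) by (unfold th; field; lra).
    unfold Cdiv. apply Cmult_assoc.
  - apply is_series_Clim.
    assert (H := Clim_mult_const (/ 2)%C _ _ (taylor_kernel_lim s th hs Hth)).
    unfold Cdiv. rewrite Cmult_comm. eapply Clim_ext; [|exact H].
    intros n. cbv beta. rewrite (line_int_eq _ _ (taylor_kernel_int s th n)).
    induction n.
    + rewrite !csum_O, (alternating_zeta_eq eta Heta). unfold Cdiv. ring.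
    + rewrite !csum_S, Cmult_plus_distr_l, IHn, (alternating_zeta_eq eta Heta). unfold Cdiv. ring.
Qed.
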